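(* Let $\Omega\subset\mathbb{R}^d$ be compact, $\tilde\Omega=\Omega\times[0,1]$, $C>0$, $\sigma\in(0,1)$, and let $\Lambda^\star:\mathrm{Lip}_C^\sigma(\tilde\Omega)\times\tilde\Omega\to\mathbb{R}^{d'}$ be continuous (weak$^*$ topology on $\mathrm{Lip}_C^\sigma(\tilde\Omega)$, Euclidean topology on $\tilde\Omega$) and causal identifiable. Then for every $\varepsilon>0$ there exist $L\in\mathbb{N}$, masked attention parameters $\theta_1,\dots,\theta_L$ and MLPs $F_{\xi_1},\dots,F_{\xi_L}$ such that $$\forall(\mu,x,t)\in\mathrm{Lip}_C^\sigma(\tilde\Omega)\times\tilde\Omega,\qquad\big|F_{\xi_L}\diamond\Gamma_{\theta_L}\diamond\cdots\diamond F_{\xi_1}\diamond\Gamma_{\theta_1}(\mu,x,t)-\Lambda^\star(\mu,x,t)\big|\le\varepsilon,$$ with $d_{\mathrm{in}}(\theta_\ell)\le d+3d'$, $d_{\mathrm{head}}(\theta_\ell)=k(\theta_\ell)=1$, $H(\theta_\ell)\le d'$ for all $\ell$.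
   Context: For a probability measure $\mu$ on $\mathbb{R}^m\times[0,1]$, $\bar\mu=P_\sharp\mu$ is its time marginal, $P(x,t)=t$. $\mathrm{Lip}_C^\sigma(\tilde\Omega)$ is the set of $\mu\in\mathcal{P}(\tilde\Omega)$ with $\bar\mu(\{0\})\ge\sigma$ admitting a disintegration $d\mu(x,s)=d\mu(x|s)\,d\bar\mu(s)$ such that $s\mapsto\mu(\cdot|s)\in\mathcal{P}(\Omega)$ satisfies $W_2(\mu(\cdot|s),\mu(\cdot|t))\le C|s-t|$ for all $s,t\in[0,1]$ ($W_2$ the 2-Wasserstein distance). Masked measure: for $t\in[0,1]$, $\mu_t=\frac{1_{[0,t]}}{\bar\mu([0,t])}\cdot\mu$ (at $t=0$ this is $\mu(\cdot|0)\otimes\delta_0$). A map $\Lambda$ on $\mathrm{Lip}_C^\sigma(\tilde\Omega)\times\tilde\Omega$ is causal if $\Lambda(\mu,x,t)=\Lambda(\mu_t,x,t)$ for all $(\mu,x,t)$, and identifiable if for all $\mu\in\mathrm{Lip}_C^\sigma(\tilde\Omega)$ and $t,t'\in[0,1]$, $\mu_t=\mu_{t'}$ implies $\Lambda(\mu_t,\cdot,t)=\Lambda(\mu_{t'},\cdot,t')$. Masked attention with parameters $\theta=(W^h,K^h,Q^h,V^h)_{h=1}^H$ ($K^h,Q^h\in\mathbb{R}^{k\times d_{\mathrm{in}}}$, $V^h\in\mathbb{R}^{d_{\mathrm{head}}\times d_{\mathrm{in}}}$, $W^h\in\mathbb{R}^{d_{\mathrm{in}}\times d_{\mathrm{head}}}$;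 sizes $d_{\mathrm{in}}(\theta),d_{\mathrm{head}}(\theta),k(\theta),H(\theta)$): for a compactly supported probability measure $\mu$ on $\mathbb{R}^{d_{\mathrm{in}}}\times[0,1]$ with $\bar\mu(\{0\})>0$ and $(x,t)\in\mathbb{R}^{d_{\mathrm{in}}}\times[0,1]$, $$\Gamma_\theta(\mu,x,t)=x+\sum_{h=1}^HW^h\int\frac{\exp(\frac1{\sqrt k}\langle Q^hx,K^hy\rangle)1_{[0,t]}(r)}{\int\exp(\frac1{\sqrt k}\langle Q^hx,K^hz\rangle)1_{[0,t]}(s)\,d\mu(z,s)}V^hy\,d\mu(y,r).$$ An MLP is a map $A_K\circ\rho\circ\cdots\circ\rho\circ A_1$ with affine $A_j$ and componentwise ReLU $\rho$ (affine maps allowed), regarded as a context-free map $F(\mu,x,t)=F(x)$. Masked composition: $(\Gamma_2\diamond\Gamma_1)(\mu,x,t)=\Gamma_2(\mu_1,\Gamma_1(\mu,x,t),t)$ with $\mu_1$ the push-forward of $\mu$ by $(x,t)\mapsto(\Gamma_1(\mu,x,t),t)$. Dimensions compatible: $d_{\mathrm{in}}(\theta_1)=d$, $F_{\xi_\ell}:\mathbb{R}^{d_{\mathrm{in}}(\theta_\ell)}\to\mathbb{R}^{d_{\mathrm{in}}(\theta_{\ell+1})}$, $F_{\xi_L}$ maps into $\mathbb{R}^{d'}$. *)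

(* Defs.v *)
From HB Require Import structures.
From mathcomp Require Import all_boot all_order all_algebra.
From mathcomp Require Import all_classical all_reals all_analysis measurable_realfun.
Set Implicit Arguments. Unset Strict Implicit. Unset Printing Implicit Defensive.
Import Order.TTheory GRing.Theory Num.Theory numFieldNormedType.Exports.
Local Open Scope classical_set_scope.
Local Open Scope ring_scope.

Section Defs.
Variable R : realType.

Definition borelV (n : nat) := g_sigma_algebraType (@open 'cV[R]_n).

(** The space R^n x R (space x time) with the product sigma-algebra
    (= Borel sigma-algebra of R^n x R). *)
Definition pt (n : nat) := (borelV n * R)%type.

Definition meas (n : nat) := set (pt n) -> \bar R.

Definition enorm2 n (v : 'cV[R]_n) : R := \sum_(i < n) v i 0 ^+ 2.
Definition enorm n (v : 'cV[R]_n) : R := Num.sqrt (enorm2 v).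

Definition I01 : set R := [set t | 0 <= t <= 1].
Definition Itv0 (t : R) : set R := [set s | 0 <= s <= t].

Definition coupling n (nu1 nu2 : set (borelV n) -> \bar R)
    (g : probability (borelV n * borelV n)%type R) : Prop :=
  forall A : set (borelV n), measurable A ->
    g (A `*` setT) = nu1 A /\ g (setT `*` A) = nu2 A.

Definition W2 n (nu1 nu2 : set (borelV n) -> \bar R) : \bar R :=
  poweR (ereal_inf [set (\int[g]_z (enorm2 ((z.1 : 'cV[R]_n) - z.2))%:E)%E
                   | g in [set g | coupling nu1 nu2 g]]) (2^-1).

Definition tmarg n (mu : meas n) : set R -> \bar R := fun B => mu (setT `*` B).

Definition Lip n (Om : set 'cV[R]_n) (C sig : R) (mu : meas n) : Prop :=
  (exists P : probability (pt n) R, (P : set (pt n) -> \bar R) = mu) /\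
  mu (Om `*` I01) = 1%E /\
  (sig%:E <= tmarg mu [set 0%R])%E /\
  exists kappa : R -> probability (borelV n) R,
    (forall s, I01 s -> kappa s Om = 1%E) /\
    (forall A : set (borelV n), measurable A ->
       measurable_fun [set: R] (fun s : R => kappa s A : \bar R)) /\
    (forall (A : set (borelV n)) (B : set R), measurable A -> measurable B ->
       mu (A `*` B) = (\int[tmarg mu]_(s in B) kappa s A)%E) /\
    (forall s t, I01 s -> I01 t -> (W2 (kappa s) (kappa t) <= (C * `|s - t|)%:E)%E).

Definition mask n (mu : meas n) (t : R) : meas n :=
  fun A => (mu (A `&` (setT `*` Itv0 t)) * ((fine (tmarg mu (Itv0 t)))^-1)%:E)%E.

Definition cmap n m := meas n -> 'cV[R]_n -> R -> 'cV[R]_m.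

Definition causal n m (Om : set 'cV[R]_n) (C sig : R) (Lam : cmap n m) : Prop :=
  forall mu x t, Lip Om C sig mu -> Om x -> I01 t -> Lam mu x t = Lam (mask mu t) x t.

Definition identifiable n m (Om : set 'cV[R]_n) (C sig : R) (Lam : cmap n m) : Prop :=
  forall mu t t', Lip Om C sig mu -> I01 t -> I01 t' -> mask mu t = mask mu t' ->
    forall x, Om x -> Lam (mask mu t) x t = Lam (mask mu t') x t'.

(** Continuity on Lip_C^sigma(Omega~) x Omega~, for the (subspace) weak-*
    topology on measures times the Euclidean topology: at every point, for every
    eps > 0 there is a basic weak-* neighbourhood (finitely many continuous test
    functions f_i and a tolerance del) and a Euclidean ball on which the values
    stay eps-close. *)
Definition weak_cont n m (Om : set 'cV[R]_n) (C sig : R) (Lam : cmap n m) : Prop :=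
  forall mu x t, Lip Om C sig mu -> Om x -> I01 t ->
  forall eps : R, 0 < eps ->
  exists (k : nat) (f : 'I_k -> ('cV[R]_n * R)%type -> R) (del : R),
    0 < del /\ (forall i, continuous (f i)) /\
    forall nu y s, Lip Om C sig nu -> Om y -> I01 s ->
      (forall i, `| fine (\int[nu]_z (f i z)%:E)%E
                  - fine (\int[mu]_z (f i z)%:E)%E | < del) ->
      enorm (y - x) < del -> `| s - t | < del ->
      enorm (Lam nu y s - Lam mu x t) < eps.

Record attn (din : nat) := Attn {
  nheads : nat;
  dhead : nat;
  kdim : nat;
  Wm : 'I_nheads -> 'M[R]_(din, dhead);
  Km : 'I_nheads -> 'M[R]_(kdim, din);
  Qm : 'I_nheads -> 'M[R]_(kdim, din);
  Vm : 'I_nheads -> 'M[R]_(dhead, din) }.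

Definition score n (th : attn n) (h : 'I_(nheads th)) (x y : 'cV[R]_n) : R :=
  expR ((Num.sqrt (kdim th)%:R)^-1 *
        \sum_(i < kdim th) ((Qm h *m x) i 0 * (Km h *m y) i 0)).

Definition Gamma n (th : attn n) : cmap n n := fun mu x t =>
  x + \sum_(h < nheads th) Wm h *m
    \col_(j < dhead th) fine (\int[mu]_p
       ((score h x p.1 * \1_(Itv0 t) p.2 /
           fine (\int[mu]_q (score h x q.1 * \1_(Itv0 t) q.2)%:E)%E)
        * (Vm h *m p.1) j 0)%:E)%E.

Inductive mlp : nat -> nat -> Type :=
| mlp_aff n m : 'M[R]_(m, n) -> 'cV[R]_m -> mlp n m
| mlp_cons n p m : 'M[R]_(p, n) -> 'cV[R]_p -> mlp p m -> mlp n m.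

Definition relu n (v : 'cV[R]_n) : 'cV[R]_n := map_mx (fun a => Num.max a 0) v.

Fixpoint mlp_eval n m (F : mlp n m) : 'cV[R]_n -> 'cV[R]_m :=
  match F in mlp n m return 'cV[R]_n -> 'cV[R]_m with
  | mlp_aff _ _ A b => fun x => A *m x + b
  | mlp_cons _ _ _ A b G => fun x => mlp_eval G (relu (A *m x + b))
  end.

Definition ctxfree n m (f : 'cV[R]_n -> 'cV[R]_m) : cmap n m := fun _ x _ => f x.

Definition diamond n p m (G2 : cmap p m) (G1 : cmap n p) : cmap n m :=
  fun mu x t =>
    G2 (pushforward mu (fun z : pt n => ((G1 mu z.1 z.2 : borelV p), z.2) : pt p))
       (G1 mu x t) t.

(** Networks  F_L <> Gamma_L <> ... <> F_1 <> Gamma_1  with L >= 1 layers,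
    dimension-compatible by construction. *)
Inductive net : nat -> nat -> Type :=
| net_one n m : attn n -> mlp n m -> net n m
| net_cons n p m : attn n -> mlp n p -> net p m -> net n m.

Fixpoint net_eval n m (N : net n m) : cmap n m :=
  match N in net n m return cmap n m with
  | net_one _ _ th F => diamond (ctxfree (mlp_eval F)) (Gamma th)
  | net_cons _ _ _ th F N' =>
      diamond (net_eval N') (diamond (ctxfree (mlp_eval F)) (Gamma th))
  end.

Fixpoint net_all (P : forall n, attn n -> Prop) n m (N : net n m) : Prop :=
  match N with
  | net_one n _ th _ => P n th
  | net_cons n _ _ th _ N' => P n th /\ net_all P N'
  end.

End Defs.

(* Main.v *)
Require Import Defs.
From HB Require Import structures.
From mathcomp Require Import all_boot all_order all_algebra.
From mathcomp Require Import all_classical all_reals all_analysis measurable_realfun.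
From mathcomp Require Import ring lra.
Set Implicit Arguments. Unset Strict Implicit. Unset Printing Implicit Defensive.
Import Order.TTheory GRing.Theory Num.Theory numFieldNormedType.Exports.
Local Open Scope classical_set_scope.
Local Open Scope ring_scope.

(** The hypotheses on [Lam] leave it very little freedom. If the time marginal
    of a measure is carried by a finite grid, its masked measures are constant
    in [t] between grid points, so causality and identifiability make [Lam]
    constant there, and continuity in [t] closes the gaps at the grid points:
    [Lam mu x t] does not depend on [t], and by causality at [t = 0] it depends
    only on [x] and on the conditional law [nu] at time [0]. Discretising time
    and using weak continuity, this holds for every [mu] in the Lipschitz class.

    By weak compactness of the probabilities on [Om], the resulting function of
    [(nu, x)] is uniformly continuous in finitely many moments of [nu] and in the
    coordinates of [x], so it is approximated by a McShane formula
    [min_j (v_j + K max_i |c_i - c_ji|)] in these features.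

    This formula is computed register by register. The only attention head
    needed has [Q = K = 0] and averages one register over the past: the update
    [r <- (r + mean of r over the past) / 2] keeps the mean of [r] at time [0] and,
    as at least a fraction [sig] of the past mass sits at time [0], brings [r]
    geometrically close to that mean, that is, to a moment of [nu]. *)

(** * Integrals against probabilities *)

(** A network sees time only through the mask, and a masked average mixes time 0 with the rest of
    the past. So a moment of the initial law is approached by repeated contraction, at rate
    [1 - sig / 2].

    The width bound shapes the program. The number of moments grows with the precision, while only
    [d + 2 + d'] registers are available. No list of moments is stored: each moment is recomputed
    from the untouched token whenever the formula calls for it. Maxima and minima are nonexpansive,
    so the errors of successive moments do not accumulate.

    The Wasserstein bound is used in the discretisation. The atoms reuse the kernel at the grid
    points, which keeps the discrete measure in the class, and near-optimal couplings turn a small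
    time shift into a small change of test integrals.

    Weak compactness is built by hand. A probability is coded by the masses of binary cells,
    compactness of the codes is Tychonoff's theorem, and a uniform variable realises each code as a
    law. Uniform continuity then needs no topology on measures, only a compact parameter space and a
    filter of finite test families. *)

Section ProbabilityIntegral.
Context d (T : measurableType d) (R : realType).
Implicit Types P : probability T R.

Lemma prob1_compl P S : measurable S -> P S = 1%E -> P (~` S) = 0%E.
Proof. by move=> mS PS; rewrite probability_setC // PS subee. Qed.

Lemma prob1_setI P S A : measurable S -> P S = 1%E -> measurable A ->
  P (A `&` S) = P A.
Proof.
move=> mS PS mA; have Z : P (A `\` S) = 0%E.
  apply/eqP; rewrite eq_le measure_ge0 andbT -(prob1_compl mS PS).
  by apply: le_measure; rewrite ?inE; [exact: measurableD|exact: measurableC|move=> x []].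
transitivity (P (A `\` S) + P (A `&` S))%E; first by rewrite Z add0e.
by rewrite -(measureDI P mA mS).
Qed.

(** The bound is asked only on a set of full measure: the integrands are often continuous on the
    whole space but controlled only on a compact set that carries [P]. *)
Lemma prob1_integrable P (S : set T) (f : T -> R) (B : R) :
  measurable S -> P S = 1%E -> measurable_fun setT f ->
  (forall x, S x -> `|f x| <= B) -> P.-integrable setT (EFin \o f).
Proof.
move=> mS PS mf fB.
have mCS : measurable (~` S) by exact: measurableC.
rewrite (negligible_integrable mCS) //; last 2 first.
- exact/measurable_EFinP.
- exact: prob1_compl.
rewrite setTD setCK; apply: measurable_bounded_integrable => //.
- by change (P S < +oo)%E; rewrite PS ltry.
- exact: measurable_funTS.
- exists B; split; first exact: num_real.
  by move=> M BM x Sx; apply: le_trans (fB _ Sx) _; exact: ltW.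
Qed.

Lemma bounded_prob_integrable P (f : T -> R) (B : R) :
  measurable_fun setT f -> (forall x, `|f x| <= B) ->
  P.-integrable setT (EFin \o f).
Proof.
move=> mf fB; apply: (@prob1_integrable P setT f B) => //.
exact: probability_setT.
Qed.

Lemma prob_Rintegral_cst P (c : R) : \int[P]_x c = c.
Proof.
by rewrite Rintegral_cst // -[X in _ * fine X]/(P setT) probability_setT mulr1.
Qed.

Lemma prob1_Rintegral P (S : set T) (f : T -> R) (B : R) :
  measurable S -> P S = 1%E -> measurable_fun setT f ->
  (forall x, S x -> `|f x| <= B) -> \int[P]_x f x = \int[P]_(x in S) f x.
Proof.
move=> mS PS mf fB; rewrite /Rintegral.
have mCS : measurable (~` S) by exact: measurableC.
rewrite (negligible_integral mCS) // ?setTD ?setCK //.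
- exact: (prob1_integrable mS PS mf fB).
- exact: prob1_compl.
Qed.

Lemma Rintegral_close P (S : set T) (f g : T -> R) (B eta : R) :
  measurable S -> P S = 1%E -> measurable_fun setT f -> measurable_fun setT g ->
  (forall x, S x -> `|f x| <= B) -> (forall x, S x -> `|g x| <= B) ->
  (forall x, S x -> `|f x - g x| <= eta) ->
  `|\int[P]_x f x - \int[P]_x g x| <= eta.
Proof.
move=> mS PS mf mg fB gB fg.
have If := prob1_integrable mS PS mf fB.
have Ig := prob1_integrable mS PS mg gB.
have mfg : measurable_fun setT (f \- g) by exact: measurable_funB.
have fgB x : S x -> `|(f \- g) x| <= eta by exact: fg.
have Ifg := prob1_integrable mS PS mfg fgB.
rewrite -RintegralB // (prob1_Rintegral mS PS mfg fgB).
have IfgS : P.-integrable S (EFin \o (f \- g)).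
  exact: (@integrableS _ _ _ _ setT).
apply: (le_trans (le_normr_Rintegral mS IfgS)).
apply: (@le_trans _ _ (\int[P]_(x in S) eta)).
  apply: le_Rintegral => //.
  - exact: integrable_norm.
  - apply: (@integrableS _ _ _ _ setT) => //.
    exact: (@bounded_prob_integrable P (cst eta) `|eta|).
by rewrite Rintegral_cst // -[X in _ * fine X]/(P S) PS /= mulr1.
Qed.

Lemma Rintegral_norm_le P (S : set T) (f : T -> R) (B : R) :
  measurable S -> P S = 1%E -> measurable_fun setT f ->
  (forall x, S x -> `|f x| <= B) -> `|\int[P]_x f x| <= B.
Proof.
move=> mS PS mf fB.
have := @Rintegral_close P S f (cst 0) `|B| B mS PS mf.
rewrite prob_Rintegral_cst subr0; apply.
- exact: measurable_cst.
- by move=> x Sx; rewrite (le_trans (fB _ Sx)) // ler_norm.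
- by move=> x _; rewrite /= normr0.
- by move=> x Sx /=; rewrite subr0; exact: fB.
Qed.

Lemma eq_Rintegral_prob1 P (S : set T) (f g : T -> R) (B : R) :
  measurable S -> P S = 1%E -> measurable_fun setT f -> measurable_fun setT g ->
  (forall x, S x -> `|f x| <= B) -> (forall x, S x -> f x = g x) ->
  \int[P]_x f x = \int[P]_x g x.
Proof.
move=> mS PS mf mg fB fg; apply/eqP; rewrite -subr_eq0 -normr_le0.
apply: (Rintegral_close mS PS mf mg fB) => x Sx.
  by rewrite -fg //; exact: fB.
by rewrite fg // subrr normr0.
Qed.

Lemma prob1_le_Rintegral P (S : set T) (f g : T -> R) (B : R) :
  measurable S -> P S = 1%E -> measurable_fun setT f -> measurable_fun setT g ->
  (forall x, S x -> `|f x| <= B) -> (forall x, S x -> `|g x| <= B) ->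
  (forall x, S x -> f x <= g x) -> \int[P]_x f x <= \int[P]_x g x.
Proof.
move=> mS PS mf mg fB gB fg.
rewrite (prob1_Rintegral mS PS mf fB) (prob1_Rintegral mS PS mg gB).
apply: le_Rintegral => //.
- by apply: (@integrableS _ _ _ _ setT) => //; exact: prob1_integrable mS PS mf fB.
- by apply: (@integrableS _ _ _ _ setT) => //; exact: prob1_integrable mS PS mg gB.
Qed.

Lemma Rintegral_sum P (F : finType) (f : F -> T -> R) :
  (forall w, P.-integrable setT (EFin \o f w)) ->
  \int[P]_x (\sum_w f w x) = \sum_w \int[P]_x f w x.
Proof.
move=> If.
suff H (s : seq F) : P.-integrable setT (EFin \o (fun x => \sum_(w <- s) f w x)) /\
    \int[P]_x (\sum_(w <- s) f w x) = \sum_(w <- s) \int[P]_x f w x.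
  by have [] := H (index_enum F).
elim: s => [|w s [IHi IH]].
  rewrite (_ : (fun x => _) = cst 0); last by apply/funext => x; rewrite big_nil.
  rewrite big_nil prob_Rintegral_cst; split=> //.
  by apply: (@bounded_prob_integrable P (cst 0) 0) => // x; rewrite normr0.
rewrite (_ : (fun x => _) = (fun x => f w x + \sum_(v <- s) f v x)); last first.
  by apply/funext => x; rewrite big_cons.
rewrite big_cons -IH -RintegralD //; split=> //.
by have := integrableD measurableT (If w) IHi; apply: eq_integrable.
Qed.

Lemma Rintegral_indic P (A : set T) : measurable A ->
  \int[P]_x \1_A x = fine (P A).
Proof. by move=> mA; rewrite /Rintegral integral_indic // setIT. Qed.

(** This is how masses of cells determine integrals, both in the coding of probabilities and when a
    disintegration known on rectangles is applied to functions. *)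
Lemma Rintegral_finite_valued P (F : finType) (W : T -> F) (h : F -> R) :
  (forall w, measurable (W @^-1` [set w])) ->
  \int[P]_x h (W x) = \sum_w h w * fine (P (W @^-1` [set w])).
Proof.
move=> mW.
have hE x : h (W x) = \sum_w h w * \1_(W @^-1` [set w]) x.
  rewrite (bigD1 (W x)) //= big1 ?addr0.
    by rewrite indicE mem_set ?mulr1.
  move=> w wW; rewrite indicE memNset ?mulr0 // => /= H.
  by rewrite H eqxx in wW.
rewrite (@eq_Rintegral _ _ _ P setT (fun x => \sum_w h w * \1_(W @^-1` [set w]) x)); last first.
  by move=> x _; exact: hE.
rewrite Rintegral_sum; last first.
  move=> w; apply: (@bounded_prob_integrable P _ (\sum_w `|h w|)).
     apply: measurable_funM => //; exact: measurable_indic.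
  move=> x; rewrite (bigD1 w) //= indicE normrM.
  rewrite -[leLHS]addr0; apply: lerD; last by apply: sumr_ge0.
  by case: (_ \in _); rewrite ?normr1 ?normr0 ?mulr1 ?mulr0.
apply: eq_bigr => w _; rewrite RintegralZl //.
  by rewrite Rintegral_indic.
apply: (@bounded_prob_integrable P _ 1) => [|x]; first exact: measurable_indic.
by rewrite indicE; case: (_ \in _); rewrite ?normr1 ?normr0.
Qed.

(** Keeping the mass of [B] as a factor lets the errors over disjoint time cells sum to a single
    error, and yields the factor [1 - sig] for averages over the past. *)
Lemma Rintegral_close_indic P (S B : set T) (f g : T -> R) (M c : R) :
  measurable S -> P S = 1%E -> measurable B ->
  measurable_fun setT f -> measurable_fun setT g ->
  (forall x, S x -> `|f x| <= M) -> (forall x, S x -> `|g x| <= M) ->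
  (forall x, S x -> `|f x - g x| <= c * \1_B x) ->
  `|\int[P]_x f x - \int[P]_x g x| <= c * fine (P B).
Proof.
move=> mS PS mB mf mg fM gM fg.
have i1 x : `|\1_B x : R| <= 1 by rewrite indicE; case: (_ \in _); rewrite ?normr1 ?normr0.
have m1 : measurable_fun setT (\1_B : T -> R) by exact: measurable_indic.
have Ii := bounded_prob_integrable P m1 i1.
rewrite -Rintegral_indic // -RintegralZl // -RintegralB //; last 2 first.
- exact: prob1_integrable mS PS mf fM.
- exact: prob1_integrable mS PS mg gM.
have mfg : measurable_fun setT (fun x => f x - g x) by exact: measurable_funB.
have fgM x : S x -> `|f x - g x| <= `|c|.
  move=> Sx; apply: (le_trans (fg x Sx)); apply: (le_trans (ler_norm _)).
  by rewrite normrM ler_piMr.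
apply: (le_trans (le_normr_Rintegral measurableT (prob1_integrable mS PS mfg fgM))).
apply: (@prob1_le_Rintegral P S _ _ `|c|) => //.
- exact: measurableT_comp.
- exact: measurable_funM.
- by move=> x Sx; rewrite normr_id; exact: fgM.
- by move=> x Sx; rewrite normrM ler_piMr.
Qed.

Lemma eq_Rintegral_measure (P Q : probability T R) (f : T -> R) :
  (forall A, measurable A -> P A = Q A) -> \int[P]_x f x = \int[Q]_x f x.
Proof.
move=> PQ; rewrite /Rintegral; congr fine.
by apply: eq_measure_integral => A mA _; exact: PQ.
Qed.

End ProbabilityIntegral.

(** * Pushforwards and mixtures of probabilities *)

Section ProbabilityConstructions.
Context (R : realType).

Lemma Rintegral_pushforward d d' (T : measurableType d) (T' : measurableType d')
    (P : probability T R) (phi : T -> T') (f : T' -> R) :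
  measurable_fun setT phi -> measurable_fun setT f ->
  fine (\int[pushforward P phi]_y (f y)%:E)%E = \int[P]_x f (phi x).
Proof.
move=> mphi mf; rewrite /Rintegral; congr fine.
rewrite [LHS]integralE [RHS]integralE.
have mEf : measurable_fun setT (EFin \o f) by exact/measurable_EFinP.
congr (_ - _)%E.
  rewrite (ge0_integral_pushforward mphi P measurableT) ?preimage_setT //.
  - by congr integral; apply/funext => x; rewrite /= !funeposE.
  - exact: measurable_funepos.
rewrite (ge0_integral_pushforward mphi P measurableT) ?preimage_setT //.
- by congr integral; apply/funext => x; rewrite /= !funenegE.
- exact: measurable_funeneg.
Qed.

Lemma Rintegral_pushforwardE d d' (T : measurableType d) (T' : measurableType d')
    (P : probability T R) (Q : probability T' R) (phi : T -> T') (f : T' -> R) :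
  (Q : set T' -> \bar R) = pushforward P phi ->
  measurable_fun setT phi -> measurable_fun setT f ->
  \int[Q]_y f y = \int[P]_x f (phi x).
Proof.
move=> QE mphi mf; rewrite -(Rintegral_pushforward P mphi mf) /Rintegral.
exact: (congr1 (fun q : set T' -> \bar R => fine (\int[q]_x (f x)%:E)%E) QE).
Qed.

(** [mnormalize] leaves a measure of mass 1 unchanged and equips it with the structure of a
    probability. *)
Lemma measure_prob d (T : measurableType d) (m : {measure set T -> \bar R}) :
  m setT = 1%E -> exists Q : probability T R, (Q : set T -> \bar R) = m.
Proof.
move=> H; exists (mnormalize m \d_point); apply/funext => A.
by rewrite /= /mnormalize H /= onee_eq0 /= invr1 mule1.
Qed.

Lemma pushforward_prob d d' (T : measurableType d) (T' : measurableType d')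
    (P : probability T R) (phi : T -> T') : measurable_fun setT phi ->
  exists Q : probability T' R, (Q : set T' -> \bar R) = pushforward P phi.
Proof.
move=> mphi.
have [m mE] : exists m : {measure set T' -> \bar R}, (m : set T' -> \bar R) = pushforward P phi.
  by unshelve eexists (pushforward P phi : {measure set T' -> \bar R}).
rewrite -mE; apply: measure_prob.
by rewrite mE /pushforward preimage_setT probability_setT.
Qed.

Lemma mixture_prob d (T : measurableType d) (n : nat) (w : nat -> R)
    (P : nat -> probability T R) :
  (forall i, 0 <= w i) -> \sum_(i < n) w i = 1 ->
  exists Q : probability T R,
    (forall A, Q A = \sum_(i < n) ((w i)%:E * P i A)%E)%E /\
    forall f : T -> R, measurable_fun setT f ->
      (forall i, (i < n)%N -> (P i).-integrable setT (EFin \o f)) ->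
      \int[Q]_x f x = \sum_(i < n) w i * \int[P i]_x f x.
Proof.
move=> w0 w1.
pose m : {measure set T -> \bar R} := msum (fun i => mscale (NngNum (w0 i)) (P i)) n.
have H : m setT = 1%E.
  rewrite /m /= {1}/msum.
  have mE i : mscale (NngNum (w0 i)) (P i) setT = (w i)%:E.
    rewrite -[RHS]mule1; congr (_ * _)%E; exact: probability_setT.
  by rewrite (eq_bigr (fun i : 'I_n => (w i)%:E)) ?sumEFin ?w1 // => i _; exact: mE.
have [Q QE] := measure_prob H; exists Q; split; first by move=> A; rewrite QE.
have IQ (g : T -> \bar R) : (\int[Q]_x g x = \int[m]_x g x)%E.
  exact: (congr1 (fun q : set T -> \bar R => \int[q]_x g x)%E QE).
move=> f mf If.
have mEf : measurable_fun setT (EFin \o f) by exact/measurable_EFinP.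
(* For nonnegative [g] the integral against a finite sum of measures splits. The general case
   applies this to the positive and negative parts of [f], whose integrals are finite by
   hypothesis. *)
have key (g : T -> \bar R) : measurable_fun setT g -> (forall x, 0 <= g x)%E ->
    (forall i, (i < n)%N -> (P i).-integrable setT g) ->
    (\int[m]_x g x = (\sum_(i < n) w i * fine (\int[P i]_x g x))%:E)%E.
  move=> mg g0 Ig; rewrite ge0_integral_measure_sum // -sumEFin.
  apply: eq_bigr => i _; rewrite ge0_integral_mscale // EFinM fineK //.
  by apply: integrable_fin_num => //; exact: Ig.
have Ip i : (i < n)%N -> (P i).-integrable setT ((EFin \o f)^\+)%E by move=> ni;
  apply: integrable_funepos => //; exact: If.
have In i : (i < n)%N -> (P i).-integrable setT ((EFin \o f)^\-)%E by move=> ni;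
  apply: integrable_funeneg => //; exact: If.
rewrite /Rintegral IQ integralE !key //; last 2 first.
- exact: measurable_funeneg.
- exact: measurable_funepos.
rewrite -EFinB /= -sumrB; apply: eq_bigr => i _.
rewrite -mulrBr; congr (_ * _).
have F1 := integrable_fin_num measurableT (Ip i (ltn_ord i)).
have F2 := integrable_fin_num measurableT (In i (ltn_ord i)).
by rewrite -fineB // [X in _ = fine X]integralE.
Qed.

End ProbabilityConstructions.

(** * Continuity, compactness and measurability on column vectors *)

Section Topology.
Context (R : realType).

(** Only [x] has to lie in [K], so this is slightly more than uniform continuity on [K]. Compactness
    is used as a near-covering property along the filter of small positive radii. *)
Lemma compact_unif_continuous (T : pseudoMetricType R) (K : set T) (f : T -> R) :
  compact K -> continuous f -> forall e : R, 0 < e ->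
  exists2 del : R, 0 < del & forall x y, K x -> ball x del y -> `|f x - f y| < e.
Proof.
move=> cK cf e e0.
pose P (del : R) (x : T) := forall y, ball x del y -> `|f x - f y| < e.
have := (iffLR (compact_near_coveringP K) cK) R (0^'+)%R P _.
case; last first.
  move=> d0 /= d0_gt0 H.
  exists (d0 / 2); first by rewrite divr_gt0.
  move=> x y Kx; apply: (H (d0 / 2)) => //.
    rewrite /= sub0r normrN gtr0_norm ?divr_gt0 // ltr_pdivrMr // ltr_pMr //; lra.
  by rewrite divr_gt0.
move=> x Kx.
have e2 : 0 < e / 2 by lra.
have /cvgrPdist_lt /(_ _ e2) /nbhs_ballP [r /= r0 Hr] := cf x.
exists (ball x (r / 2), [set d | 0 < d < r / 2]).
  split => /=; first by apply: nbhsx_ballx; lra.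
  exists (r / 2) => /=; first lra.
  by move=> d /=; rewrite sub0r normrN => H1 H2; rewrite H2 /=; rewrite gtr0_norm in H1.
move=> [x' d] [/= Hx' /andP[d0 dr]] y Hy.
have h1 : `|f x - f x'| < e / 2.
  by apply: Hr; apply: le_ball Hx'; lra.
have h2 : `|f x - f y| < e / 2.
  apply: Hr; rewrite (splitr r); apply: ball_triangle Hx' _.
  by apply: le_ball Hy; exact: ltW.
have -> : f x' - f y = (f x - f y) - (f x - f x') by ring.
apply: le_lt_trans (ler_normB _ _) _; lra.
Qed.

Lemma compact_bounded_fun (T : topologicalType) (K : set T) (f : T -> R) :
  compact K -> continuous f -> exists2 B : R, 0 < B & forall x, K x -> `|f x| <= B.
Proof.
move=> cK cf.
have /compact_bounded [M [_ HM]] : compact (f @` K : set R^o).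
  by apply: continuous_compact => //; exact: continuous_subspaceT.
exists (`|M| + 1); first by have := normr_ge0 M; lra.
move=> x Kx; apply: (HM (`|M| + 1)); last by exists x.
have := ler_norm M; lra.
Qed.

Lemma I01E : @I01 R = `[0, 1]%classic.
Proof. by apply/seteqP; split=> t /=; rewrite /I01 /= in_itv. Qed.

Lemma I01_compact : compact (@I01 R).
Proof. by rewrite I01E; exact: segment_compact. Qed.

Lemma measurable_I01 : measurable (@I01 R).
Proof. by rewrite I01E; exact: measurable_itv. Qed.

Lemma measurable_Itv0 (t : R) : measurable (Itv0 t).
Proof.
rewrite (_ : Itv0 t = `[0, t]%classic); first exact: measurable_itv.
by apply/seteqP; split=> s /=; rewrite /Itv0 /= in_itv.
Qed.

Lemma ball_cV n (x y : 'cV[R]_n) (e : R) : 0 < e ->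
  (forall i, `|x i 0 - y i 0| < e) -> ball x e y.
Proof. by move=> e0 H; split=> // i j; rewrite (ord1 j); exact: H. Qed.

Lemma cV_ball n (x y : 'cV[R]_n) (e : R) : ball x e y ->
  forall i, `|x i 0 - y i 0| < e.
Proof. by move=> [e0 H] i; exact: H. Qed.

Lemma continuous_coord n (i : 'I_n) : continuous (fun x : 'cV[R]_n => x i 0).
Proof. exact: coord_continuous. Qed.

(* Rational boxes with e k = 0 are empty; they fill the enumeration where no
   admissible box is available. *)
Lemma open_prod_boxes n (U : set ('cV[R]_n * R)) : open U ->
  exists (q : nat -> 'cV[R]_n) (r e : nat -> R), forall z, U z <->
    exists k, (forall i, `|z.1 i 0 - q k i 0| < e k) /\ `|z.2 - r k| < e k.
Proof.
move=> oU.
pose box (a : 'cV[rat]_n * rat * rat) : set ('cV[R]_n * R) := [set z : 'cV[R]_n * R |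
  (forall i, `|z.1 i 0 - ratr (a.1.1 i 0)| < ratr a.2) /\ `|z.2 - ratr a.1.2| < ratr a.2].
pose get k : 'cV[rat]_n * rat * rat := odflt (0, 0, 0) (unpickle k).
exists (fun k => map_mx ratr (get k).1.1), (fun k => ratr (get k).1.2),
  (fun k => if `[< box (get k) `<=` U >] then ratr (get k).2 else 0).
move=> z; split=> [Uz|[k [H1 H2]]]; last first.
  move: H1 H2; case: ifPn => [/asboolP sub|_] H1 H2; last first.
    by rewrite ltNge normr_ge0 in H2.
  by apply: sub; split=> // i; have := H1 i; rewrite mxE.
have /nbhs_ballP [r /= r0 Hr] := open_nbhs_nbhs (conj oU Uz).
have [e /=] := @rat_in_itvoo R 0 (r / 2) ltac:(lra).
rewrite in_itv /= => /andP[e0 er].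
have approx (x : R) : exists q : rat, `|x - ratr q| < ratr e.
  have [q /=] := @rat_in_itvoo R (x - ratr e) (x + ratr e) ltac:(lra).
  by rewrite in_itv /= => /andP[h1 h2]; exists q; rewrite ltr_norml; lra.
have [qf Hqf] := choice (fun i : 'I_n => approx (z.1 i 0)).
have [s Hs] := approx z.2.
exists (pickle ((\col_i qf i, s, e) : 'cV[rat]_n * rat * rat)); rewrite /get pickleK /=.
rewrite ifT.
  by split=> // i; rewrite !mxE.
apply/asboolP => y [/= h1 h2]; apply: Hr; split=> /=.
  apply: ball_cV => // i.
  have := h1 i; have := Hqf i; rewrite mxE => a1 a2.
  have -> : z.1 i 0 - y.1 i 0 = (z.1 i 0 - ratr (qf i)) - (y.1 i 0 - ratr (qf i)) by ring.
  by apply: le_lt_trans (ler_normB _ _) _; lra.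
suff : `|z.2 - y.2| < r by [].
have -> : z.2 - y.2 = (z.2 - ratr s) - (y.2 - ratr s) by ring.
by apply: le_lt_trans (ler_normB _ _) _; lra.
Qed.

Lemma open_measurableV n (U : set 'cV[R]_n) : open U -> measurable (U : set (borelV R n)).
Proof. by move=> oU; apply: sub_sigma_algebra. Qed.

Lemma closed_measurableV n (A : set 'cV[R]_n) : closed A -> measurable (A : set (borelV R n)).
Proof.
move=> cA; rewrite -[A]setCK; apply: measurableC.
by apply: open_measurableV; exact: closed_openC.
Qed.

Lemma compact_measurableV n (A : set 'cV[R]_n) : compact A -> measurable (A : set (borelV R n)).
Proof.
move=> cA; apply: closed_measurableV; exact: compact_closed.
Qed.

Lemma measurable_continuousV n (f : 'cV[R]_n -> R) : continuous f ->
  measurable_fun [set: borelV R n] f.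
Proof.
move=> /continuousP cf; apply: (measurability _ (RGenOpens.measurableE R)).
move=> _ [_ [a [b ->]] <-]; rewrite setTI.
by apply: open_measurableV; apply: cf; exact: interval_open.
Qed.

Lemma measurable_coordV n (i : 'I_n) :
  measurable_fun [set: borelV R n] (fun y : borelV R n => (y : 'cV[R]_n) i 0).
Proof. exact: (measurable_continuousV (@continuous_coord n i)). Qed.

Lemma measurable_boxV d (T : measurableType d) n (phi : T -> 'cV[R]_n) (q : 'cV[R]_n) (e : R) :
  (forall i, measurable_fun setT (fun x => phi x i 0)) ->
  measurable [set x | forall i, `|phi x i 0 - q i 0| < e].
Proof.
move=> mphi.
rewrite (_ : [set x | _] = \bigcap_(i in [set: 'I_n]) [set x | `|phi x i 0 - q i 0| < e]); last first.
  by apply/seteqP; split=> x /=; [move=> H i _; exact: H | move=> H i; exact: H].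
apply: fin_bigcap_measurable => // i _.
rewrite -[X in measurable X]setTI.
apply: (@measurable_fun_ltr _ _ _ setT (fun x => `|phi x i 0 - q i 0|) (cst e)) => //.
apply: measurableT_comp => //; exact: measurable_funB.
Qed.

(** Openness refers to the product topology and measurability to the product sigma-algebra; a
    countable union of boxes reconciles them. *)
Lemma open_pt_measurable n (U : set ('cV[R]_n * R)) : open U -> measurable (U : set (pt R n)).
Proof.
move=> oU; have [q [r [e HU]]] := open_prod_boxes oU.
rewrite (_ : U = \bigcup_k ([set y : borelV R n | forall i, `|(y : 'cV[R]_n) i 0 - q k i 0| < e k] `*`
   [set s : R | `|s - r k| < e k])); last first.
  apply/seteqP; split=> z; first by move=> /HU [k [h1 h2]]; exists k.
  by move=> [k _ [/= h1 h2]]; apply/HU; exists k.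
apply: bigcupT_measurable => k; apply: measurableX.
  by apply: measurable_boxV; exact: measurable_coordV.
rewrite (_ : [set s | _] = `](r k - e k), (r k + e k)[%classic) //.
by apply/seteqP; split=> s /=; rewrite in_itv /= ltr_norml; lra.
Qed.

Lemma measurable_continuous_pt n (f : 'cV[R]_n * R -> R) : continuous f ->
  measurable_fun [set: pt R n] f.
Proof.
move=> /continuousP cf; apply: (measurability _ (RGenOpens.measurableE R)).
move=> _ [_ [a [b ->]] <-]; rewrite setTI.
by apply: open_pt_measurable; apply: cf; exact: interval_open.
Qed.

(** An open set of the vector space is decomposed into boxes through the cylinder above it, sliced
    at second coordinate [0]; on that slice the second factor of a box is a condition independent of
    [x]. *)
Lemma measurable_cV d (T : measurableType d) n (phi : T -> 'cV[R]_n) :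
  (forall i, measurable_fun setT (fun x => phi x i 0)) ->
  measurable_fun setT (phi : T -> borelV R n).
Proof.
move=> mphi; apply: (@measurability _ _ T (borelV R n) setT phi (@open 'cV[R]_n)) => //.
move=> _ [U oU <-]; rewrite setTI.
have oU' : open (fst @^-1` U : set ('cV[R]_n * R)).
  by apply: open_comp oU => z _; exact: cvg_fst.
have [q [r [e HU]]] := open_prod_boxes oU'.
rewrite (_ : phi @^-1` U = \bigcup_k ([set x | forall i, `|phi x i 0 - q k i 0| < e k] `&`
   [set x | `|0 - r k| < e k])); last first.
  apply/seteqP; split=> x /=.
    by move=> Ux; have /HU [k [h1 h2]] : (fst @^-1` U) (phi x, 0 : R) by []; exists k.
  move=> [k _ [/= h1 h2]].
  by have /HU : exists k, (forall i, `|(phi x, 0 : R).1 i 0 - q k i 0| < e k) /\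
     `|(phi x, 0 : R).2 - r k| < e k by exists k.
apply: bigcupT_measurable => k; apply: measurableI; first exact: measurable_boxV.
have [H|H] := boolP (`|0 - r k| < e k).
  by rewrite (_ : [set x | _] = setT) //; apply/seteqP.
by rewrite (_ : [set x | _] = set0) //; apply/seteqP; split=> // x /=; rewrite (negbTE H).
Qed.

End Topology.

(** * Weak compactness of the probabilities on a compact set *)

Section BinaryCoding.
Context (R : realType) (n : nat).
Implicit Types (M : R) (x y : 'cV[R]_n).

(** Half-spaces cut at rational distances from [- M], enumerated by [pickle]; they separate the
    points of the cube of half-side [M]. An index that codes no triple gives the constant bit
    [false]. *)
Definition bitset M (k : nat) : set 'cV[R]_n :=
  if (unpickle k : option ('I_n * nat * nat)) is Some (i, j, l)
  then [set x | x i 0 < - M + j%:R / l.+1%:R] else set0.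

(* Words are stored with the latest bit first. *)
Fixpoint bword M (k : nat) x : seq bool :=
  if k is k'.+1 then `[< bitset M k' x >] :: bword M k' x else [::].

Lemma size_bword M k x : size (bword M k x) = k.
Proof. by elim: k => //= k ->. Qed.

Lemma bword_drop M k k' x : bword M k x = drop k' (bword M (k' + k) x).
Proof. by elim: k' => [|k' IH] /=; rewrite ?drop0. Qed.

Lemma bword_bit M k x y : bword M k x = bword M k y ->
  forall k', (k' < k)%N -> bitset M k' x = bitset M k' y.
Proof.
elim: k => // k IH /= [hb hw] k'; rewrite ltnS leq_eqVlt => /predU1P[->|]; last exact: IH.
by apply/propext; split=> /asboolP; [rewrite hb|rewrite -hb] => /asboolP.
Qed.

(** Two coordinates at distance [eta] or more are separated by a threshold of mesh
    [1 / (l + 1) < eta]. Finitely many thresholds of that mesh meet the cube, so their bits all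
    occur before some index. *)
Lemma bword_close M (eta : R) : 0 < eta -> exists N, forall k x y, (N <= k)%N ->
  (forall i, `|x i 0| <= M) -> (forall i, `|y i 0| <= M) ->
  bword M k x = bword M k y -> ball x eta y.
Proof.
move=> eta0.
pose l := Num.truncn (eta^-1).
have leta : l.+1%:R^-1 < eta.
  by rewrite invf_plt ?posrE //; exact: truncnS_gt.
have l0 : (0 : R) < l.+1%:R by [].
(* The shifted coordinate [u i 0 + M] is at most [2 * M], so the index of the first threshold above
   it is at most the truncation plus one, hence below [J]. *)
pose J := (Num.truncn (2 * M * l.+1%:R)).+2.
exists (\max_(a : 'I_n * 'I_J) (pickle ((a.1, val a.2, l) : 'I_n * nat * nat)).+1)%N.
move=> k x y Nk xM yM W.
suff key (u v : 'cV[R]_n) : (forall i, `|u i 0| <= M) -> (forall i, `|v i 0| <= M) ->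
    bword M k u = bword M k v -> forall i, v i 0 - u i 0 < eta.
  apply: ball_cV => // i; rewrite ltr_norml.
  have := key x y xM yM W i; have := key y x yM xM (esym W) i; lra.
move=> uM vM Wuv i; rewrite ltNge; apply/negP => ge.
have := uM i; have := vM i; rewrite !ler_norml => /andP[v1 v2] /andP[u1 u2].
pose a := (u i 0 + M) * l.+1%:R.
have a0 : 0 <= a by rewrite mulr_ge0 //; lra.
have aJ : a <= 2 * M * l.+1%:R by rewrite ler_wpM2r //; lra.
have jJ : ((Num.truncn a).+1 < J)%N by rewrite !ltnS; exact: le_truncn.
have /andP[t1 t2] := truncn_itv a0.
(* The first threshold strictly above [u i 0]; as the mesh is below [eta], it does not exceed
   [v i 0]. *)
set j := (Num.truncn a).+1 in jJ t2.
have uj : u i 0 < - M + j%:R / l.+1%:R.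
  suff : u i 0 + M < j%:R / l.+1%:R by move: (_ / _) => X; lra.
  by rewrite ltr_pdivlMr.
have jv : - M + j%:R / l.+1%:R <= v i 0.
  suff : j%:R / l.+1%:R <= u i 0 + M + l.+1%:R^-1.
    by move: (_ / _) leta => X; move: (_^-1) => Y; lra.
  rewrite ler_pdivrMr // mulrDl mulVf ?gt_eqF // -/a /j -natr1; lra.
have kj : (pickle ((i, j, l) : 'I_n * nat * nat) < k)%N.
  apply: leq_trans Nk.
  exact: (leq_bigmax (i, Ordinal jJ)).
have := bword_bit Wuv kj; rewrite /bitset pickleK /= => E.
have : v i 0 < - M + j%:R / l.+1%:R by rewrite -E.
by rewrite ltNge jv.
Qed.

Lemma measurable_bitset M k : measurable (bitset M k : set (borelV R n)).
Proof.
rewrite /bitset; case: unpickle => [[[i j] l]|] //.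
rewrite -[X in measurable X]setTI.
exact: (measurable_fun_ltr (measurable_coordV i) (measurable_cst (- M + j%:R / l.+1%:R : R))
  measurableT (Y := [set true])).
Qed.

Lemma measurable_bword M k (w : seq bool) :
  measurable ([set x | bword M k x = w] : set (borelV R n)).
Proof.
elim: k w => [|k IH] w /=.
  have [->|/eqP nw] := eqVneq w [::]; last by rewrite (_ : [set x | _] = set0) //; apply/seteqP;
    split => // x /= /esym.
  by rewrite (_ : [set x | _] = setT) //; apply/seteqP.
case: w => [|b w]; first by rewrite (_ : [set x | _] = set0) //; apply/seteqP; split.
rewrite (_ : [set x | _] = [set x | `[< bitset M k x >] = b] `&` [set x | bword M k x = w]); last first.
  by apply/seteqP; split=> x /= [-> ->].
apply: measurableI; last exact: IH.
case: b.
  rewrite (_ : [set x | _] = bitset M k); first exact: measurable_bitset.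
  by apply/seteqP; split=> x /= => [/asboolP|/asboolP ->].
rewrite (_ : [set x | _] = ~` bitset M k); first by apply: measurableC; exact: measurable_bitset.
by apply/seteqP; split=> x /=; [move/asboolPn | move/asboolPn => /negbTE].
Qed.

End BinaryCoding.

Lemma measurable_finite_valued d (T : measurableType d) (R : realType)
    (F : finType) (W : T -> F) (h : F -> R) :
  (forall w, measurable (W @^-1` [set w])) -> measurable_fun setT (fun x => h (W x)).
Proof.
move=> mW; rewrite (_ : (fun x => _) = (fun x => \sum_w h w * \1_(W @^-1` [set w]) x)).
  apply: measurable_sum => w; apply: measurable_funM => //; exact: measurable_indic.
apply/funext => x; rewrite (bigD1 (W x)) //= big1 ?addr0.
  by rewrite indicE mem_set ?mulr1.
by move=> w wW; rewrite indicE memNset ?mulr0 // => /= H; rewrite H eqxx in wW.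
Qed.

(** * Realising a consistent family of masses by a uniform variable *)

Section Quantile.
Context (R : realType).
Implicit Types (m : seq bool -> R) (w : seq bool).

(* [m w] is the mass of the cell of word [w]; nested intervals of length [m w]
   with left end [qleft m w] cut up [0, 1), and [qword m k u] is the word of the
   [k]-th generation interval containing [u]. The uniform law of [u] thus gives
   each word its mass. *)
Fixpoint qleft m w : R :=
  if w is b :: w' then if b then qleft m w' else qleft m w' + m (true :: w') else 0.

Fixpoint qword m (k : nat) (u : R) : seq bool :=
  if k is k'.+1 then
    let w := qword m k' u in (u < qleft m w + m (true :: w)) :: w
  else [::].

(** Kolmogorov's consistency condition for a law on infinite bit sequences. *)
Definition consistent m : Prop :=
  [/\ forall w, 0 <= m w <= 1, m [::] = 1 & forall w, m w = m (true :: w) + m (false :: w)].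

Lemma size_qword m k u : size (qword m k u) = k.
Proof. by elim: k => //= k ->. Qed.

Lemma qword_drop m k k' u : qword m k u = drop k' (qword m (k' + k) u).
Proof. by elim: k' => [|k' IH] /=; rewrite ?drop0. Qed.

Lemma qword_itv m k u : consistent m -> 0 <= u < 1 ->
  qleft m (qword m k u) <= u < qleft m (qword m k u) + m (qword m k u).
Proof.
move=> [m01 m1 mD] u01; elim: k => [|k /andP[IH1 IH2]] /=; first by rewrite m1 add0r.
have := mD (qword m k u).
by case: ltP => h /= h2; [rewrite IH1 h | rewrite h /=; lra].
Qed.

(** With [qword_itv], this identifies the words drawn from [[0, 1)] with subintervals: the fibre
    over [w] is an interval of length [m w]. *)
Lemma qword_eq m w u : consistent m ->
  qleft m w <= u < qleft m w + m w -> qword m (size w) u = w.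
Proof.
move=> [m01 m1 mD]; elim: w => //= b w IH.
have := mD w; have := m01 (true :: w); have := m01 (false :: w).
case: b => /= h1 h2 h3 h4.
  by rewrite IH; [congr cons; apply/idP; lra | lra].
by rewrite IH; [congr cons; apply/negbTE; rewrite -leNgt; lra | lra].
Qed.

Lemma qleft_ge0 m w : consistent m -> 0 <= qleft m w.
Proof.
move=> [m01 _ _]; elim: w => //= -[] w IH //.
by have := m01 (true :: w); lra.
Qed.

Lemma qright_le1 m w : consistent m -> qleft m w + m w <= 1.
Proof.
move=> [m01 m1 mD]; elim: w => [|b w IH] /=; first by rewrite m1 add0r.
have := mD w; have := m01 (true :: w); have := m01 (false :: w).
by case: b; lra.
Qed.

Lemma measurable_qword m k w : measurable [set u | qword m k u = w].
Proof.
elim: k w => [|k IH] w /=.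
  have [->|/eqP nw] := eqVneq w [::]; last by rewrite (_ : [set x | _] = set0) //; apply/seteqP;
    split => // x /= /esym.
  by rewrite (_ : [set x | _] = setT) //; apply/seteqP.
case: w => [|b w]; first by rewrite (_ : [set x | _] = set0) //; apply/seteqP; split.
pose c := qleft m w + m (true :: w).
rewrite (_ : [set u | _] = [set u | (u < c) = b] `&` [set u | qword m k u = w]); last first.
  apply/seteqP; split=> u /=; first by move=> [h1 h2]; rewrite -h1 /c -h2.
  by move=> [h1 h2]; rewrite -h1 /c h2.
apply: measurableI; last exact: IH.
case: b.
  by rewrite (_ : [set u | _] = `]-oo, c[%classic) //; apply/seteqP; split=> u /=; rewrite in_itv.
rewrite (_ : [set u | _] = `[c, +oo[%classic) //.
apply/seteqP; split=> u /=; rewrite in_itv /= andbT.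
  by move/negbT; rewrite -leNgt.
by move=> h; apply/negbTE; rewrite -leNgt.
Qed.

Lemma uniform01_ex : exists U : probability R R,
  forall a b : R, 0 <= a -> a <= b -> b <= 1 -> U `[a, b[%classic = (b - a)%:E.
Proof.
(* The pushforward by the identity only moves the uniform law from [measurableTypeR R] to the
   measurable structure of [R]. *)
have mid : measurable_fun setT (fun u : measurableTypeR R => u : R).
  by move=> _ Y mY; rewrite setTI.
have [U UE] := pushforward_prob (uniform_prob (@ltr01 R)) mid.
exists U => a b a0 ab b1; rewrite UE /pushforward.
rewrite /= /uniform_prob integral_uniform_pdf.
rewrite (_ : _ `&` _ = `[a, b[%classic); last first.
  by apply/seteqP; split=> x /=; rewrite !in_itv /=; [case | move=> h; split=> //; lra].
rewrite (eq_integral (fun=> 1%:E)); last first.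
  by move=> x; rewrite inE /= in_itv /= /uniform_pdf => h; rewrite ifT ?subr0 ?invr1 //; lra.
rewrite integral_cst //= mul1e lebesgue_measure_itv /= lte_fin.
case: ltP => [_|ba]; first by rewrite -EFinD.
by have -> : b - a = 0 by lra.
Qed.

Context (U : probability R R).
Hypothesis UE : forall a b : R, 0 <= a -> a <= b -> b <= 1 -> U `[a, b[%classic = (b - a)%:E.

Lemma uniform01_unit : U `[0, 1[%classic = 1%E.
Proof. by rewrite UE // subr0. Qed.

Lemma uniform01_qword m w : consistent m ->
  U [set u | qword m (size w) u = w] = (m w)%:E.
Proof.
move=> cm; have [m01 m1 mD] := cm.
have mU := measurable_itv (`[0 : R, 1[).
have mq := measurable_qword m (size w) w.
have -> : U [set u | qword m (size w) u = w] =
    U ([set u | qword m (size w) u = w] `&` `[0, 1[%classic).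
  by rewrite -[LHS](prob1_setI mU uniform01_unit mq).
rewrite (_ : _ `&` _ = `[qleft m w, qleft m w + m w[%classic).
  have := m01 w; have := qleft_ge0 w cm; have := qright_le1 w cm => h1 h2 h3.
  by rewrite UE //; [congr EFin; lra | lra].
apply/seteqP; split=> u /=; rewrite !in_itv /=.
  by move=> [h1 h2]; have := qword_itv (size w) cm h2; rewrite h1.
have := qleft_ge0 w cm; have := qright_le1 w cm => h1 h2 h3.
by split; [exact: qword_eq | lra].
Qed.

End Quantile.

Lemma cvg_finite_sum (T : topologicalType) (R : realType) (I : Type) (s : seq I)
    (g : I -> T -> R) (x : T) : (forall i, g i y @[y --> x] --> g i x) ->
  \sum_(i <- s) g i y @[y --> x] --> \sum_(i <- s) g i x.
Proof.
move=> cg; elim: s => [|i s IH].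
  rewrite big_nil (_ : (fun y => _) = cst 0); first exact: cvg_cst.
  by apply/funext => y; rewrite big_nil.
rewrite big_cons (_ : (fun y => _) = (fun y => g i y + \sum_(j <- s) g j y)).
  exact: cvgD.
by apply/funext => y; rewrite big_cons.
Qed.

(** * Compact parametrisation of the probabilities on [Om] *)

Section WeakCompactness.
Context (R : realType) (n : nat) (Om : set 'cV[R]_n) (M : R) (x0 : 'cV[R]_n).
Hypotheses (cOm : compact Om) (Om0 : Om x0)
  (OmM : forall x, Om x -> forall i, `|x i 0| <= M).

Context (U : probability R R).
Hypothesis UE : forall a b : R, 0 <= a -> a <= b -> b <= 1 -> U `[a, b[%classic = (b - a)%:E.

Definition cell (w : seq bool) : set 'cV[R]_n :=
  [set x | Om x /\ bword M (size w) x = w].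

Definition cellpt (w : seq bool) : 'cV[R]_n := xget x0 (cell w).

(** The vanishing of masses on empty cells ensures that each word drawn by [qword] is the word of an
    actual point of [Om]. *)
Definition massK : set {ptws seq bool -> R} :=
  [set m | consistent m /\ forall w, cell w = set0 -> m w = 0].

Lemma closed_mass_eq (g : {ptws seq bool -> R} -> R) :
  continuous g -> closed [set m | g m = 0].
Proof.
move=> cg; rewrite -[X in closed X]/(g @^-1` [set 0]).
by apply: closed_comp => [x _|]; [exact: cg | exact: closed_eq].
Qed.

(** Each defining condition is closed and involves at most three coordinates, so [massK] is a closed
    subset of a product of unit intervals. *)
Lemma massK_compact : compact massK.
Proof.
have pc w : continuous (fun m : {ptws seq bool -> R} => m w : R).
  exact: (@proj_continuous _ (fun=> R) w).
have cb := @tychonoff (seq bool) (fun=> R) (fun=> `[0, 1]%classic) (fun=> @segment_compact R 0 1).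
apply: (subclosed_compact _ cb); last first.
  by move=> m [[m01 _ _] _] w /=; rewrite in_itv /=; exact: m01.
rewrite (_ : massK = (\bigcap_w [set m : {ptws seq bool -> R} | 0 <= m w <= 1]) `&`
  ([set m : {ptws seq bool -> R} | m [::] - 1 = 0] `&`
  ((\bigcap_w [set m : {ptws seq bool -> R} | m w - (m (true :: w) + m (false :: w)) = 0]) `&`
  (\bigcap_(w in [set w | cell w = set0]) [set m : {ptws seq bool -> R} | m w = 0])))); last first.
  apply/seteqP; split=> m.
    move=> [[h1 h2 h3] h4]; split; first by move=> w _; exact: h1.
    split; first by rewrite /= h2 subrr.
    split; first by move=> w _; rewrite /= -h3 subrr.
    by move=> w /h4.
  move=> [h1 [/= /eqP h2 [h3 h4]]]; split; last by move=> w /h4.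
  split; first by move=> w; exact: h1.
    by rewrite subr_eq0 in h2; exact/eqP.
  by move=> w; have /= /eqP := h3 w I; rewrite subr_eq0 => /eqP.
apply: closedI.
  apply: closed_bigI => w _.
  rewrite (_ : [set m | _] = (fun m : {ptws seq bool -> R} => m w) @^-1` `[0, 1]%classic); last first.
    by apply/seteqP; split=> m /=; rewrite in_itv.
  by apply: closed_comp => [x _|]; [exact: pc | exact: interval_closed].
apply: closedI.
  apply: closed_mass_eq => m; have := cvgB (pc [::] m) (cvg_cst (1 : R)); exact.
apply: closedI.
  apply: closed_bigI => w _; apply: closed_mass_eq => m.
  by have := cvgB (pc w m) (cvgD (pc (true :: w) m) (pc (false :: w) m)); exact.
by apply: closed_bigI => w _; apply: closed_mass_eq => m; exact: pc.
Qed.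

Lemma cellptP w : cell w !=set0 -> cell w (cellpt w).
Proof. by move=> h; apply: xgetPex. Qed.

Lemma cellpt_Om w : Om (cellpt w).
Proof. by rewrite /cellpt; case: xgetP => // y _ []. Qed.

Lemma cellpt_qword m k u : massK m -> 0 <= u < 1 ->
  bword M k (cellpt (qword m k u)) = qword m k u.
Proof.
move=> [cm m0] u01; have /andP[h1 h2] := qword_itv k cm u01.
have : cell (qword m k u) !=set0.
  apply/set0P/eqP => /m0 E; rewrite E in h2; lra.
by move/cellptP => [_]; rewrite size_qword.
Qed.

Definition separating N (eta : R) := forall k x y, (N <= k)%N ->
  Om x -> Om y -> bword M k x = bword M k y -> ball x eta y.

Lemma separating_ex eta : 0 < eta -> exists N, separating N eta.
Proof.
move=> e0; have [N HN] := bword_close n M e0.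
by exists N => k x y Nk Ox Oy; apply: HN => //; exact: OmM.
Qed.

(** The limit of the representatives of the successive words of [u]. The rate is built into the
    definition because it depends neither on [m] nor on [u]; [sum_approx] relies on this
    uniformity. *)
Definition qlimit m (u : R) : set 'cV[R]_n := [set y | Om y /\
  forall eta N, 0 < eta -> separating N eta -> forall k, (N <= k)%N ->
    ball (cellpt (qword m k u)) (2 * eta) y].

(** A cluster point suffices. All later representatives share the bits of the [k]-th one, so they
    lie within [eta] of it, and some of them lie within [eta] of the cluster point. *)
Lemma qlimit_ex m u : massK m -> 0 <= u < 1 -> qlimit m u !=set0.
Proof.
move=> Km u01; pose z k := cellpt (qword m k u).
have zOm : (z @ \oo) Om by exists 0%N => // k _; exact: cellpt_Om.
have [y [Oy cy]] := cOm _ zOm.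
exists y; split=> // eta N e0 sN k Nk.
have FA : (z @ \oo) [set a | exists2 k', (k <= k')%N & a = z k'].
  by exists k => // k' /= kk'; exists k'.
have [_ [[k' kk' ->] /= By]] := cy _ _ FA (nbhsx_ballx y eta e0).
rewrite mulr_natl mulr2n; apply: (@ball_triangle _ _ (z k')); last exact: ball_sym.
apply: (sN k) => //; [exact: cellpt_Om | exact: cellpt_Om |].
rewrite cellpt_qword // -(subnK kk') [RHS](bword_drop M k (k' - k)).
by rewrite [bword M (_ + _) _](_ : _ = qword m (k' - k + k) u) ?cellpt_qword // -qword_drop.
Qed.

Definition qpoint m (u : R) : 'cV[R]_n := if 0 <= u < 1 then xget x0 (qlimit m u) else x0.

Lemma qpointP m u : massK m -> 0 <= u < 1 -> qlimit m u (qpoint m u).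
Proof. by move=> Km u01; rewrite /qpoint u01; apply: xgetPex; exact: qlimit_ex. Qed.

Lemma qpoint_Om m u : Om (qpoint m u).
Proof. by rewrite /qpoint; case: ifP => // _; case: xgetP => // y _ []. Qed.

Lemma size_tuple_qword (m : seq bool -> R) k u : size (qword m k u) == k.
Proof. by rewrite size_qword. Qed.

Lemma size_tuple_bword k (x : 'cV[R]_n) : size (bword M k x) == k.
Proof. by rewrite size_bword. Qed.

Definition tqword m k u : k.-tuple bool := Tuple (size_tuple_qword m k u).
Definition tbword k x : k.-tuple bool := Tuple (size_tuple_bword k x).

Lemma tqword_fiber m k (w : k.-tuple bool) :
  tqword m k @^-1` [set w] = [set u | qword m (size w) u = w].
Proof.
apply/seteqP; split=> u /=; first by move=> <- /=; rewrite size_qword.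
by move=> h; apply: val_inj; rewrite /= -[RHS]h size_tuple.
Qed.

Lemma tbword_fiber k (w : k.-tuple bool) :
  tbword k @^-1` [set w] = [set x | bword M (size w) x = w].
Proof.
apply/seteqP; split=> u /=; first by move=> <- /=; rewrite size_bword.
by move=> h; apply: val_inj; rewrite /= -[RHS]h size_tuple.
Qed.

Lemma measurable_qpoint m : massK m -> measurable_fun setT (qpoint m : R -> borelV R n).
Proof.
move=> Km; apply: measurable_cV => i.
have mI := measurable_itv (`[0 : R, 1[).
rewrite -(setUv `[0 : R, 1[%classic); apply/measurable_funU => //; first exact: measurableC.
split; last first.
  apply: (eq_measurable_fun (cst (x0 i 0))) => [u|]; last exact: measurable_cst.
  by rewrite inE /= in_itv /= => /negP/negbTE h; rewrite /qpoint h.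
(* On [[0, 1)] the point is a pointwise limit of functions that take finitely many values, one for
   each word of length [k]. *)
apply: (@measurable_fun_cvg _ _ R _ (fun k u => cellpt (qword m k u) i 0)).
  move=> k; apply: measurable_funTS.
  apply: (@measurable_finite_valued _ _ R _ (tqword m k) (fun w => cellpt w i 0)) => w.
  by rewrite tqword_fiber; exact: measurable_qword.
move=> u /=; rewrite in_itv /= => u01.
apply/cvgrPdist_lt => e e0.
have [N sN] := separating_ex (divr_gt0 e0 (ltr0Sn R 1)).
have [_ H] := qpointP Km u01.
near=> k; rewrite distrC.
have := H _ _ (divr_gt0 e0 (ltr0Sn R 1)) sN k.
rewrite mulrC divfK // => /(_ _)/cV_ball; apply.
by near: k; exact: nbhs_infty_ge.
Unshelve. all: by end_near. Qed.

(** [N] depends on [f] and [e] alone. Integrals are thus uniformly close to functions of finitely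
    many masses, which gives continuity in [m], and laws with the same cell masses have the same
    integrals. *)
Lemma sum_approx (f : 'cV[R]_n -> R) (e : R) : continuous f -> 0 < e ->
  exists N,
  (forall m (P : probability (borelV R n) R), massK m ->
    (P : set _ -> \bar R) = pushforward U (qpoint m : R -> borelV R n) ->
    `|\int[P]_x f x - \sum_(w : N.-tuple bool) f (cellpt w) * m w| <= e) /\
  (forall kap : probability (borelV R n) R, kap Om = 1%E ->
    `|\int[kap]_x f x - \sum_(w : N.-tuple bool) f (cellpt w) * fine (kap (cell w))| <= e).
Proof.
move=> cf e0.
have [B B0 fB] := compact_bounded_fun cOm cf.
have [del d0 Hdel] := compact_unif_continuous cOm cf e0.
have d2 : 0 < del / 2 by rewrite divr_gt0.
have [N sN] := separating_ex d2; exists N; split.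
  move=> m P Km PE.
  have mf := measurable_continuousV cf.
  have mq := measurable_qpoint Km.
  have mt w : measurable (tqword m N @^-1` [set w]).
    by rewrite tqword_fiber; exact: measurable_qword.
  have -> : \int[P]_x f x = \int[U]_u f (qpoint m u).
    exact: Rintegral_pushforwardE PE mq mf.
  have -> : \sum_(w : N.-tuple bool) f (cellpt w) * m w = \int[U]_u f (cellpt (tqword m N u)).
    rewrite (@Rintegral_finite_valued _ _ R U _ (tqword m N) (fun w => f (cellpt w))) //.
    apply: eq_bigr => w _; rewrite tqword_fiber.
    by rewrite (uniform01_qword UE) //; case: Km.
  apply: (@Rintegral_close _ _ R U `[0, 1[%classic _ _ B) => //.
  - exact: uniform01_unit UE.
  - exact: (measurableT_comp mf mq).
  - exact: (@measurable_finite_valued _ _ R _ (tqword m N) (fun w => f (cellpt w))).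
  - by move=> u _; apply: fB; exact: qpoint_Om.
  - by move=> u _; apply: fB; exact: cellpt_Om.
  - move=> u /=; rewrite in_itv /= => u01; rewrite distrC ltW //.
    apply: Hdel; first exact: cellpt_Om.
    have [_ H] := qpointP Km u01.
    by have := H _ _ d2 sN N (leqnn N); rewrite mulrC divfK.
move=> kap kOm.
have mf := measurable_continuousV cf.
have mt w : measurable (tbword N @^-1` [set w] : set (borelV R n)).
  by rewrite tbword_fiber; exact: measurable_bword.
have mOm := compact_measurableV cOm.
have -> : \sum_(w : N.-tuple bool) f (cellpt w) * fine (kap (cell w)) =
    \int[kap]_x f (cellpt (tbword N x)).
  rewrite (@Rintegral_finite_valued _ _ R kap _ (tbword N) (fun w => f (cellpt w))) //.
  apply: eq_bigr => w _; rewrite -(prob1_setI mOm kOm (mt w)) tbword_fiber.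
  by congr (_ * fine (kap _)); apply/seteqP; split=> x /= [].
apply: (@Rintegral_close _ _ R kap Om _ _ B) => //.
- apply: (@measurable_finite_valued _ (borelV R n) R _ (tbword N : borelV R n -> _) (fun w => f
  (cellpt w))).
  exact: mt.
- by move=> u _; apply: fB; exact: cellpt_Om.
- move=> x Ox; rewrite ltW // distrC; apply: Hdel; first exact: cellpt_Om.
  have [hO1 hO2] : cell (bword M N x) (cellpt (bword M N x)).
    by apply: cellptP; exists x; split=> //; rewrite size_bword.
  rewrite size_bword in hO2.
  by apply: le_ball (sN N _ _ (leqnn N) hO1 Ox hO2); lra.
Qed.

Lemma cell_massK (kap : probability (borelV R n) R) : kap Om = 1%E ->
  massK (fun w => fine (kap (cell w))).
Proof.
move=> kOm.
have mOm := compact_measurableV cOm.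
have mc w : measurable (cell w : set (borelV R n)).
  by apply: measurableI => //; exact: measurable_bword.
split; last by move=> w ->; rewrite measure0.
split.
- move=> w; rewrite fine_ge0 //=.
  by rewrite -lee_fin fineK ?fin_num_measure //; exact: probability_le1.
- rewrite (_ : cell [::] = Om) ?kOm //.
  by apply/seteqP; split=> x //; case.
- move=> w; rewrite -fineD ?fin_num_measure // -measureU //.
  + congr (fine (kap _)); apply/seteqP; split=> x /=.
      by move=> [Ox h]; rewrite /cell /= h; case: `[< _ >]; [left|right].
    by rewrite /cell /= => -[[Ox [_ h]]|[Ox [_ h]]].
  + apply/seteqP; split=> // x [[_ /= [h _]] [_ /= [h' _]]].
    by rewrite h in h'.
Qed.

(** Weak compactness in the form of a parametrisation: integrals of continuous functions vary
    continuously over a compact [K], and every probability on [Om] agrees on them with a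
    parametrised one. Covering arguments can be run on [K]. *)
Lemma weak_compactness_nonempty :
  exists (K : set {ptws seq bool -> R}) (Pm : {ptws seq bool -> R} -> probability (borelV R n) R),
  [/\ compact K, forall m, K m -> Pm m Om = 1%E,
    forall f, continuous f -> forall m, K m -> forall e : R, 0 < e ->
      \forall m' \near m, K m' -> `|\int[Pm m']_x f x - \int[Pm m]_x f x| < e &
    forall kap : probability (borelV R n) R, kap Om = 1%E ->
      exists2 m, K m & forall f, continuous f -> \int[Pm m]_x f x = \int[kap]_x f x].
Proof.
have ex m : exists P : probability (borelV R n) R, massK m ->
    (P : set _ -> \bar R) = pushforward U (qpoint m : R -> borelV R n).
  (* Outside [massK] a Dirac mass serves as default value. *)
  have [Km|nK] := pselect (massK m); last by exists (@dirac _ (borelV R n) x0 R).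
  by have [P PE] := pushforward_prob U (measurable_qpoint Km); exists P.
have [Pm HP] := choice ex.
exists massK, Pm; split.
- exact: massK_compact.
- move=> m Km; rewrite HP // /pushforward.
  rewrite (_ : _ @^-1` _ = setT) ?probability_setT //.
  by apply/seteqP; split=> // u _; exact: qpoint_Om.
- move=> f cf m Km e e0.
  have e4 : 0 < e / 4 by rewrite divr_gt0.
  have [N [HN _]] := sum_approx cf e4.
  have pc w : continuous (fun m : {ptws seq bool -> R} => m w : R).
    exact: (@proj_continuous _ (fun=> R) w).
  pose S (m' : {ptws seq bool -> R}) : R := \sum_(w : N.-tuple bool) f (cellpt w) * m' w.
  have cw (w : N.-tuple bool) : f (cellpt w) * (m' : {ptws seq bool -> R}) w @[m' --> m] -->
      f (cellpt w) * m w.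
    by have := cvgM (cvg_cst (f (cellpt w))) (pc w m); exact.
  have cS := @cvg_finite_sum {ptws seq bool -> R} R _ (index_enum _)
    (fun w (m' : {ptws seq bool -> R}) => f (cellpt (w : N.-tuple bool)) * m' w) m cw.
  have /cvgrPdist_lt /(_ _ e4) := cS; apply: filterS => m' /= h Km'.
  have := HN _ _ Km (HP _ Km); have := HN _ _ Km' (HP _ Km').
  rewrite -/(S m) -/(S m'); rewrite !ler_norml => /andP[a1 a2] /andP[a3 a4].
  move: h; rewrite -/(S m) -/(S m') !ltr_norml => /andP[a5 a6].
  move: (S m) (S m') a1 a2 a3 a4 a5 a6 => s1 s2 a1 a2 a3 a4 a5 a6; apply/andP; split; lra.
- move=> kap kOm; exists (fun w => fine (kap (cell w))); first exact: cell_massK.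
  move=> f cf; apply/eqP; rewrite -subr_eq0 -normr_le0; apply/ler_addgt0Pl => e e0.
  have e2 : 0 < e / 2 by rewrite divr_gt0.
  have [N [HN1 HN2]] := sum_approx cf e2.
  have Km := cell_massK kOm.
  have := HN1 _ _ Km (HP _ Km); have := HN2 _ kOm.
  rewrite addr0 !ler_norml => /andP[a1 a2] /andP[a3 a4]; apply/andP; split; lra.
Qed.

End WeakCompactness.

Lemma compact_coord_bounded (R : realType) n (Om : set 'cV[R]_n) : compact Om ->
  exists2 M : R, 0 < M & forall x, Om x -> forall i, `|x i 0| <= M.
Proof.
move=> cOm.
have /choice [B HB] (i : 'I_n) : exists B : R, forall x, Om x -> `|x i 0| <= B.
  by have [B _ HB] := compact_bounded_fun cOm (@continuous_coord R n i); exists B.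
exists (1 + \sum_i `|B i|); first by rewrite ltr_pwDl // sumr_ge0.
move=> x Ox i; apply: (le_trans (HB i x Ox)); apply: (le_trans (ler_norm _)).
rewrite (bigD1 i) //=; have : 0 <= \sum_(j < n | j != i) `|B j| by rewrite sumr_ge0.
lra.
Qed.

Lemma weak_compactness (R : realType) n (Om : set 'cV[R]_n) : compact Om -> Om !=set0 ->
  exists (K : set {ptws seq bool -> R}) (Pm : {ptws seq bool -> R} -> probability (borelV R n) R),
  [/\ compact K, forall m, K m -> Pm m Om = 1%E,
    forall f, continuous f -> forall m, K m -> forall e : R, 0 < e ->
      \forall m' \near m, K m' -> `|\int[Pm m']_x f x - \int[Pm m]_x f x| < e &
    forall kap : probability (borelV R n) R, kap Om = 1%E ->
      exists2 m, K m & forall f, continuous f -> \int[Pm m]_x f x = \int[kap]_x f x].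
Proof.
move=> cOm [x0 Ox0]; have [M _ HM] := compact_coord_bounded cOm.
have [U UE] := uniform01_ex R.
exact: weak_compactness_nonempty cOm Ox0 HM U UE.
Qed.

(** * Wasserstein distance and test functions *)

Section EuclideanNorm.
Context (R : realType) (n : nat).
Implicit Types v : 'cV[R]_n.

Lemma enorm2_ge0 v : 0 <= enorm2 v.
Proof. by apply: sumr_ge0 => i _; exact: sqr_ge0. Qed.

Lemma enorm_ge0 v : 0 <= enorm v.
Proof. exact: sqrtr_ge0. Qed.

Lemma enorm_le0 v : enorm v <= 0 -> v = 0.
Proof.
move=> h; have : enorm v == 0 by rewrite eq_le h enorm_ge0.
rewrite /enorm sqrtr_eq0 => h0.
have /eqP : enorm2 v == 0 by rewrite eq_le h0 enorm2_ge0.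
move=> /psumr_eq0P h1; apply/matrixP => i j; rewrite (ord1 j) mxE.
by apply/eqP; rewrite -sqrf_eq0; apply/eqP; apply: h1 => // k _; exact: sqr_ge0.
Qed.

Lemma enormN v : enorm (- v) = enorm v.
Proof.
by rewrite /enorm /enorm2; congr Num.sqrt; apply: eq_bigr => i _; rewrite mxE sqrrN.
Qed.

Lemma enorm_distC (u v : 'cV[R]_n) : enorm (u - v) = enorm (v - u).
Proof. by rewrite -enormN opprB. Qed.

Lemma coord_le_enorm v i : `|v i 0| <= enorm v.
Proof.
rewrite -sqrtr_sqr ler_sqrt ?enorm2_ge0 // /enorm2 (bigD1 i) //=.
by rewrite lerDl; apply: sumr_ge0 => j _; exact: sqr_ge0.
Qed.

Lemma enorm_le_coord v (c : R) : 0 <= c -> (forall i, `|v i 0| <= c) ->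
  enorm v <= n%:R * c.
Proof.
move=> c0 h.
have nc : 0 <= n%:R * c by rewrite mulr_ge0.
rewrite -(ger0_norm nc) -sqrtr_sqr ler_sqrt ?sqr_ge0 //.
apply: (@le_trans _ _ (\sum_(i < n) c ^+ 2)).
  by apply: ler_sum => i _; rewrite -real_normK ?num_real // ler_sqr ?nnegrE.
rewrite sumr_const card_ord -[_ *+ n]mulr_natl exprMn; apply: ler_wpM2r; first exact: sqr_ge0.
case: n => [|k]; first by rewrite expr0n.
by rewrite -natrX ler_nat leq_pmulr.
Qed.

End EuclideanNorm.

Section Couplings.
Context (R : realType) (n : nat) (Om : set 'cV[R]_n).
Hypothesis cOm : compact Om.
Local Notation V := (borelV R n).

(** If no coordinate differs by [del], uniform continuity gives [eta]. Otherwise the squared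
    distance is at least [del ^+ 2], and [K = 2 * B / del ^+ 2] absorbs the trivial bound [2 * B].
    The quadratic form is the one that integrates to the transport cost of [W2]. *)
Lemma quadratic_modulus (f : 'cV[R]_n * R -> R) (eta : R) : continuous f -> 0 < eta ->
  exists2 K : R, 0 <= K & forall x y s, Om x -> Om y -> I01 s ->
    `|f (x, s) - f (y, s)| <= eta + K * enorm2 (x - y).
Proof.
move=> cf e0.
have cS : compact (Om `*` @I01 R) by apply: compact_setX => //; exact: I01_compact.
have [B B0 fB] := compact_bounded_fun cS cf.
have [del d0 Hd] := compact_unif_continuous cS cf e0.
exists (2 * B / del ^+ 2); first by rewrite divr_ge0 ?sqr_ge0 // mulr_ge0 // ltW.
move=> x y s Ox Oy s01.
have [h|/existsNP [i /negP]] := pselect (forall i, `|x i 0 - y i 0| < del).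
  apply: (@le_trans _ _ eta).
    apply/ltW/Hd => //; split; last exact: ballxx.
    exact: ball_cV.
  by rewrite lerDl mulr_ge0 ?enorm2_ge0 // divr_ge0 ?sqr_ge0 // mulr_ge0 // ltW.
rewrite -leNgt => h.
apply: (@le_trans _ _ (2 * B)).
  apply: (le_trans (ler_normB _ _)).
  have := fB (x, s) (conj Ox s01); have := fB (y, s) (conj Oy s01); lra.
apply: (@le_trans _ _ (2 * B / del ^+ 2 * enorm2 (x - y))); last first.
  by rewrite lerDr ltW.
rewrite -mulrA ler_peMr ?mulr_ge0 ?(ltW B0) // mulrC ler_pdivlMr ?exprn_gt0 // mul1r.
apply: (@le_trans _ _ (`|(x - y) i 0| ^+ 2)).
  by rewrite ler_sqr ?nnegrE ?(ltW d0) // !mxE.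
rewrite real_normK ?num_real // /enorm2 (bigD1 i) //= lerDl.
by apply: sumr_ge0 => j _; exact: sqr_ge0.
Qed.

Lemma measurable_enorm2 :
  measurable_fun [set: V * V] (fun z : V * V => enorm2 ((z.1 : 'cV[R]_n) - z.2)).
Proof.
apply: measurable_sum => i; apply: measurable_funX.
rewrite (_ : (fun z => _) = (fun z : V * V => (z.1 : 'cV[R]_n) i 0 - (z.2 : 'cV[R]_n) i 0)).
  apply: measurable_funB.
    exact: (measurableT_comp (@measurable_coordV R n i) measurable_fst).
  exact: (measurableT_comp (@measurable_coordV R n i) measurable_snd).
by apply/funext => z; rewrite !mxE.
Qed.

Lemma enorm2_bounded : exists2 D : R, 0 <= D & forall x y, Om x -> Om y -> enorm2 (x - y) <= D.
Proof.
have [M M0 HM] := compact_coord_bounded cOm.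
exists (\sum_(i < n) (2 * M) ^+ 2); first by apply: sumr_ge0 => i _; exact: sqr_ge0.
move=> x y Ox Oy; apply: ler_sum => i _.
rewrite -real_normK ?num_real // ler_sqr ?nnegrE //; last by lra.
rewrite !mxE; apply: (le_trans (ler_normB _ _)).
by have := HM _ Ox i; have := HM _ Oy i; lra.
Qed.

Lemma W2_test (kap kap' : probability V R) (g : 'cV[R]_n -> R) (c eta K : R) :
  kap Om = 1%E -> kap' Om = 1%E -> continuous g -> 0 <= c -> 0 <= K ->
  (forall x y, Om x -> Om y -> `|g x - g y| <= eta + K * enorm2 (x - y)) ->
  (W2 kap kap' <= c%:E)%E ->
  `|\int[kap]_x g x - \int[kap']_x g x| <= eta + K * c ^+ 2.
Proof.
move=> kO kO' cg c0 K0 Hg HW.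
have mOm := compact_measurableV cOm.
have mg := measurable_continuousV cg.
have [B B0 gB] := compact_bounded_fun cOm cg.
have [D D0 HD] := enorm2_bounded.
have me := measurable_enorm2.
set I := ereal_inf [set (\int[g]_z (enorm2 ((z.1 : 'cV[R]_n) - z.2))%:E)%E
                   | g in [set g | coupling kap kap' g]].
have I0 : (0 <= I)%E.
  apply: le_ereal_inf_tmp => _ [gam _ <-]; apply: integral_ge0 => z _.
  by rewrite lee_fin enorm2_ge0.
(* [W2] is the square root of the infimum [I], so a bound [c] on it makes [I] finite and at most
   [c ^+ 2]. *)
have [r rE rc] : exists2 r : R, I = r%:E & r <= c ^+ 2.
  move: HW; rewrite /W2 -/I poweR12_sqrt //.
  case: I I0 => [r| |] //= r0; rewrite lee_fin => h.
  exists r => //; rewrite lee_fin in r0; rewrite -[leLHS](sqr_sqrtr r0).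
  by rewrite ler_sqr ?nnegrE ?sqrtr_ge0.
apply/ler_addgt0Pr => e e0.
(* Slack of the near-optimal coupling: multiplied by [K] it costs at most [e], and [K + 1] also
   covers [K = 0]. *)
have e1 : 0 < e / (K + 1) by rewrite divr_gt0 // ltr_wpDl.
have [|_ [gam gamC <-]] := lb_ereal_inf_adherent e1 (_ : I \is a fin_num); first by rewrite rE.
rewrite -/I rE -EFinD => cost.
have k1 : \int[kap]_x g x = \int[gam]_z g z.1.
  have [Q QE] := pushforward_prob gam (measurable_fst : measurable_fun [set: V * V] fst).
  rewrite -(Rintegral_pushforwardE QE measurable_fst mg).
  apply: eq_Rintegral_measure => A mA; have [h _] := gamC A mA.
  by rewrite QE -h /pushforward; congr (gam _); apply/seteqP; split=> z /=; [case|].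
have k2 : \int[kap']_x g x = \int[gam]_z g z.2.
  have [Q QE] := pushforward_prob gam (measurable_snd : measurable_fun [set: V * V] snd).
  rewrite -(Rintegral_pushforwardE QE measurable_snd mg).
  apply: eq_Rintegral_measure => A mA; have [_ h] := gamC A mA.
  by rewrite QE -h /pushforward; congr (gam _); apply/seteqP; split=> z /=; [case|].
pose S : set (V * V) := (Om `*` setT) `&` (setT `*` Om).
have m1 : measurable (Om `*` setT : set (V * V)) by exact: measurableX.
have m2 : measurable (setT `*` Om : set (V * V)) by exact: measurableX.
have mS : measurable S by exact: measurableI.
have gS : gam S = 1%E.
  have [h1 h2] := gamC _ mOm.
  rewrite /S prob1_setI //; first by rewrite h1.
  by rewrite h2.
have mg1 : measurable_fun [set: V * V] (fun z : V * V => g z.1) by exact: (measurableT_comp mg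
  measurable_fst).
have mg2 : measurable_fun [set: V * V] (fun z : V * V => g z.2) by exact: (measurableT_comp mg
  measurable_snd).
have Ie : gam.-integrable setT (EFin \o (fun z : V * V => enorm2 ((z.1 : 'cV[R]_n) - z.2))).
  apply: (prob1_integrable mS gS me (B := D)) => z [[/= p1 _] [_ /= p2]].
  by rewrite ger0_norm ?enorm2_ge0 //; exact: HD.
have cost' : \int[gam]_z enorm2 ((z.1 : 'cV[R]_n) - z.2) < r + e / (K + 1).
  have Fi := integrable_fin_num measurableT Ie.
  by rewrite -lte_fin /Rintegral fineK.
rewrite k1 k2.
have S12 z : S z -> Om z.1 /\ Om z.2 by move=> [[/= p1 _] [_ /= p2]].
rewrite -RintegralB //; last 2 first.
- by apply: (prob1_integrable mS gS mg1 (B := B)) => z /S12 [p1 p2]; exact: gB.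
- by apply: (prob1_integrable mS gS mg2 (B := B)) => z /S12 [p1 p2]; exact: gB.
have mB : measurable_fun [set: V * V] (fun z : V * V => g z.1 - g z.2) by exact: measurable_funB.
have bB z : S z -> `|g z.1 - g z.2| <= 2 * B.
  move=> /S12 [p1 p2]; apply: (le_trans (ler_normB _ _)).
  by have := gB _ p1; have := gB _ p2; lra.
apply: (le_trans (le_normr_Rintegral measurableT (prob1_integrable mS gS mB bB))).
apply: (@le_trans _ _ (\int[gam]_z (eta + K * enorm2 ((z.1 : 'cV[R]_n) - z.2)))).
  apply: (@prob1_le_Rintegral _ _ _ gam S _ _ (2 * B + `|eta| + K * D)) => //.
  - exact: measurableT_comp.
  - by apply: measurable_funD => //; exact: measurable_funM.
  - move=> z Sz; rewrite normr_id; apply: (le_trans (bB _ Sz)).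
    by rewrite -addrA lerDl addr_ge0 // mulr_ge0.
  - move=> z /S12 [p1 p2]; apply: (le_trans (ler_normD _ _)).
    rewrite [`|K * _|]ger0_norm ?mulr_ge0 ?enorm2_ge0 //.
    have h : K * enorm2 ((z.1 : 'cV[R]_n) - z.2) <= K * D by rewrite ler_wpM2l // HD.
    by have := ltW B0; lra.
  - by move=> z /S12 [p1 p2]; exact: Hg.
rewrite RintegralD //; last 2 first.
- exact: (@bounded_prob_integrable _ _ _ gam (cst eta) `|eta|).
- by have := integrableZl measurableT K Ie; apply: eq_integrable.
rewrite RintegralZl // prob_Rintegral_cst -addrA lerD2l.
apply: (@le_trans _ _ (K * (c ^+ 2 + e / (K + 1)))).
  by rewrite ler_wpM2l //; apply: (le_trans (ltW cost')); rewrite lerD2r.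
rewrite mulrDr lerD2l mulrCA ler_piMr ?(ltW e0) // ler_pdivrMr ?ltr_wpDl // mul1r; lra.
Qed.

(** The diagonal coupling has zero cost. This makes a constant kernel Lipschitz, as needed for
    measures concentrated at time 0. *)
Lemma W2_refl (nu : probability V R) : W2 nu nu = 0%E.
Proof.
have mdiag : measurable_fun [set: V] (fun x : V => (x, x)) by exact: measurable_fun_pair.
have [g gE] := pushforward_prob nu mdiag.
rewrite /W2; set I := ereal_inf _.
have I0 : (0 <= I)%E.
  apply: le_ereal_inf_tmp => _ [gam _ <-]; apply: integral_ge0 => z _.
  by rewrite lee_fin enorm2_ge0.
suff -> : I = 0%E by rewrite poweR0r.
apply/eqP; rewrite eq_le I0 andbT; apply: ereal_inf_lbound; exists g.
  move=> A mA; rewrite gE /pushforward; split; congr (nu _);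
    by apply/seteqP; split=> x //= [].
have gE' : (\int[g]_z (enorm2 ((z.1 : 'cV[R]_n) - z.2))%:E)%E =
   (\int[pushforward nu (fun x : V => (x, x))]_z (enorm2 ((z.1 : 'cV[R]_n) - z.2))%:E)%E.
  exact: (congr1 (fun q : set (V * V) -> \bar R => \int[q]_z (enorm2 ((z.1 : 'cV[R]_n) - z.2))%:E)%E gE).
rewrite gE' (ge0_integral_pushforward mdiag nu measurableT) //; last 2 first.
- by apply/measurable_EFinP; exact: measurable_enorm2.
- by move=> z _; rewrite lee_fin enorm2_ge0.
apply: integral0_eq => x _ /=; rewrite subrr /enorm2 big1 // => i _.
by rewrite mxE expr0n.
Qed.

End Couplings.

Lemma eq_indic (R : realType) (T T' : Type) (A : set T) (B : set T') x y :
  (A x <-> B y) -> \1_A x = \1_B y :> R.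
Proof.
move=> AB; rewrite !indicE; have [h|h] := pselect (A x).
  by rewrite !mem_set //; exact/AB.
by rewrite !memNset // => /AB.
Qed.

Lemma continuous_slice (T U W : topologicalType) (f : T * U -> W) (t : U) :
  continuous f -> continuous (fun y => f (y, t)).
Proof.
move=> cf y0.
apply: (@cvg_comp _ _ _ (fun y => (y, t)) f _ (nbhs (y0, t))); last exact: cf.
by apply: cvg_pair => //; exact: cvg_cst.
Qed.

(** * Discretisation of time and dependence on the initial law *)

Section DiscreteTime.
Context (R : realType) (n : nat) (Om : set 'cV[R]_n).
Hypothesis cOm : compact Om.
Local Notation V := (borelV R n).
Implicit Types (kap : R -> probability V R).

Lemma measurable_pairt (t : R) : measurable_fun [set: V] (fun y : V => (y, t) : pt R n).
Proof. exact: measurable_fun_pair. Qed.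

Lemma tmargE (P : probability (pt R n) R) :
  tmarg P = pushforward P (snd : pt R n -> R).
Proof.
apply/funext => B; rewrite /tmarg /pushforward; congr (P _).
by apply/seteqP; split=> z //= [].
Qed.

(** The sum of the [w i] times the product of [kap (t i)] with the Dirac mass at [t i]. *)
Definition discrete kap (N : nat) (w t : nat -> R) : meas R n :=
  fun A => (\sum_(i < N) (w i)%:E * kap (t i) [set y | A (y, t i)])%E.

Lemma discrete_prob kap N (w t : nat -> R) :
  (forall i, 0 <= w i) -> \sum_(i < N) w i = 1 ->
  exists Q : probability (pt R n) R, (Q : set _ -> \bar R) = discrete kap N w t /\
    forall f : pt R n -> R, measurable_fun setT f ->
      (forall i, (i < N)%N -> (kap (t i)).-integrable setT (EFin \o (fun y : V => f (y, t i)))) ->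
      \int[Q]_z f z = \sum_(i < N) w i * \int[kap (t i)]_y f (y, t i).
Proof.
move=> w0 w1.
have ex (i : nat) := pushforward_prob (kap (t i)) (measurable_pairt (t i)).
have [P HP] := choice ex.
have [Q [QA Qf]] := mixture_prob P w0 w1.
exists Q; split; first by apply/funext => A; rewrite QA; apply: eq_bigr => i _; rewrite HP.
move=> f mf If; rewrite Qf //.
  by apply: eq_bigr => i _; rewrite (Rintegral_pushforwardE (HP i) (measurable_pairt (t i)) mf).
move=> i iN; have mEf : measurable_fun setT (EFin \o f) by exact/measurable_EFinP.
have := integrable_pushforward (measurable_pairt (t i)) mEf (If i iN) measurableT.
move=> h; apply/integrableP; split => //; have /integrableP [_] := h.
by congr (_ < _)%E; exact: (congr1 (fun q : set (pt R n) -> \bar R => \int[q]_x `|(EFin \o f)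
  x|)%E (esym (HP i))).
Qed.

(** The kernel [kap] itself disintegrates the discrete measure, so its Lipschitz bound carries over,
    and the atom of index 0 provides the mass [sig] at time 0. *)
Lemma Lip_discrete kap (C sig : R) N (w t : nat -> R) :
  (forall s, I01 s -> kap s Om = 1%E) ->
  (forall A : set V, measurable A -> measurable_fun [set: R] (fun s : R => kap s A : \bar R)) ->
  (forall s s', I01 s -> I01 s' -> (W2 (kap s) (kap s') <= (C * `|s - s'|)%:E)%E) ->
  (forall i, 0 <= w i) -> \sum_(i < N.+1) w i = 1 -> (forall i, (i < N.+1)%N -> I01 (t i)) ->
  t 0%N = 0 -> sig <= w 0%N ->
  Lip Om C sig (discrete kap N.+1 w t).
Proof.
move=> kOm mk kW w0 w1 t01 t0 sw.
have [Q [QE Qf]] := discrete_prob kap t w0 w1.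
have kT s : kap s setT = 1%E by exact: probability_setT.
have tm B : tmarg (discrete kap N.+1 w t) B = (\sum_(i < N.+1) (w i)%:E * (\1_B (t i))%:E)%E.
  rewrite /tmarg /discrete; apply: eq_bigr => i _; congr (_ * _)%E.
  have [h|h] := pselect (B (t i)).
    rewrite indicE mem_set // (_ : [set y | _] = setT) ?kT //.
    by apply/seteqP; split.
  rewrite indicE memNset // (_ : [set y | _] = set0) ?measure0 //.
  by apply/seteqP; split=> // y /= [].
split; first by exists Q.
split.
  rewrite /discrete (eq_bigr (fun i : 'I_N.+1 => (w i)%:E)); first by rewrite sumEFin w1.
  move=> i _; rewrite (_ : [set y | _] = Om) ?kOm ?mule1 //; first exact: t01.
  by apply/seteqP; split=> y /=; [case | split=> //; exact: t01].
split.
  rewrite tm big_ord_recl /= t0 indicE mem_set // mule1.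
  rewrite -[leLHS]adde0 leeD // ?lee_fin //.
  by apply: sume_ge0 => i _; rewrite mule_ge0 // lee_fin // indicE.
exists kap; do 2 split=> //; split=> // A B mA mB.
rewrite (_ : tmarg (discrete kap N.+1 w t) = msum (fun i => mscale (NngNum (w0 i)) (dirac (t i)))
  N.+1); last first.
  by apply/funext => B'; rewrite tm.
have mkB : measurable_fun B (fun s : R => kap s A : \bar R) by exact: measurable_funTS (mk A mA).
rewrite ge0_integral_measure_sum //.
apply: eq_bigr => i _; rewrite ge0_integral_mscale // integral_dirac //; congr (_ * _)%E.
rewrite diracE; have [h|h] := pselect (B (t i)).
  rewrite mem_set // mul1e; congr (kap _ _).
  by apply/seteqP; split=> y /=; [case|].
rewrite memNset // mul0e (_ : [set y | _] = set0) ?measure0 //.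
by apply/seteqP; split=> // y /= [].
Qed.

Definition initial (nu : set V -> \bar R) : meas R n := fun A => nu [set y | A (y, 0)].

Lemma initialE (nu : set V -> \bar R) :
  initial nu = pushforward nu (fun y : V => (y, 0) : pt R n).
Proof. by []. Qed.

Lemma Lip_initial (nu : probability V R) (C sig : R) : 0 <= C -> sig <= 1 ->
  nu Om = 1%E -> Lip Om C sig (initial nu).
Proof.
move=> C0 s1 nO.
have -> : initial nu = discrete (fun=> nu) 1 (fun=> 1) (fun=> 0).
  by apply/funext => A; rewrite /discrete big_ord1 mul1e.
apply: Lip_discrete => //.
- by move=> s s' _ _; rewrite W2_refl lee_fin mulr_ge0.
- by rewrite big_ord1.
- by move=> i _; rewrite /I01 /= lexx ler01.
Qed.

(** The disintegration is known on rectangles. Replacing [g] by a function of its first [N] bits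
    turns the integral into a finite sum over rectangles. Of the four [eta], one pays for this
    replacement under [P], one under [kap s] and two under [kap s0]. *)
Lemma disintegration_close (P : probability (pt R n) R) kap (g : 'cV[R]_n -> R)
    (B : set R) (s0 eps eta : R) :
  P (Om `*` @I01 R) = 1%E -> (forall s, I01 s -> kap s Om = 1%E) ->
  (forall A : set V, measurable A -> measurable_fun [set: R] (fun s : R => kap s A : \bar R)) ->
  (forall (A : set V) (B : set R), measurable A -> measurable B ->
     P (A `*` B) = (\int[tmarg P]_(s in B) kap s A)%E) ->
  continuous g -> measurable B -> B `<=` @I01 R -> I01 s0 -> 0 < eta ->
  (forall s, B s -> `|\int[kap s]_x g x - \int[kap s0]_x g x| <= eps) ->
  `|\int[P]_z (g z.1 * \1_B z.2) - fine (tmarg P B) * \int[kap s0]_x g x|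
    <= (eps + 4 * eta) * fine (tmarg P B).
Proof.
move=> PO kO mk dis cg mB B01 s01 e0 Hs.
have [x0 Ox0] : Om !=set0.
  apply/set0P/eqP => E; have := kO _ s01; rewrite E measure0 => /eqP.
  by rewrite eq_sym onee_eq0.
have [M M0 HM] := compact_coord_bounded cOm.
have [F F0 gF] := compact_bounded_fun cOm cg.
have [U UE] := uniform01_ex R.
have mOm := compact_measurableV cOm.
have mS : measurable (Om `*` @I01 R : set (pt R n)).
  by apply: measurableX => //; exact: measurable_I01.
have [del d0 Hdel] := compact_unif_continuous cOm cg e0.
have [N sN] := separating_ex (n := n) HM d0.
pose W : V -> N.-tuple bool := tbword M N.
pose h (w : N.-tuple bool) := g (cellpt Om M x0 w).
have mW w : measurable (W @^-1` [set w]) by rewrite /W tbword_fiber; exact: measurable_bword.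
have mhW : measurable_fun [set: V] (fun y => h (W y)) by exact: measurable_finite_valued.
have mg := measurable_continuousV cg.
have hF w : `|h w| <= F by apply: gF; exact: cellpt_Om.
have ghW y : Om y -> `|g y - h (W y)| <= eta.
  move=> Oy; rewrite ltW // distrC; apply: Hdel; first exact: cellpt_Om.
  have [h1 h2] : cell Om M (bword M N y) (cellpt Om M x0 (bword M N y)).
    by apply: cellptP; exists y; split=> //; rewrite size_bword.
  rewrite size_bword in h2.
  exact: (sN N _ _ (leqnn N) h1 Oy h2).
have m1 : measurable_fun [set: pt R n] (fun z : pt R n => \1_B z.2 : R).
  exact: (measurableT_comp (measurable_indic mB) measurable_snd).
have i1 (s : R) : `|\1_B s : R| <= 1 by rewrite indicE; case: (_ \in _); rewrite ?normr1 ?normr0.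
have mTB : measurable (setT `*` B : set (pt R n)) by exact: measurableX.
have TB (z : pt R n) : \1_(setT `*` B) z = \1_B z.2 :> R.
  by apply: eq_indic; split=> [[]|].
have hind (a : R) (s : R) : `|a * \1_B s| <= `|a| by rewrite normrM ler_piMr.
have step1 : `|\int[P]_z (g z.1 * \1_B z.2) - \int[P]_z (h (W z.1) * \1_B z.2)| <= eta * fine
  (tmarg P B).
  apply: (@Rintegral_close_indic _ _ _ P (Om `*` @I01 R) (setT `*` B) _ _ F) => //.
  - by apply: measurable_funM => //; exact: (measurableT_comp mg measurable_fst).
  - by apply: measurable_funM => //; exact: (measurableT_comp mhW measurable_fst).
  - by move=> z [Oz _]; apply: (le_trans (hind _ _)); exact: gF.
  - by move=> z [Oz _]; apply: (le_trans (hind _ _)).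
  - move=> z [Oz _]; rewrite TB -mulrBl normrM [`|\1_B _|]ger0_norm; last by rewrite indicE.
    by rewrite ler_wpM2r ?indicE //; exact: ghW.
have mSnd : measurable_fun [set: pt R n] (snd : pt R n -> R) by exact: measurable_snd.
have [Q QE] := pushforward_prob P mSnd.
have tQ : tmarg P = Q by rewrite tmargE QE.
pose k (w : N.-tuple bool) (s : R) := fine (kap s (W @^-1` [set w])).
have mkw w : measurable_fun [set: R] (k w).
  by apply/measurable_EFinP; rewrite (_ : EFin \o k w = (fun s => kap s (W @^-1` [set w]) : \bar R));
    [exact: mk | apply/funext => s /=; rewrite fineK // fin_num_measure].
have k01 w s : `|k w s| <= 1.
  rewrite ger0_norm ?fine_ge0 // -lee_fin fineK ?fin_num_measure //; exact: probability_le1.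
have Phi s : \sum_w h w * k w s = \int[kap s]_y h (W y).
  by rewrite Rintegral_finite_valued.
have step2 : \int[P]_z (h (W z.1) * \1_B z.2) = \int[Q]_s (\1_B s * \sum_w h w * k w s).
  transitivity (\sum_w h w * fine (P ((W @^-1` [set w]) `*` B))).
    transitivity (\int[P]_z (\sum_w h w * \1_((W @^-1` [set w]) `*` B) z)).
      apply: eq_Rintegral => z _; rewrite (bigD1 (W z.1)) //= big1 ?addr0.
        by congr (_ * _); apply: eq_indic; split=> [|[]].
      move=> w wW; rewrite indicE memNset ?mulr0 // => -[/= E _].
      by rewrite E eqxx in wW.
    have mX w : measurable ((W @^-1` [set w]) `*` B : set (pt R n)) by exact: measurableX.
    have Ii w : P.-integrable setT (EFin \o (\1_((W @^-1` [set w]) `*` B) : pt R n -> R)).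
      apply: (@bounded_prob_integrable _ _ _ P _ 1); first exact: measurable_indic.
      by move=> x; rewrite indicE; case: (_ \in _); rewrite ?normr1 ?normr0.
    rewrite Rintegral_sum.
      by apply: eq_bigr => w _; rewrite RintegralZl // Rintegral_indic.
    by move=> w; have := integrableZl measurableT (h w) (Ii w); apply: eq_integrable.
  have mB1 : measurable_fun [set: R] (\1_B : R -> R) by exact: measurable_indic.
  have Ik w : Q.-integrable setT (EFin \o (fun s => \1_B s * k w s)).
    apply: (@bounded_prob_integrable _ _ _ Q _ 1); first exact: measurable_funM.
    by move=> s; rewrite mulrC (le_trans (hind _ _)).
  transitivity (\sum_w \int[Q]_s (h w * (\1_B s * k w s))).
    apply: eq_bigr => w _; rewrite RintegralZl //; congr (_ * _).
    rewrite dis // tQ /Rintegral [X in fine X = _]integral_mkcond; congr fine.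
    congr integral; apply/funext => s; rewrite patchE.
    case: ifPn => h1; rewrite indicE; first by rewrite h1 mul1r fineK // fin_num_measure.
    by rewrite (negbTE h1) mul0r.
  rewrite -Rintegral_sum; last by move=> w; have := integrableZl measurableT (h w) (Ik w);
    apply: eq_integrable.
  by apply: eq_Rintegral => s _; rewrite mulr_sumr; apply: eq_bigr => w _; rewrite mulrCA.
pose c0 := \int[kap s0]_y h (W y).
have close s : I01 s -> `|\int[kap s]_y g y - \int[kap s]_y h (W y)| <= eta.
  move=> s1; apply: (@Rintegral_close _ _ _ (kap s) Om _ _ F) => //; exact: kO.
have mPhi : measurable_fun [set: R] (fun s => \sum_w h w * k w s).
  by apply: measurable_sum => w; exact: measurable_funM.
have PhiF s : `|\int[kap s]_y h (W y)| <= F.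
  by apply: (@Rintegral_norm_le _ _ _ (kap s) setT) => //; exact: probability_setT.
have tB : fine (tmarg P B) = \int[Q]_s \1_B s by rewrite tQ Rintegral_indic.
have step3 : `|\int[Q]_s (\1_B s * \sum_w h w * k w s) - \int[Q]_s (\1_B s * c0)| <= (eps + 2 *
  eta) * fine (tmarg P B).
  rewrite tQ; apply: (@Rintegral_close_indic _ _ _ Q setT B _ _ F) => //.
  - exact: probability_setT.
  - by apply: measurable_funM => //; exact: measurable_indic.
  - by apply: measurable_funM => //; exact: measurable_indic.
  - by move=> s _; rewrite mulrC (le_trans (hind _ _)) // Phi.
  - by move=> s _; rewrite mulrC; apply: (le_trans (hind _ _)); exact: PhiF.
  - move=> s _; rewrite -mulrBr mulrC Phi normrM [`|\1_B _|]ger0_norm; last by rewrite indicE.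
    rewrite indicE; case: (boolP (s \in B)) => [|_]; last by rewrite !mulr0.
    rewrite inE => Bs; rewrite !mulr1.
    have := Hs _ Bs; have := close _ (B01 _ Bs); have := close _ s01; rewrite -/c0.
    rewrite !ler_norml => /andP[a1 a2] /andP[a3 a4] /andP[a5 a6]; apply/andP; split; lra.
have step4 : \int[Q]_s (\1_B s * c0) = c0 * fine (tmarg P B).
  rewrite tB mulrC -RintegralZr //; last first.
    by apply: (@bounded_prob_integrable _ _ _ Q _ 1) => //; exact: measurable_indic.
have wB0 : 0 <= fine (tmarg P B) by rewrite fine_ge0 // tQ.
have step5 : `|c0 * fine (tmarg P B) - fine (tmarg P B) * \int[kap s0]_x g x| <= eta * fine (tmarg P B).
  rewrite [X in _ - X]mulrC -mulrBl normrM [X in _ * X]ger0_norm // ler_wpM2r // distrC.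
  exact: close.
rewrite -step4 in step5; rewrite step2 in step1.
set a := \int[P]_z _ in step1 *; set b := \int[Q]_s _ in step1 step3.
set c := \int[Q]_s _ in step3 step5; set d := fine _ * _ in step5 *.
have -> : a - d = (a - b) + (b - c) + (c - d) by ring.
apply: (le_trans (ler_normD _ _)); apply: (le_trans (lerD (ler_normD _ _) step5)).
apply: (le_trans (lerD (lerD step1 step3) (lexx _))).
by rewrite -!mulrDl ler_wpM2r //; lra.
Qed.

(** Half-open cells: for positive [N] the cell of index [N] is the single point [1], so [N.+1] cells
    cover the unit interval. *)
Definition gridcell (N i : nat) : set R := [set s | 0 <= s <= 1 /\ i%:R / N%:R <= s < i.+1%:R / N%:R].

Lemma measurable_gridcell N i : measurable (gridcell N i).
Proof.
rewrite (_ : gridcell N i = `[0, 1]%classic `&` `[i%:R / N%:R, i.+1%:R / N%:R[%classic).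
  exact: measurableI.
by apply/seteqP; split=> s /=; rewrite !in_itv.
Qed.

Lemma gridcellP N (s : R) : (0 < N)%N -> I01 s ->
  gridcell N (Num.truncn (N%:R * s)) s /\ (Num.truncn (N%:R * s) < N.+1)%N.
Proof.
move=> N0 s01; have /andP[s0 s1] := s01; have NR : (0 : R) < N%:R by rewrite ltr0n.
have h0 : 0 <= N%:R * s by rewrite mulr_ge0.
have /andP[h1 h2] := truncn_itv h0.
split; first by split => //; rewrite ler_pdivrMr // ltr_pdivlMr // [s * _]mulrC h1.
rewrite ltnS -(ler_nat R); apply: (le_trans h1).
by rewrite -[leRHS]mulr1 ler_wpM2l // ltW.
Qed.

Lemma gridcell_uniq N i j (s : R) : (0 < N)%N -> gridcell N i s -> gridcell N j s -> i = j.
Proof.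
move=> N0; have NR : (0 : R) < N%:R by rewrite ltr0n.
suff H i' j' : gridcell N i' s -> gridcell N j' s -> (i' <= j')%N.
  by move=> hi hj; apply/eqP; rewrite eqn_leq !H.
move=> [_ /andP[a1 a2]] [_ /andP[b1 b2]].
have := le_lt_trans a1 b2; rewrite ltr_pM2r ?invr_gt0 // ltr_nat ltnS //.
Qed.

Lemma grid_indic N (a : nat -> R) (s : R) : (0 < N)%N -> I01 s ->
  \sum_(i < N.+1) a i * \1_(gridcell N i) s = a (Num.truncn (N%:R * s)).
Proof.
move=> N0 s01; have [h1 h2] := gridcellP N0 s01.
rewrite (bigD1 (Ordinal h2)) //= big1 ?addr0; first by rewrite indicE mem_set ?mulr1.
move=> i ne; rewrite indicE memNset ?mulr0 // => h3.
by move/eqP: ne; apply; apply: val_inj => /=; exact: (gridcell_uniq N0 h3 h1).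
Qed.

Lemma gridcell_mass (P : probability (pt R n) R) N : (0 < N)%N ->
  P (Om `*` @I01 R) = 1%E -> \sum_(i < N.+1) fine (tmarg P (gridcell N i)) = 1.
Proof.
move=> Ngt0 PO.
have mOm := compact_measurableV cOm.
have mB i := measurable_gridcell N i.
have mSnd : measurable_fun [set: pt R n] (snd : pt R n -> R) by exact: measurable_snd.
have [Q QE] := pushforward_prob P mSnd.
have tQ : tmarg P = Q by rewrite tmargE QE.
have QI : Q (@I01 R) = 1%E.
  rewrite -tQ /tmarg; apply/eqP; rewrite eq_le; apply/andP; split.
    by apply: probability_le1; apply: measurableX => //; exact: measurable_I01.
  rewrite -PO; apply: le_measure; rewrite ?inE; last by move=> z [].
    by apply: measurableX => //; exact: measurable_I01.
  by apply: measurableX => //; exact: measurable_I01.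
have Ii (i : 'I_N.+1) : Q.-integrable setT (EFin \o (\1_(gridcell N i) : R -> R)).
    apply: (@bounded_prob_integrable _ _ _ Q _ 1); first exact: measurable_indic.
    by move=> x; rewrite indicE; case: (_ \in _); rewrite ?normr1 ?normr0.
  rewrite (eq_bigr (fun i : 'I_N.+1 => \int[Q]_s \1_(gridcell N i) s)); last first.
    by move=> i _; rewrite tQ Rintegral_indic.
  rewrite -Rintegral_sum //.
  rewrite -[RHS](prob_Rintegral_cst Q 1).
  apply: (@eq_Rintegral_prob1 _ _ _ Q (@I01 R) _ _ 1) => //.
  - exact: measurable_I01.
  - by apply: measurable_sum => i; exact: measurable_indic.
  - move=> s Is; have := @grid_indic N (fun=> 1) s Ngt0 Is.
    by under eq_bigr do rewrite mul1r; move=> ->; rewrite normr1.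
  - move=> s Is; have := @grid_indic N (fun=> 1) s Ngt0 Is.
    by under eq_bigr do rewrite mul1r.
Qed.

(** Two roundings are made: the time argument of [f], controlled by uniform continuity, and the
    kernel, controlled by [W2_test]. They cost [eta] and [6 * eta] in total, within
    [e = 8 * eta]. *)
Lemma discretization_cvg (P : probability (pt R n) R) kap (C : R) (f : 'cV[R]_n * R -> R) (e : R) :
  0 < C ->
  P (Om `*` @I01 R) = 1%E -> (forall s, I01 s -> kap s Om = 1%E) ->
  (forall A : set V, measurable A -> measurable_fun [set: R] (fun s : R => kap s A : \bar R)) ->
  (forall (A : set V) (B : set R), measurable A -> measurable B ->
     P (A `*` B) = (\int[tmarg P]_(s in B) kap s A)%E) ->
  (forall s t, I01 s -> I01 t -> (W2 (kap s) (kap t) <= (C * `|s - t|)%:E)%E) ->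
  continuous f -> 0 < e ->
  exists2 N0, (0 < N0)%N & forall N, (N0 <= N)%N ->
    `|\int[P]_z f z - \sum_(i < N.+1) fine (tmarg P (gridcell N i)) *
       \int[kap (i%:R / N%:R)]_y f (y, i%:R / N%:R)| <= e.
Proof.
move=> C0 PO kO mk dis kW cf e0.
have e8 : 0 < e / 8 by rewrite divr_gt0.
pose eta := e / 8.
have mOm := compact_measurableV cOm.
have mS : measurable (Om `*` @I01 R : set (pt R n)).
  by apply: measurableX => //; exact: measurable_I01.
have cS : compact (Om `*` @I01 R) by apply: compact_setX => //; exact: I01_compact.
have [F F0 fF] := compact_bounded_fun cS cf.
have [del d0 Hdel] := compact_unif_continuous cS cf e8.
have [K K0 HK] := quadratic_modulus cOm cf e8.
(* Beyond [b], the mesh is below [del], and the term [K * (C / N) ^+ 2] coming from [W2_test] is at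
   most [eta]. *)
pose b := del^-1 + K * C ^+ 2 / eta + 1.
have KC0 : 0 <= K * C ^+ 2 by rewrite mulr_ge0 // sqr_ge0.
exists (Num.truncn b).+1 => // N Nb.
have Ngt0 : (0 < N)%N by exact: leq_trans Nb.
have NR : (0 : R) < N%:R by rewrite ltr0n.
have bN : b < N%:R.
  by apply: (lt_le_trans (truncnS_gt b)); rewrite ler_nat.
have di0 : 0 < del^-1 by rewrite invr_gt0.
have KCe : 0 <= K * C ^+ 2 / eta by rewrite divr_ge0 // ltW.
have Ndel : N%:R^-1 < del.
  by rewrite invf_plt ?posrE //; apply: lt_trans bN; rewrite /b; lra.
have N1 : 1 <= N%:R :> R by rewrite ler1n.
have NKC : K * (C * N%:R^-1) ^+ 2 <= eta.
  have h1 : K * C ^+ 2 <= eta * N%:R.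
    by rewrite [eta * _]mulrC -ler_pdivrMr //; apply: le_trans (ltW bN); rewrite /b; lra.
  rewrite exprMn mulrA exprVn ler_pdivrMr ?exprn_gt0 //; apply: (le_trans h1).
  by rewrite ler_pM2l // expr2 ler_peMr // ltW.
have tI (i : 'I_N.+1) : I01 (i%:R / N%:R : R).
  by rewrite /I01 /= divr_ge0 //= ler_pdivrMr // mul1r ler_nat -ltnS.
have cfi (t : R) : continuous (fun y : 'cV[R]_n => f (y, t)) by exact: continuous_slice.
have mB i := measurable_gridcell N i.
have cellI01 i : gridcell N i `<=` @I01 R by move=> s [].
have celldist (i : 'I_N.+1) s : gridcell N i s -> `|s - i%:R / N%:R| <= N%:R^-1.
  move=> [_ /andP[h1 h2]]; rewrite -natr1 mulrDl mul1r in h2.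
  by rewrite ger0_norm; lra.
(* On the support, the sum of the [G i] is [f] with its time rounded down to the grid. *)
pose G (i : 'I_N.+1) (z : pt R n) : R := f (z.1 : 'cV[R]_n, i%:R / N%:R) * \1_(gridcell N i) z.2.
have mG i : measurable_fun [set: pt R n] (G i).
  apply: measurable_funM.
    exact: (measurableT_comp (measurable_continuousV (cfi (i%:R / N%:R))) measurable_fst).
  exact: (measurableT_comp (measurable_indic (mB i)) measurable_snd).
have GF i z : (Om `*` @I01 R) z -> `|G i z| <= F.
  move=> [Oz _]; rewrite normrM.
  apply: (@le_trans _ _ (`|f (z.1, i%:R / N%:R)|)); last by apply: fF; split=> //; exact: tI.
  by rewrite ler_piMr // indicE; case: (_ \in _); rewrite ?normr1 ?normr0.
have IG i : P.-integrable setT (EFin \o G i) by exact: prob1_integrable mS PO (mG i) (GF i).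
have GE z : (Om `*` @I01 R) z -> \sum_i G i z = f (z.1, (Num.truncn (N%:R * z.2))%:R / N%:R).
  move=> [Oz Iz]; exact: (@grid_indic N (fun i => f (z.1 : 'cV[R]_n, i%:R / N%:R)) z.2 Ngt0 Iz).
have mf := measurable_continuous_pt cf.
have step1 : `|\int[P]_z f z - \int[P]_z (\sum_i G i z)| <= eta.
  apply: (@Rintegral_close _ _ _ P (Om `*` @I01 R) _ _ F) => //.
  - by apply: measurable_sum.
  - move=> z Sz; rewrite GE //; have [Oz Iz] := Sz.
    have [h1 h2] := gridcellP Ngt0 Iz.
    by apply: fF; split=> //; exact: (tI (Ordinal h2)).
  - move=> z Sz; rewrite GE //; have [Oz Iz] := Sz.
    have [h1 h2] := gridcellP Ngt0 Iz.
    apply/ltW/Hdel => //; split; first exact: ballxx.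
    apply: (@le_lt_trans _ _ N%:R^-1) => //.
    exact: (celldist (Ordinal h2)).
have step2 (i : 'I_N.+1) : `|\int[P]_z G i z - fine (tmarg P (gridcell N i)) *
    \int[kap (i%:R / N%:R)]_y f (y, i%:R / N%:R)| <= (eta + eta + 4 * eta) * fine (tmarg P
      (gridcell N i)).
  apply: (@disintegration_close P kap (fun y => f (y, i%:R / N%:R))) => //.
    move=> s Bs.
    apply: (@le_trans _ _ (eta + K * (C * `|s - i%:R / N%:R|) ^+ 2)); last first.
      rewrite lerD2l; apply: le_trans NKC; rewrite ler_wpM2l // ler_sqr ?nnegrE; last 2 first.
      - by rewrite mulr_ge0 // ltW.
      - by rewrite mulr_ge0 ?invr_ge0 // ltW.
      by rewrite ler_pM2l //; exact: celldist.
    apply: (W2_test cOm) => //.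
    - exact: kO (cellI01 _ _ Bs).
    - exact: kO (tI i).
    - by rewrite mulr_ge0 // ltW.
    - by move=> x y Ox Oy; apply: HK => //; exact: tI.
    - by apply: kW; [exact: cellI01 Bs | exact: tI].
have wsum := gridcell_mass Ngt0 PO.
have step3 : `|\int[P]_z (\sum_i G i z) - \sum_(i < N.+1) fine (tmarg P (gridcell N i)) *
    \int[kap (i%:R / N%:R)]_y f (y, i%:R / N%:R)| <= eta + eta + 4 * eta.
  rewrite Rintegral_sum // -sumrB; apply: (le_trans (ler_norm_sum _ _ _)).
  apply: (@le_trans _ _ (\sum_(i < N.+1) (eta + eta + 4 * eta) * fine (tmarg P (gridcell N i)))).
    by apply: ler_sum => i _; exact: step2.
  by rewrite -mulr_sumr wsum mulr1.
move: step1 step3; rewrite /eta !ler_norml => /andP[a1 a2] /andP[a3 a4]; apply/andP; split; lra.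
Qed.

End DiscreteTime.

(** * Reduction of the map to the law at time 0 *)

Section Collapse.
Context (R : realType) (n m : nat) (Om : set 'cV[R]_n) (C sig : R) (Lam : cmap R n m).
Hypotheses (cOm : compact Om) (C0 : 0 < C) (sig01 : 0 < sig < 1).
Hypotheses (Lc : weak_cont Om C sig Lam) (Lca : causal Om C sig Lam)
  (Lid : identifiable Om C sig Lam).
Local Notation V := (borelV R n).

Lemma mask_discrete_eq (kap : R -> probability V R) N (w t : nat -> R) (s s' : R) :
  (forall i, (i < N)%N -> Itv0 s (t i) <-> Itv0 s' (t i)) ->
  Defs.mask (discrete kap N w t) s = Defs.mask (discrete kap N w t) s'.
Proof.
move=> H.
have E A : discrete kap N w t (A `&` (setT `*` Itv0 s)) = discrete kap N w t (A `&` (setT `*` Itv0 s')).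
  apply: eq_bigr => i _; congr (_ * kap _ _)%E.
  by apply/seteqP; split=> y [h1 [h2 h3]]; split=> //; split=> //; exact/H.
apply/funext => A; rewrite /Defs.mask E; congr (_ * (fine _)^-1%:E)%E.
by have := E setT; rewrite !setTI.
Qed.

Lemma gridpt_le N i j (s : R) : (0 < N)%N -> i%:R / N%:R <= s < i.+1%:R / N%:R ->
  (j%:R / N%:R <= s) = (j <= i)%N.
Proof.
move=> N0 /andP[h1 h2]; have NR : (0 : R) < N%:R by rewrite ltr0n.
apply/idP/idP => h.
  by have := le_lt_trans h h2; rewrite ltr_pM2r ?invr_gt0 // ltr_nat ltnS.
by apply: le_trans h1; rewrite ler_pM2r ?invr_gt0 // ler_nat.
Qed.

Lemma discrete_const (kap : R -> probability V R) N (w : nat -> R) x t :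
  (0 < N)%N -> Lip Om C sig (discrete kap N.+1 w (fun i => i%:R / N%:R)) ->
  Om x -> I01 t ->
  Lam (discrete kap N.+1 w (fun i => i%:R / N%:R)) x t =
  Lam (discrete kap N.+1 w (fun i => i%:R / N%:R)) x 0.
Proof.
move=> N0; set nu := discrete _ _ _ _ => Ln Ox.
have NR : (0 : R) < N%:R by rewrite ltr0n.
have same i s s' : I01 s -> I01 s' -> i%:R / N%:R <= s < i.+1%:R / N%:R ->
    i%:R / N%:R <= s' < i.+1%:R / N%:R -> Lam nu x s = Lam nu x s'.
  move=> s01 s01' hs hs'; rewrite (Lca Ln Ox s01) (Lca Ln Ox s01').
  apply: Lid => //; apply: mask_discrete_eq => j _.
  rewrite /Itv0 /=; split=> /andP[-> h] /=.
    by rewrite (gridpt_le j N0 hs'); rewrite (gridpt_le j N0 hs) in h.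
  by rewrite (gridpt_le j N0 hs); rewrite (gridpt_le j N0 hs') in h.
have ptI i : (i <= N)%N -> I01 (i%:R / N%:R : R).
  by move=> iN; rewrite /I01 /= divr_ge0 //= ler_pdivrMr // mul1r ler_nat.
have ptc i : (i%:R / N%:R <= i%:R / N%:R :> R) && (i%:R / N%:R < i.+1%:R / N%:R :> R).
  by rewrite lexx ltr_pM2r ?invr_gt0 // ltr_nat /=.
have grid i : (i <= N)%N -> Lam nu x (i%:R / N%:R) = Lam nu x 0.
  elim: i => [_|i IH iN]; first by rewrite mul0r.
  apply/eqP; rewrite -subr_eq0; apply/eqP/enorm_le0/ler_addgt0Pl => e e0; rewrite addr0.
  have [k [f [del [d0 [_ H]]]]] := Lc Ln Ox (ptI _ iN) e0.
  (* Below [del], so that [s] is in the neighbourhood of the grid point, and below the mesh, so that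
     [s] lies in the preceding cell where the value is known. The measure is held fixed, so its test
     conditions are immediate. *)
  pose r := Num.min (del / 2) (N%:R^-1 / 2).
  have r0 : 0 < r by rewrite lt_min !divr_gt0 // invr_gt0.
  have r1 : r <= del / 2 by rewrite ge_min lexx.
  have r2 : r <= N%:R^-1 / 2 by rewrite ge_min lexx orbT.
  have iv : 0 < (N%:R^-1 : R) by rewrite invr_gt0.
  pose s := i.+1%:R / N%:R - r.
  have sE : i.+1%:R / N%:R = i%:R / N%:R + N%:R^-1 :> R by rewrite -natr1 mulrDl mul1r.
  have sI : i%:R / N%:R <= s < i.+1%:R / N%:R.
    by rewrite /s sE; apply/andP; split; lra.
  have s01 : I01 s.
    have /andP[a1 a2] := ptI _ iN; have /andP[a3 a4] := ptI _ (ltnW iN).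
    by rewrite /I01 /=; move/andP: sI => [a5 a6]; apply/andP; split; lra.
  have hs : Lam nu x s = Lam nu x 0.
    by rewrite -(IH (ltnW iN)); apply: (same i) => //; apply: ptI; exact: ltnW.
  have := H nu x s Ln Ox s01; rewrite hs enorm_distC => h; apply/ltW/h.
  - by move=> j; rewrite subrr normr0.
  - by rewrite subrr /enorm /enorm2 big1 ?sqrtr0 // => j _; rewrite mxE expr0n.
  - by rewrite /s addrAC subrr add0r normrN gtr0_norm //; lra.
move=> t01; have [[_ h1] h2] := gridcellP N0 t01.
by rewrite -(grid _ h2); apply: (same (Num.truncn (N%:R * t))) => //; exact: ptI.
Qed.

Lemma mask_discrete0 (kap : R -> probability V R) N (w : nat -> R) :
  (0 < N)%N -> 0 < w 0%N ->
  Defs.mask (discrete kap N.+1 w (fun i => i%:R / N%:R)) 0 = initial (kap 0).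
Proof.
move=> N0 w0; have NR : (0 : R) < N%:R by rewrite ltr0n.
have E A : discrete kap N.+1 w (fun i => i%:R / N%:R) (A `&` (setT `*` Itv0 0)) =
    ((w 0%N)%:E * kap 0%R [set y | A (y, 0%R)])%E.
  rewrite /discrete big_ord_recl /= big1 ?adde0.
    rewrite mul0r; congr (_ * kap _ _)%E; apply/seteqP; split=> y /=; first by case.
    by move=> h; split=> //; split=> //; rewrite /Itv0 /= lexx.
  move=> i _; rewrite (_ : [set y | _] = set0) ?measure0 ?mule0 //.
  apply/seteqP; split=> // y [_ [_ /andP[/= _]]].
  by rewrite leNgt divr_gt0.
apply/funext => A; rewrite /Defs.mask /tmarg E.
have := E setT; rewrite setTI => ->.
have kT : kap 0 [set y | [set: V * R] (y, 0 : R)] = 1%E by exact: probability_setT.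
rewrite kT mule1 /=.
by rewrite muleAC -EFinM divff ?mul1e // gt_eqF.
Qed.

(** The law is [kap 0]. The second clause ties it to what averaging layers can reach, namely means
    over the tokens at time 0. *)
Lemma collapse (P : probability (pt R n) R) : Lip Om C sig P ->
  exists nu : probability V R, [/\ nu Om = 1%E,
    (forall g : 'cV[R]_n -> R, continuous g ->
      \int[P]_z (g z.1 * \1_[set 0] z.2) = fine (tmarg P [set 0]) * \int[nu]_x g x) &
    forall x t, Om x -> I01 t -> Lam P x t = Lam (initial nu) x 0].
Proof.
move=> Lmu; have [_ [muO [sigmu [kap [kO [mk [dis kW]]]]]]] := Lmu.
have z01 : I01 (0 : R) by rewrite /I01 /= lexx ler01.
exists (kap 0); split.
- exact: kO.
- move=> g cg; apply/eqP; rewrite -subr_eq0 -normr_le0; apply/ler_addgt0Pl => e e0.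
  (* The quarter cancels the factor 4 in [disintegration_close]. *)
  have e5 : 0 < e / 4 by rewrite divr_gt0.
  have sub0 : [set 0] `<=` @I01 R by move=> s /= ->.
  have H0 s : [set 0 : R] s -> `|\int[kap s]_x g x - \int[kap 0]_x g x| <= 0.
    by move=> /= ->; rewrite subrr normr0.
  have := disintegration_close cOm muO kO mk dis cg (measurable_set1 0) sub0 z01 e5 H0.
  move=> h; apply: (le_trans h); rewrite add0r mulrCA divff // mulr1 addr0 ler_piMr ?(ltW e0) //.
  have m0 : measurable (setT `*` [set 0] : set (pt R n)) by apply: measurableX.
  by rewrite -lee_fin fineK ?fin_num_measure //; exact: probability_le1.
move=> x t Ox t01.
apply/eqP; rewrite -subr_eq0; apply/eqP/enorm_le0/ler_addgt0Pl => e e0; rewrite addr0.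
have [k [f [del [d0 [cf H]]]]] := Lc Lmu Ox t01 e0.
have d2 : 0 < del / 2 by rewrite divr_gt0.
have /choice [N0 HN0] (j : 'I_k) : exists N0, (0 < N0)%N /\ forall N, (N0 <= N)%N ->
    `|\int[P]_z f j z - \sum_(i < N.+1) fine (tmarg P (gridcell N i)) *
       \int[kap (i%:R / N%:R)]_y f j (y, i%:R / N%:R)| <= del / 2.
  by have [N0 h1 h2] := discretization_cvg cOm C0 muO kO mk dis kW (cf j) d2; exists N0.
(* One grid fine enough for all the finitely many tests; the successor makes it positive. *)
pose N := (\max_(j < k) N0 j).+1.
have N0N j : (N0 j <= N)%N by apply: leqW; exact: leq_bigmax.
have Ngt0 : (0 < N)%N by [].
pose w (i : nat) := if (i < N.+1)%N then fine (tmarg P (gridcell N i)) else 0.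
have NR : (0 : R) < N%:R by rewrite ltr0n.
have mSnd : measurable_fun [set: pt R n] (snd : pt R n -> R) by exact: measurable_snd.
have [Q QE] := pushforward_prob P mSnd.
have tQ : tmarg P = Q by rewrite tmargE QE.
have mG i := measurable_gridcell N i (R := R).
have w0 i : 0 <= w i by rewrite /w; case: ifP => // _; rewrite fine_ge0 // tQ.
have w1 : \sum_(i < N.+1) w i = 1.
  rewrite (eq_bigr (fun i : 'I_N.+1 => fine (tmarg P (gridcell N i)))); last by move=> i _;
    rewrite /w ltn_ord.
  exact: (gridcell_mass cOm).
(* The cell of index 0 contains time 0, and its atom is placed there, so the mass [sig] survives the
   discretisation. *)
have sw : sig <= w 0%N.
  rewrite /w /= -lee_fin fineK ?tQ ?fin_num_measure //.
  apply: (le_trans sigmu); rewrite tQ; apply: le_measure; rewrite ?inE //.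
  by move=> s /= ->; split; rewrite ?lexx ?ler01 // mul0r lexx divr_gt0.
have Ln : Lip Om C sig (discrete kap N.+1 w (fun i => i%:R / N%:R)).
  apply: Lip_discrete => //; last by rewrite mul0r.
  by move=> i; rewrite ltnS => iN; rewrite /I01 /= divr_ge0 //= ler_pdivrMr // mul1r ler_nat.
have LE : Lam (discrete kap N.+1 w (fun i => i%:R / N%:R)) x t = Lam (initial (kap 0)) x 0.
  rewrite discrete_const // (Lca Ln Ox) ?mask_discrete0 //.
  by apply: lt_le_trans sw; case/andP: sig01.
have := H _ x t Ln Ox t01; rewrite LE enorm_distC => h; apply/ltW/h.
- move=> j; have [_ /(_ N (N0N j)) hj] := HN0 j.
  have [Q' [Q'E Q'f]] := discrete_prob kap (fun i => i%:R / N%:R) w0 w1.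
  have -> : fine (\int[discrete kap N.+1 w (fun i => (i%:R / N%:R)%R)]_z (f j z)%:E)%E =
    \int[Q']_z f j z.
    exact: (congr1 (fun q : set (pt R n) -> \bar R => fine (\int[q]_z (f j z)%:E)%E) (esym Q'E)).
  rewrite -[X in _ - X]/(\int[P]_z f j z).
  have mf := measurable_continuous_pt (cf j).
  have cS : compact (Om `*` @I01 R) by apply: compact_setX => //; exact: I01_compact.
  have mOm := compact_measurableV cOm.
  have cfi (s : R) := @continuous_slice _ _ _ _ s (cf j).
  have Q'sum : \int[Q']_z f j z = \sum_(i < N.+1) fine (tmarg P (gridcell N i)) *
       \int[kap (i%:R / N%:R)]_y f j (y, i%:R / N%:R).
    rewrite Q'f //.
      by apply: eq_bigr => i _; rewrite /w ltn_ord.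
    move=> i iN; have [B B0 fB] := compact_bounded_fun cOm (cfi (i%:R / N%:R)).
    apply: (prob1_integrable mOm _ (measurable_continuousV (cfi (i%:R / N%:R))) fB).
    by apply: kO; rewrite /I01 /= divr_ge0 //= ler_pdivrMr // mul1r ler_nat -ltnS.
  by rewrite Q'sum distrC; apply: le_lt_trans hj _; lra.
- by rewrite subrr /enorm /enorm2 big1 ?sqrtr0 // => j _; rewrite mxE expr0n.
- by rewrite subrr normr0.
Qed.

End Collapse.

(** * The McShane formula *)

Section McShane.
Context (R : realType).

Lemma max_fold_le (s : seq R) (c : R) : 0 <= c ->
  (forall a, a \in s -> a <= c) -> foldr Num.max 0 s <= c.
Proof.
move=> c0; elim: s => //= a s IH h; rewrite ge_max h ?mem_head //=.
by apply: IH => b bs; apply: h; rewrite in_cons bs orbT.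
Qed.

Lemma le_max_fold (s : seq R) a : a \in s -> a <= foldr Num.max 0 s.
Proof.
elim: s => //= b s IH; rewrite in_cons => /predU1P[->|/IH h]; first by rewrite le_max lexx.
by rewrite le_max h orbT.
Qed.

Lemma max_fold_ge0 (s : seq R) : 0 <= foldr Num.max 0 s.
Proof. by elim: s => //= a s IH; rewrite le_max IH orbT. Qed.

Definition supdist k (c c' : 'I_k -> R) : R :=
  foldr Num.max 0 [seq `|c i - c' i| | i <- enum 'I_k].

Lemma le_supdist k (c c' : 'I_k -> R) i : `|c i - c' i| <= supdist c c'.
Proof. by apply: le_max_fold; apply/mapP; exists i => //; rewrite mem_enum. Qed.

Lemma supdist_le k (c c' : 'I_k -> R) (e : R) : 0 <= e ->
  (forall i, `|c i - c' i| <= e) -> supdist c c' <= e.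
Proof. by move=> e0 h; apply: max_fold_le => // _ /mapP [i _ ->]. Qed.

Lemma supdist_ge0 k (c c' : 'I_k -> R) : 0 <= supdist c c'.
Proof. exact: max_fold_ge0. Qed.

(** [V] is a cap that starts the minimum. Folding over a list matches the network, which processes
    one centre per round of register updates. *)
Definition mcshane k (V K : R) (js : seq (R * ('I_k -> R))) (c : 'I_k -> R) : R :=
  foldr (fun j acc => Num.min acc (j.1 + K * supdist c j.2)) V js.

(** Total boundedness of the range of [c], by rounding to a grid of mesh [del / 2] and choosing one
    representative for each attained code. The centres thus come from [T], where [h] has values. *)
Lemma finite_net (T : Type) (k : nat) (c : T -> 'I_k -> R) (B del : R) : 0 < del ->
  (forall a i, `|c a i| <= B) ->
  exists l : seq T, forall a, exists2 b, List.In b l & forall i, `|c a i - c b i| < del.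
Proof.
move=> d0 cB.
have [[a0 _]|ne] := pselect (exists a : T, True); last first.
  by exists [::] => a; case: ne; exists a.
pose J := (Num.truncn (2 * B / (del / 2))).+1.
pose code a : {ffun 'I_k -> 'I_J} := [ffun i => inord (Num.truncn ((c a i + B) / (del / 2)))].
have d2 : 0 < del / 2 by rewrite divr_gt0.
have codeE a b : code a = code b -> forall i, `|c a i - c b i| < del.
  move=> E i; have := congr1 (fun g : {ffun 'I_k -> 'I_J} => val (g i)) E; rewrite /= !ffunE.
  have pos x : 0 <= (c x i + B) / (del / 2).
    by rewrite divr_ge0 ?(ltW d2) //; have := cB x i; rewrite ler_norml => /andP[]; lra.
  have lt x : (Num.truncn ((c x i + B) / (del / 2)) < J)%N.
    rewrite ltnS; apply: le_truncn; rewrite ler_pM2r ?invr_gt0 //.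
    by have := cB x i; rewrite ler_norml => /andP[]; lra.
  rewrite !inordK // => Et.
  have /andP[a1 a2] := truncn_itv (pos a); have /andP[b1 b2] := truncn_itv (pos b).
  rewrite -Et in b1 b2.
  rewrite ler_pdivlMr // in a1; rewrite ltr_pdivrMr // in a2.
  rewrite ler_pdivlMr // in b1; rewrite ltr_pdivrMr // in b2.
  rewrite -natr1 mulrDl mul1r in a2 b2.
  move: (_%:R * _) a1 a2 b1 b2 => X a1 a2 b1 b2.
  by rewrite ltr_norml; apply/andP; split; lra.
have /choice [rep Hrep] (g : {ffun 'I_k -> 'I_J}) : exists b : T, (exists a, code a = g) -> code b = g.
  have [[a Ha]|n] := pselect (exists a, code a = g); first by exists a.
  by exists a0.
exists [seq rep g | g <- enum {ffun 'I_k -> 'I_J}] => a; exists (rep (code a)).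
  apply/List.in_map.
  have : code a \in enum {ffun 'I_k -> 'I_J} by rewrite mem_enum.
  by elim: (enum _) => //= g s IH; rewrite in_cons => /predU1P[->|/IH]; [left|right].
by apply: codeE; rewrite Hrep //; exists a.
Qed.

Lemma mcshane_approx (T : Type) (k : nat) (c : T -> 'I_k -> R) (h : T -> R) (B del eps : R) :
  0 < del -> 0 < eps -> (forall a i, `|c a i| <= B) ->
  (forall a b, (forall i, `|c a i - c b i| < del) -> `|h a - h b| <= eps) ->
  exists (V K : R) (js : seq (R * ('I_k -> R))), 0 <= K /\
    forall a, `|h a - mcshane V K js (c a)| <= 2 * eps.
Proof.
move=> d0 e0 cB hh.
have [l0 Hl0] := finite_net d0 cB.
(* [h] is bounded because it stays within [eps] of its finitely many values on a [del]-net. *)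
have [H H0 hH] : exists2 H, 0 < H & forall a, `|h a| <= H.
  have [H1 H10 hH1] : exists2 H, 0 <= H & forall b, List.In b l0 -> `|h b| <= H.
    elim: l0 {Hl0} => [|b l [H1 H10 IH]]; first by exists 0.
    exists (H1 + `|h b|); first by rewrite addr_ge0.
    by move=> b' /= [<-|/IH h1]; [rewrite lerDr | rewrite (le_trans h1) // lerDl].
  exists (H1 + eps); first by rewrite ltr_wpDl.
  move=> a; have [b bl ab] := Hl0 a.
  have -> : h a = h b + (h a - h b) by ring.
  by apply: (le_trans (ler_normD _ _)); rewrite lerD // ?hH1 // hh.
(* With this slope a centre at distance at least [del] contributes at least [- H + 2 * H], hence no
   less than [h a]; a closer centre contributes at least [h a - eps]. *)
pose K := 2 * H / del.
have K0 : 0 < K by rewrite divr_gt0 // mulr_gt0.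
(* Some centre is then so close that its distance term is at most [eps] and its value differs from
   [h a] by at most [eps]. *)
pose d1 := Num.min del (eps / K).
have d10 : 0 < d1 by rewrite lt_min d0 divr_gt0.
have [l Hl] := finite_net d10 cB.
exists H, K, [seq (h b, c b) | b <- l]; split; first exact: ltW.
move=> a; rewrite distrC ler_norml; apply/andP; split.
  suff : h a - eps <= mcshane H K [seq (h b, c b) | b <- l] (c a) by lra.
  elim: l {Hl} => [|b l IH] /=; first by have := hH a; rewrite ler_norml => /andP[]; lra.
  rewrite le_min IH /=.
  have [hd|/existsNP [i /negP]] := pselect (forall i, `|c a i - c b i| < del).
    have := hh _ _ hd; rewrite ler_norml => /andP[a1 a2].
    have : 0 <= K * supdist (c a) (c b) by rewrite mulr_ge0 ?supdist_ge0 // ltW.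
    by lra.
  rewrite -leNgt => hd.
  have : K * del <= K * supdist (c a) (c b).
    by rewrite ler_wpM2l ?(ltW K0) //; apply: (le_trans hd); exact: le_supdist.
  rewrite /K divfK ?gt_eqF // -/K.
  have := hH a; have := hH b; rewrite !ler_norml => /andP[a1 a2] /andP[a3 a4].
  by move: (K * _) => X; lra.
have [b bl ab] := Hl a.
suff : mcshane H K [seq (h b, c b) | b <- l] (c a) <= h b + K * supdist (c a) (c b).
  have : K * supdist (c a) (c b) <= eps.
    rewrite mulrC -ler_pdivlMr //; apply: supdist_le; first by rewrite divr_ge0 // ltW.
    by move=> i; apply: ltW; apply: (lt_le_trans (ab i)); rewrite ge_min lexx orbT.
  have /hh : forall i, `|c a i - c b i| < del.
    by move=> i; apply: (lt_le_trans (ab i)); rewrite ge_min lexx.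
  rewrite ler_norml => /andP[a1 a2]; move: (K * _) => X; lra.
elim: l bl {Hl} => //= b' l IH [->|/IH h1]; rewrite ge_min ?lexx ?orbT //.
by rewrite h1.
Qed.

End McShane.

(** * Functions computed by MLPs *)

Section MLP.
Context (R : realType).

Definition mlpable n m (f : 'cV[R]_n -> 'cV[R]_m) : Prop :=
  exists F : mlp R n m, forall x, mlp_eval F x = f x.

Lemma mlpable_ext n m (f g : 'cV[R]_n -> 'cV[R]_m) : f =1 g -> mlpable f -> mlpable g.
Proof. by move=> fg [F HF]; exists F => x; rewrite HF fg. Qed.

Lemma mlpable_affine n m (A : 'M[R]_(m, n)) (b : 'cV[R]_m) :
  mlpable (fun x => A *m x + b).
Proof. by exists (mlp_aff A b). Qed.

Lemma mlpable_lin n m (A : 'M[R]_(m, n)) : mlpable (fun x => A *m x).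
Proof. by apply: mlpable_ext (mlpable_affine A 0) => x; rewrite addr0. Qed.

Lemma mlpable_relu n : mlpable (@relu R n).
Proof.
by exists (mlp_cons 1%:M 0 (mlp_aff 1%:M 0)) => x /=; rewrite !mul1mx !addr0.
Qed.

(** The affine map is absorbed into the first layer of [G]; this removes the seam when two MLPs are
    composed. *)
Lemma mlp_precomp_affine p m (G : mlp R p m) n (A : 'M[R]_(p, n)) (b : 'cV[R]_p) :
  mlpable (fun x => mlp_eval G (A *m x + b)).
Proof.
case: G A b => [p' m' A' b'|p' q m' A' b' G] A b.
  exists (mlp_aff (A' *m A) (A' *m b + b')) => x /=.
  by rewrite mulmxDr mulmxA addrA.
exists (mlp_cons (A' *m A) (A' *m b + b') G) => x /=.
by rewrite mulmxDr mulmxA addrA.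
Qed.

Lemma mlp_comp n p (F : mlp R n p) m (G : mlp R p m) :
  mlpable (fun x => mlp_eval G (mlp_eval F x)).
Proof.
elim: F m G => [n' p' A b|n' q p' A b F IH] m G; first exact: mlp_precomp_affine.
by have [H HH] := IH m G; exists (mlp_cons A b H) => x /=; rewrite HH.
Qed.

Lemma mlpable_comp n p m (f : 'cV[R]_n -> 'cV[R]_p) (g : 'cV[R]_p -> 'cV[R]_m) :
  mlpable f -> mlpable g -> mlpable (fun x => g (f x)).
Proof.
move=> [F HF] [G HG]; apply: mlpable_ext (mlp_comp F G) => x.
by rewrite HG HF.
Qed.

Lemma relu_col n m (a : 'cV[R]_n) (b : 'cV[R]_m) : relu (col_mx a b) = col_mx (relu a) (relu b).
Proof. exact: map_col_mx. Qed.

Lemma reluBN n (a : 'cV[R]_n) : relu a - relu (- a) = a.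
Proof.
apply/matrixP => i j; rewrite !mxE /Num.max.
by case: ltP => h1; case: ltP => h2; lra.
Qed.

(* A hidden layer can carry u along, since u = relu u - relu (-u). *)
Lemma mlp_par n m (G : mlp R n m) p :
  mlpable (fun z : 'cV[R]_(p + n) => col_mx (usubmx z) (mlp_eval G (dsubmx z))).
Proof.
elim: G => [n' m' A b|n' q m' A b G IH].
  apply: mlpable_ext (mlpable_affine (block_mx 1%:M 0 0 A) (col_mx 0 b)) => z /=.
  by rewrite -{1}[z]vsubmxK mul_block_col mul1mx !mul0mx addr0 add0r add_col_mx addr0.
have h : mlpable (fun z : 'cV[R]_(p + n') => col_mx (usubmx z) (relu (A *m dsubmx z + b))).
  apply: (@mlpable_ext _ _ (fun z : 'cV[R]_(p + n') =>
    block_mx (row_mx 1%:M (- 1%:M)) 0 0 1%:M *m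
      relu (block_mx (col_mx 1%:M (- 1%:M)) 0 0 A *m z + col_mx 0 b))).
    move=> z; rewrite -{1}[z]vsubmxK mul_block_col !mul0mx addr0 add0r add_col_mx addr0.
    rewrite [col_mx _ _ *m usubmx z]mul_col_mx mulNmx mul1mx !relu_col mul_block_col !mul0mx addr0 add0r.
    by rewrite mul_row_col mulNmx !mul1mx reluBN.
  have h1 := mlpable_affine (block_mx (col_mx 1%:M (- 1%:M)) 0 0 A) (col_mx (0 : 'cV[R]_(p + p)) b).
  exact: (mlpable_comp (mlpable_comp h1 (mlpable_relu _)) (mlpable_lin _)).
apply: mlpable_ext (mlpable_comp h IH) => z /=.
by rewrite col_mxKu col_mxKd.
Qed.

Lemma mlpable_pair n m1 m2 (f : 'cV[R]_n -> 'cV[R]_m1) (g : 'cV[R]_n -> 'cV[R]_m2) :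
  mlpable f -> mlpable g -> mlpable (fun x => col_mx (f x) (g x)).
Proof.
move=> [F HF] [G HG].
have sw a b : mlpable (fun z : 'cV[R]_(a + b) => col_mx (dsubmx z) (usubmx z)).
  apply: mlpable_ext (mlpable_lin (block_mx 0 1%:M 1%:M 0)) => z /=.
  by rewrite -{1}[z]vsubmxK mul_block_col !mul1mx !mul0mx add0r addr0.
have dup : mlpable (fun x : 'cV[R]_n => col_mx x x).
  apply: mlpable_ext (mlpable_lin (col_mx 1%:M 1%:M)) => z /=.
  by rewrite mul_col_mx !mul1mx.
have h1 := mlpable_comp dup (mlp_par G n).
have h2 := mlpable_comp h1 (sw n m2).
have h3 := mlpable_comp h2 (mlp_par F m2).
have h4 := mlpable_comp h3 (sw m2 m1).
apply: mlpable_ext h4 => x.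
by rewrite !(col_mxKu, col_mxKd) HF HG.
Qed.

Definition mlps n (f : 'cV[R]_n -> R) : Prop := mlpable (fun x => (f x)%:M : 'cV[R]_1).

Lemma mlps_ext n (f g : 'cV[R]_n -> R) : f =1 g -> mlps f -> mlps g.
Proof. by move=> fg; apply: mlpable_ext => x; rewrite fg. Qed.

Lemma mlps_comp n m (h : 'cV[R]_n -> 'cV[R]_m) (f : 'cV[R]_m -> R) :
  mlpable h -> mlps f -> mlps (fun x => f (h x)).
Proof. by move=> mh mf; exact: (mlpable_comp mh mf). Qed.

Lemma mlps_lin2 n (f g : 'cV[R]_n -> R) (a b c : R) : mlps f -> mlps g ->
  mlps (fun x => a * f x + b * g x + c).
Proof.
move=> mf mg.
have := mlpable_comp (mlpable_pair mf mg)
  (mlpable_affine (row_mx (a%:M : 'M[R]_1) (b%:M : 'M[R]_1)) (c%:M : 'cV[R]_1)).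
apply: mlpable_ext => x.
by rewrite mul_row_col -!scalar_mxM -!raddfD.
Qed.

Lemma mlps_cst n (c : R) : mlps (fun _ : 'cV[R]_n => c).
Proof.
apply: mlpable_ext (mlpable_affine 0 (c%:M : 'cV[R]_1)) => x.
by rewrite mul0mx add0r.
Qed.

Lemma mlps_coord n (i : 'I_n) : mlps (fun x : 'cV[R]_n => x i 0).
Proof.
apply: mlpable_ext (mlpable_lin (delta_mx 0 i)) => x.
apply/matrixP => a b; rewrite !mxE (bigD1 i) //= big1 => [|j ji].
  by rewrite mxE (ord1 a) (ord1 b) !eqxx mul1r addr0.
by rewrite mxE (ord1 a) (negbTE ji) andbF mul0r.
Qed.

(** Rests on [max(f, g) = f + relu(g - f)]; minima and absolute values follow by changes of sign. *)
Lemma mlps_max n (f g : 'cV[R]_n -> R) : mlps f -> mlps g -> mlps (fun x => Num.max (f x) (g x)).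
Proof.
move=> mf mg.
have h1 := mlps_lin2 1 (-1) 0 mg mf.
have h2 : mlps (fun x => Num.max (1 * g x + -1 * f x + 0) 0).
  apply: mlpable_ext (mlpable_comp h1 (mlpable_relu 1)) => x.
  by apply/matrixP => a b; rewrite !mxE (ord1 a) (ord1 b) eqxx !mulr1n.
apply: mlps_ext (mlps_lin2 1 1 0 mf h2) => x.
by rewrite /Num.max; case: ltP => a1; case: ltP => a2; lra.
Qed.

Lemma mlps_min n (f g : 'cV[R]_n -> R) : mlps f -> mlps g -> mlps (fun x => Num.min (f x) (g x)).
Proof.
move=> mf mg.
have h1 := mlps_lin2 (-1) 0 0 mf mf; have h2 := mlps_lin2 (-1) 0 0 mg mg.
have h3 := mlps_max h1 h2.
apply: mlps_ext (mlps_lin2 (-1) 0 0 h3 h3) => x.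
by rewrite /Num.max /Num.min; case: ltP => a1; case: ltP => a2; lra.
Qed.

Lemma mlps_dist n (f : 'cV[R]_n -> R) (c : R) : mlps f -> mlps (fun x => `|f x - c|).
Proof.
move=> mf; have h1 := mlps_lin2 1 0 (- c) mf mf; have h2 := mlps_lin2 (-1) 0 c mf mf.
apply: mlps_ext (mlps_max h1 h2) => x.
by rewrite /Num.max; case: ltP => h; [rewrite ler0_norm | rewrite ger0_norm]; lra.
Qed.

Lemma mlpable_coords n m (f : 'cV[R]_n -> 'cV[R]_m) :
  (forall i, mlps (fun x => f x i 0)) -> mlpable f.
Proof.
elim: m f => [|m IH] f mf.
  apply: mlpable_ext (mlpable_affine 0 0) => x.
  by apply/matrixP => -[].
have h1 : mlpable (fun x => \col_i f x (lift ord0 i) 0).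
  apply: IH => i; apply: mlps_ext (mf (lift ord0 i)) => x.
  by rewrite mxE.
apply: mlpable_ext (mlpable_pair (mf ord0) h1) => x.
apply/matrixP => i j; rewrite (ord1 j) -[LHS]/((col_mx _ _ : 'cV[R]_(1 + m)) i 0).
rewrite mxE; case: splitP => k E.
  by rewrite mxE (ord1 k) eqxx mulr1n; congr (f x _ _); apply: val_inj; rewrite /= E (ord1 k).
by rewrite mxE; congr (f x _ _); apply: val_inj; rewrite /= E.
Qed.

Lemma mlps_supdist n k (c : 'I_k -> 'cV[R]_n -> R) (c' : 'I_k -> R) :
  (forall i, mlps (c i)) -> mlps (fun x => supdist (fun i => c i x) c').
Proof.
move=> mc; rewrite /supdist; elim: (enum _) => [|i s IH] /=; first exact: mlps_cst.
by apply: mlps_max => //; exact: mlps_dist.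
Qed.

Lemma mlps_mcshane n k (V K : R) js (c : 'I_k -> 'cV[R]_n -> R) :
  (forall i, mlps (c i)) -> mlps (fun x => mcshane V K js (fun i => c i x)).
Proof.
move=> mc; elim: js => [|j js IH] /=; first exact: mlps_cst.
apply: mlps_min => //.
have h := mlps_supdist j.2 mc.
by apply: mlps_ext (mlps_lin2 K 0 j.1 h h) => x; rewrite mul0r addr0 addrC.
Qed.

Lemma measurable_mlp d (T : measurableType d) n m (F : mlp R n m) (phi : T -> 'cV[R]_n) :
  (forall i, measurable_fun setT (fun x => phi x i 0)) ->
  forall i, measurable_fun setT (fun x => mlp_eval F (phi x) i 0).
Proof.
have aff p q (A : 'M[R]_(p, q)) (b : 'cV[R]_p) (psi : T -> 'cV[R]_q) :
    (forall i, measurable_fun setT (fun x => psi x i 0)) ->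
    forall i, measurable_fun setT (fun x => (A *m psi x + b) i 0).
  move=> mpsi i.
  rewrite (_ : (fun x => _) = (fun x => \sum_j A i j * psi x j 0 + b i 0)).
    apply: measurable_funD => //; apply: measurable_sum => j; exact: measurable_funM.
  by apply/funext => x; rewrite !mxE.
elim: F phi => [p q A b|p r q A b F IH] phi mphi /=; first exact: aff.
apply: IH => i.
rewrite (_ : (fun x => _) = (fun x => Num.max ((A *m phi x + b) i 0) 0)).
  by apply: measurable_maxr => //; exact: aff.
by apply/funext => x; rewrite mxE.
Qed.

(** Universal approximation through the McShane formula in the coordinates. Clamping at [B + e]
    keeps the values on [Om] and gives a bound on the whole space, which the averaging layers
    require. *)
Lemma mlps_approx n (Om : set 'cV[R]_n) (f : 'cV[R]_n -> R) (e : R) :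
  compact Om -> continuous f -> 0 < e ->
  exists (g : 'cV[R]_n -> R) (B : R), [/\ mlps g, forall x, `|g x| <= B &
    forall x, Om x -> `|f x - g x| <= e].
Proof.
move=> cOm cf e0.
have e2 : 0 < e / 2 by rewrite divr_gt0.
have [M M0 HM] := compact_coord_bounded cOm.
have [B B0 fB] := compact_bounded_fun cOm cf.
have [del d0 Hd] := compact_unif_continuous cOm cf e2.
have cB (a : {x | Om x}) i : `|sval a i 0| <= M by case: a => x Ox /=; exact: HM.
have hh (a b : {x | Om x}) : (forall i, `|sval a i 0 - sval b i 0| < del) ->
    `|f (sval a) - f (sval b)| <= e / 2.
  case: a b => [x Ox] [y Oy] /= h; apply/ltW/Hd => //; exact: ball_cV.
have [V [K [js [K0 H]]]] := mcshane_approx d0 e2 cB hh.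
pose g0 (x : 'cV[R]_n) := mcshane V K js (fun i => x i 0).
pose B1 := B + e.
exists (fun x => Num.max (- B1) (Num.min (g0 x) B1)), B1; split.
- apply: mlps_max; first exact: mlps_cst.
  apply: mlps_min; last exact: mlps_cst.
  by apply: mlps_mcshane => i; exact: mlps_coord.
- move=> x; rewrite ler_norml le_max lexx /= ge_max ge_min lexx orbT andbT /B1.
  lra.
- move=> x Ox.
  have := H (exist _ x Ox); rewrite /= -/(g0 x) => h.
  have := fB _ Ox; rewrite ler_norml => /andP[b1 b2].
  have e22 : 2 * (e / 2) = e by lra.
  rewrite e22 ler_norml in h; move/andP: h => [h1 h2].
  rewrite (min_idPl _); last by rewrite /B1; lra.
  rewrite (max_idPr _); last by rewrite /B1; lra.
  by rewrite ler_norml; apply/andP; split; lra.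
Qed.

End MLP.

(** * Averaging attention *)

Section Averaging.
Context (R : realType) (d : nat) (P : probability (pt R d) R).
Implicit Types (g : pt R d -> R) (s : R).

(** The average of [g] over the past of [s]. For negative [s] the past is empty and the quotient is
    [0]. *)
Definition avg g s : R :=
  (\int[P]_z (g z * \1_(Itv0 s) z.2)) / (\int[P]_z \1_(Itv0 s) z.2).

Definition past s : set (pt R d) := setT `*` Itv0 s.

Lemma measurable_past s : measurable (past s).
Proof. by apply: measurableX => //; exact: measurable_Itv0. Qed.

Lemma indic_past s (z : pt R d) : \1_(Itv0 s) z.2 = \1_(past s) z :> R.
Proof.
rewrite !indicE; have [h|h] := pselect (Itv0 s z.2); first by rewrite !mem_set.
by rewrite !memNset // => -[].
Qed.

Lemma measurable_indic_time s : measurable_fun setT (fun z : pt R d => \1_(Itv0 s) z.2 : R).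
Proof. exact: (measurableT_comp (measurable_indic (measurable_Itv0 s)) measurable_snd). Qed.

Lemma indic_bound (T : Type) (A : set T) x : 0 <= (\1_A x : R) <= 1.
Proof. by rewrite indicE; case: (_ \in _); rewrite ?lexx ?ler01. Qed.

Lemma Rintegral_indic_time s : \int[P]_z \1_(Itv0 s) z.2 = fine (P (past s)).
Proof.
rewrite -Rintegral_indic; last exact: measurable_past.
by apply: eq_Rintegral => z _; exact: indic_past.
Qed.

Lemma norm_indic_le (a B : R) (T : Type) (A : set T) x : `|a| <= B -> `|a * \1_A x| <= B.
Proof.
move=> h; rewrite normrM; have /andP[h0 h1] := indic_bound A x.
by rewrite [X in _ * X]ger0_norm //; apply: le_trans h; rewrite ler_piMr.
Qed.

Lemma past_sub s s' : s <= s' -> Itv0 s `<=` Itv0 s'.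
Proof. by move=> ss' u /andP[h1 h2]; rewrite /Itv0 /= h1 (le_trans h2). Qed.

Lemma Rintegral_past_nondecreasing g (B : R) : measurable_fun setT g ->
  (forall z, 0 <= g z) -> (forall z, `|g z| <= B) ->
  nondecreasing_fun (fun s => \int[P]_z (g z * \1_(Itv0 s) z.2)).
Proof.
move=> mg g0 gB s s' ss'.
apply: (@prob1_le_Rintegral _ _ _ P setT _ _ B) => //.
- exact: probability_setT.
- by apply: measurable_funM => //; exact: measurable_indic_time.
- by apply: measurable_funM => //; exact: measurable_indic_time.
- by move=> z _; exact: norm_indic_le.
- by move=> z _; exact: norm_indic_le.
- move=> z _; rewrite ler_wpM2l // !indicE.
  have [h|h] := pselect (Itv0 s z.2).
    by rewrite !mem_set //; exact: past_sub h.
  by rewrite memNset //; case: (_ \in _).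
Qed.

Lemma Rintegral_past_neg g s : s < 0 -> \int[P]_z (g z * \1_(Itv0 s) z.2) = 0.
Proof.
move=> s0; rewrite -[RHS](prob_Rintegral_cst P 0); apply: eq_Rintegral => z _.
rewrite indicE memNset ?mulr0 // => /andP[h1 h2]; lra.
Qed.

Lemma past_le s s' : s <= s' -> fine (P (past s)) <= fine (P (past s')).
Proof.
move=> ss'; have m := measurable_past; rewrite fine_le ?fin_num_measure //.
by apply: le_measure; rewrite ?inE // => z [h1 h2]; split=> //; exact: past_sub h2.
Qed.

Lemma past_le1 s : fine (P (past s)) <= 1.
Proof.
have m := measurable_past s; rewrite -lee_fin fineK ?fin_num_measure //.
exact: probability_le1.
Qed.

Hypothesis P0 : 0 < fine (P (past 0)).

(** Monotonicity in [s] gives measurability. Shifting [g] by [B] writes the numerator as a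
    difference of nondecreasing functions, and capping the denominator from below by its value at 0
    makes its inverse nonincreasing. The cap is harmless: for negative [s] the numerator
    vanishes. *)
Lemma measurable_avg g (B : R) : measurable_fun setT g -> (forall z, `|g z| <= B) ->
  measurable_fun setT (avg g).
Proof.
move=> mg gB.
have B0 : 0 <= B by exact: le_trans (gB (point : pt R d)).
have -> : avg g = (fun s => (\int[P]_z ((g z + B) * \1_(Itv0 s) z.2) - B * \int[P]_z (1 *
  \1_(Itv0 s) z.2)) *
    (Num.max (fine (P (past s))) (fine (P (past 0))))^-1).
  apply/funext => s; rewrite /avg.
  have I1 : P.-integrable setT (EFin \o (fun z : pt R d => 1 * \1_(Itv0 s) z.2 : R)).
    apply: (@bounded_prob_integrable _ _ _ P _ 1); last by move=> z; apply: norm_indic_le;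
      rewrite normr1.
    by apply: measurable_funM => //; exact: measurable_indic_time.
  have Ig : P.-integrable setT (EFin \o (fun z : pt R d => g z * \1_(Itv0 s) z.2 : R)).
    apply: (@bounded_prob_integrable _ _ _ P _ B); last by move=> z; apply: norm_indic_le.
    by apply: measurable_funM => //; exact: measurable_indic_time.
  have -> : \int[P]_z ((g z + B) * \1_(Itv0 s) z.2) =
      \int[P]_z (g z * \1_(Itv0 s) z.2) + B * \int[P]_z (1 * \1_(Itv0 s) z.2).
    rewrite -RintegralZl // -RintegralD //.
      by apply: eq_Rintegral => z _; rewrite mul1r mulrDl.
    by have := integrableZl measurableT B I1; apply: eq_integrable.
  rewrite addrK Rintegral_indic_time.
  have [s0|s0] := leP 0 s; last by rewrite Rintegral_past_neg ?mul0r.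
  by rewrite max_l //; exact: past_le.
apply: measurable_funM; last first.
  apply: nonincreasing_measurable => // s s' ss'.
  have h (x : R) : 0 < Num.max (fine (P (past x))) (fine (P (past 0))) by rewrite lt_max P0 orbT.
  by rewrite lef_pV2 ?posrE // ge_max !le_max past_le //= lexx orbT.
apply: measurable_funB; last apply: measurable_funM => //.
  apply: nondecreasing_measurable => //.
  apply: (@Rintegral_past_nondecreasing _ (B + B)).
  - exact: measurable_funD.
  - by move=> z; have := gB z; rewrite ler_norml => /andP[]; lra.
  - by move=> z; apply: (le_trans (ler_normD _ _)); rewrite lerD // ger0_norm.
apply: nondecreasing_measurable => //.
by apply: (@Rintegral_past_nondecreasing _ 1) => // z; rewrite normr1.
Qed.

Lemma avg_bound g (B : R) s : measurable_fun setT g -> (forall z, `|g z| <= B) ->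
  `|avg g s| <= B.
Proof.
move=> mg gB.
have B0 : 0 <= B by exact: le_trans (gB (point : pt R d)).
rewrite /avg Rintegral_indic_time.
have D0 : 0 <= fine (P (past s)) by rewrite fine_ge0 //; exact: measure_ge0.
have := @Rintegral_close_indic _ _ _ P setT (past s) (fun z => g z * \1_(Itv0 s) z.2) (cst 0) B B.
rewrite prob_Rintegral_cst subr0 => h.
have {}h : `|\int[P]_z (g z * \1_(Itv0 s) z.2)| <= B * fine (P (past s)).
  apply: h => //.
  - exact: probability_setT.
  - exact: measurable_past.
  - by apply: measurable_funM => //; exact: measurable_indic_time.
  - by move=> z _; exact: norm_indic_le.
  - by move=> z _; rewrite /= normr0.
  - move=> z _ /=; rewrite subr0 normrM indic_past; have /andP[h0 h1] := indic_bound (past s) z.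
    by rewrite [X in _ * X <= _]ger0_norm // ler_wpM2r.
rewrite normrM [`|_^-1|]ger0_norm ?invr_ge0 //.
have [->|ne] := eqVneq (fine (P (past s))) 0; first by rewrite invr0 mulr0.
by rewrite ler_pdivrMr // lt_neqAle eq_sym ne.
Qed.

(** The deviations [g - c] cancel over time 0, so only the mass of later times up to [s]
    contributes. Its share of the past is at most [1 - sig], since the past has total mass at most
    1. *)
Lemma avg_contract g (B c E sig s : R) : measurable_fun setT g -> (forall z, `|g z| <= B) ->
  \int[P]_z (g z * \1_(Itv0 0) z.2) = c * fine (P (past 0)) ->
  sig <= fine (P (past 0)) -> 0 <= s -> 0 <= E ->
  (forall z, 0 <= z.2 -> `|g z - c| <= E) ->
  `|avg g s - c| <= (1 - sig) * E.
Proof.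
move=> mg gB gc sP s0 E0 gE.
have mp := measurable_past.
set D := fine (P (past s)); set D0 := fine (P (past 0)).
have DD0 : D0 <= D by exact: past_le.
have Dp : 0 < D by exact: lt_le_trans P0 DD0.
have Ic s' : \int[P]_z (c * \1_(Itv0 s') z.2) = c * fine (P (past s')).
  rewrite RintegralZl ?Rintegral_indic_time //.
  apply: (@bounded_prob_integrable _ _ _ P _ 1); first exact: measurable_indic_time.
  by move=> z; have /andP[h0 h1] := indic_bound (Itv0 s') z.2; rewrite ger0_norm.
have mgi s' : measurable_fun setT (fun z : pt R d => g z * \1_(Itv0 s') z.2).
  by apply: measurable_funM => //; exact: measurable_indic_time.
have mci s' : measurable_fun setT (fun z : pt R d => c * \1_(Itv0 s') z.2).
  by apply: measurable_funM => //; exact: measurable_indic_time.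
have Ig s' : P.-integrable setT (EFin \o (fun z : pt R d => g z * \1_(Itv0 s') z.2 : R)).
  by apply: (@bounded_prob_integrable _ _ _ P _ B) => // z; exact: norm_indic_le.
have Ici s' : P.-integrable setT (EFin \o (fun z : pt R d => c * \1_(Itv0 s') z.2 : R)).
  by apply: (@bounded_prob_integrable _ _ _ P _ `|c|) => // z; exact: norm_indic_le.
have PD : fine (P (past s `\` past 0)) = D - D0.
  rewrite /D (measureDI P (mp s) (mp 0)) (_ : past s `&` past 0 = past 0); last first.
    by apply/setIidPr => z [h1 h2]; split=> //; exact: past_sub h2.
  rewrite fineD ?fin_num_measure //; first by rewrite addrK.
  exact: measurableD.
have key : `|\int[P]_z ((g z - c) * \1_(Itv0 s) z.2) - \int[P]_z ((g z - c) * \1_(Itv0 0) z.2)|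
  <= E * (D - D0).
  rewrite -PD; apply: (@Rintegral_close_indic _ _ _ P setT _ _ _ (B + `|c|)) => //.
  - exact: probability_setT.
  - exact: measurableD.
  - by apply: measurable_funM; [exact: measurable_funB | exact: measurable_indic_time].
  - by apply: measurable_funM; [exact: measurable_funB | exact: measurable_indic_time].
  - by move=> z _; apply: norm_indic_le; apply: (le_trans (ler_normB _ _)); rewrite lerD2r.
  - by move=> z _; apply: norm_indic_le; apply: (le_trans (ler_normB _ _)); rewrite lerD2r.
  - move=> z _; rewrite -mulrBr normrM !indicE.
    have [h0|h0] := pselect (Itv0 0 z.2).
      by rewrite (mem_set h0) (mem_set (past_sub s0 h0)) subrr normr0 mulr0 mulr_ge0.
    rewrite (memNset h0) subr0.
    have [h|h] := pselect (Itv0 s z.2); last by rewrite (memNset h) normr0 mulr0 mulr_ge0.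
    rewrite (mem_set h) normr1 mulr1 mem_set ?mulr1; last by split; [|case].
    by apply: gE; case/andP: h.
have e0 : \int[P]_z ((g z - c) * \1_(Itv0 0) z.2) = 0.
  rewrite (@eq_Rintegral _ _ _ P setT (fun z => g z * \1_(Itv0 0) z.2 - c * \1_(Itv0 0) z.2));
    last first.
    by move=> z _; rewrite mulrBl.
  by rewrite RintegralB // gc Ic subrr.
have es : \int[P]_z ((g z - c) * \1_(Itv0 s) z.2) = \int[P]_z (g z * \1_(Itv0 s) z.2) - c * D.
  rewrite (@eq_Rintegral _ _ _ P setT (fun z => g z * \1_(Itv0 s) z.2 - c * \1_(Itv0 s) z.2));
    last first.
    by move=> z _; rewrite mulrBl.
  by rewrite RintegralB // Ic.
rewrite e0 subr0 es in key.
rewrite /avg Rintegral_indic_time -/D.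
have -> : \int[P]_z (g z * \1_(Itv0 s) z.2) / D - c = (\int[P]_z (g z * \1_(Itv0 s) z.2) - c * D) / D.
  by rewrite mulrBl mulfK ?gt_eqF.
rewrite normrM [`|_^-1|]gtr0_norm ?invr_gt0 // ler_pdivrMr //.
apply: (le_trans key); rewrite mulrC mulrAC ler_wpM2r //.
have D1 : D <= 1 by exact: past_le1.
have : sig * D <= sig \/ sig < 0 by case: (leP 0 sig) => hs; [left; rewrite ler_piMr | right].
move=> [h|h]; first by rewrite mulrBl mul1r lerD2l lerN2; apply: le_trans h sP.
rewrite mulrBl mul1r lerD2l lerN2; apply: (@le_trans _ _ 0); last exact: ltW.
by rewrite nmulr_rle0 // ltW.
Qed.

End Averaging.

(** * The two kinds of attention layer *)

Section Attention.
Context (R : realType).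

(** Without heads only the residual connection remains, so the layer acts as a bare MLP. *)
Definition id_attn n : attn R n :=
  @Attn R n 0 1 1 (fun=> 0) (fun=> 0) (fun=> 0) (fun=> 0).

(** All scores equal 1, so the head is a plain masked mean; [V] reads register [r] and [W] writes
    the mean back to it. *)
Definition avg_attn n (r : 'I_n) : attn R n :=
  @Attn R n 1 1 1 (fun=> delta_mx r 0) (fun=> 0) (fun=> 0) (fun=> delta_mx 0 r).

Lemma Gamma_id n mu (x : 'cV[R]_n) t : Gamma (id_attn n) mu x t = x.
Proof. by rewrite /Gamma big_ord0 addr0. Qed.

Definition state_meas d n (P : meas R d) (phi : pt R d -> 'cV[R]_n) : meas R n :=
  pushforward P (fun z : pt R d => ((phi z : borelV R n), z.2) : pt R n).

Lemma measurable_state d n (phi : pt R d -> 'cV[R]_n) :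
  (forall i, measurable_fun setT (fun z => phi z i 0)) ->
  measurable_fun setT (fun z : pt R d => ((phi z : borelV R n), z.2) : pt R n).
Proof. by move=> mphi; apply: measurable_fun_pair => //; exact: measurable_cV. Qed.

Lemma Gamma_avg d n (r : 'I_n) (P : probability (pt R d) R) (phi : pt R d -> 'cV[R]_n) v t i :
  (forall i, measurable_fun setT (fun z => phi z i 0)) ->
  (exists B : R, forall z, `|phi z r 0| <= B) ->
  Gamma (avg_attn r) (state_meas P phi) v t i 0 =
  v i 0 + (if i == r then avg P (fun z => phi z r 0) t else 0).
Proof.
move=> mphi [B phiB]; rewrite /Gamma /= big_ord1 mxE; congr (_ + _).
have sc (x y : 'cV[R]_n) : score (th := avg_attn r) ord0 x y = 1.
  by rewrite /score big1 ?mulr0 ?expR0 // => j _; rewrite /= !mul0mx !mxE mul0r.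
have mst := measurable_state mphi.
have mi : measurable_fun setT (fun p : pt R n => \1_(Itv0 t) p.2 : R) by exact: measurable_indic_time.
have den : fine (\int[state_meas P phi]_q (score (th := avg_attn r) ord0 v q.1 * \1_(Itv0 t) q.2)%:E)%E =
    \int[P]_z \1_(Itv0 t) z.2.
  rewrite (_ : (fun q : pt R n => _) = (fun q : pt R n => (\1_(Itv0 t) q.2)%:E)); last first.
    by apply/funext => q; rewrite sc mul1r.
  exact: (Rintegral_pushforward P mst mi).
rewrite mxE big_ord1 !mxE; set J := fine _.
have -> : J = avg P (fun z => phi z r 0) t.
  rewrite /J den.
  pose D := \int[P]_z \1_(Itv0 t) z.2.
  rewrite (_ : (fun p : pt R n => _) = (fun p : pt R n => (D^-1 * ((p.1 : 'cV[R]_n) r 0 *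
    \1_(Itv0 t) p.2))%:E)); last first.
    apply/funext => p; rewrite sc mul1r -/D; congr EFin.
    rewrite mxE (bigD1 r) //= big1 => [|j jr].
      by rewrite mxE !eqxx mul1r addr0 mulrAC mulrC mulrA [_ * \1_(Itv0 t) _]mulrC -mulrA mulrC mulrA.
    by rewrite mxE eqxx (negbTE jr) mul0r.
  have mpr : measurable_fun setT (fun p : pt R n => (p.1 : 'cV[R]_n) r 0 : R).
    exact: (measurableT_comp (@measurable_coordV R n r) measurable_fst).
  have mf : measurable_fun setT (fun p : pt R n => D^-1 * ((p.1 : 'cV[R]_n) r 0 * \1_(Itv0 t) p.2)).
    by apply: measurable_funM => //; exact: measurable_funM.
  have E := Rintegral_pushforward P mst mf.
  rewrite /state_meas E /= RintegralZl //; first by rewrite mulrC.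
  apply: (@bounded_prob_integrable _ _ _ P _ B); last by move=> z; apply: norm_indic_le.
  by apply: measurable_funM => //; exact: measurable_indic_time.
by rewrite (ord1 0) eqxx andbT; case: eqP => _; rewrite ?mul1r ?mul0r.
Qed.

End Attention.

(** * Networks as register programs *)

Section Reach.
Context (R : realType) (d d' : nat) (Lp : probability (pt R d) R -> Prop).

Definition admissible n (th : attn R n) : Prop :=
  (n <= d + 3 * d')%N /\ dhead th = 1%N /\ kdim th = 1%N /\ (nheads th <= d')%N.

(* A prefix of layers, given as a map prepending them to an arbitrary network,
   after which the tokens are described by a state map phi satisfying Q. *)
Definition reach n (Q : probability (pt R d) R -> (pt R d -> 'cV[R]_n) -> Prop) : Prop :=
  exists ext : forall m, net R n m -> net R d m,
    (forall m (N : net R n m), net_all admissible N -> net_all admissible (ext m N)) /\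
    forall P, Lp P -> exists phi : pt R d -> 'cV[R]_n,
      [/\ forall i, measurable_fun setT (fun z => phi z i 0), Q P phi &
        forall m (N : net R n m) x t,
          net_eval (ext m N) P x t = net_eval N (state_meas P phi) (phi (x, t)) t].

Lemma reach_weaken n (Q Q' : probability (pt R d) R -> (pt R d -> 'cV[R]_n) -> Prop) :
  reach Q -> (forall P phi, Lp P -> Q P phi -> Q' P phi) -> reach Q'.
Proof.
move=> [ext [okx H]] QQ'; exists ext; split=> // P LP.
by have [phi [h1 h2 h3]] := H P LP; exists phi; split=> //; exact: QQ'.
Qed.

Lemma reach_init : reach (fun P (phi : pt R d -> 'cV[R]_d) => phi = fst).
Proof.
exists (fun m N => N); split=> // P LP; exists fst; split=> //.
  move=> i; exact: (measurableT_comp (@measurable_coordV R d i) measurable_fst).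
move=> m N x t; congr (net_eval N _ _ _); apply/funext => A.
rewrite /state_meas /pushforward; congr (P _).
by apply/seteqP; split=> -[].
Qed.

(** The new layer is the last of the prefix, so it is put in front of the continuation [N] before
    the old prefix [ext] is applied. *)
Lemma reach_layer n p (Q : probability (pt R d) R -> (pt R d -> 'cV[R]_n) -> Prop)
    (Q' : probability (pt R d) R -> (pt R d -> 'cV[R]_p) -> Prop)
    (th : attn R n) (F : mlp R n p) :
  admissible th -> reach Q ->
  (forall P (phi : pt R d -> 'cV[R]_n), Lp P -> (forall i, measurable_fun setT (fun z => phi z i
    0)) -> Q P phi ->
    let phi' := fun z : pt R d => mlp_eval F (Gamma th (state_meas P phi) (phi z) z.2) in
    (forall i, measurable_fun setT (fun z => phi' z i 0)) /\ Q' P phi') ->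
  reach Q'.
Proof.
move=> oth [ext [okx H]] HQ.
exists (fun m N => ext m (net_cons th F N)); split.
  by move=> m N okN; apply: okx.
move=> P LP; have [phi [h1 h2 h3]] := H P LP.
have [h4 h5] := HQ P phi LP h1 h2.
(* The equation for [net_eval] holds by conversion: the pushforward in the masked composition turns
   the old state measure into the new one. *)
exists (fun z : pt R d => mlp_eval F (Gamma th (state_meas P phi) (phi z) z.2)); split=> //.
Qed.

Lemma reach_mlp n p (Q : probability (pt R d) R -> (pt R d -> 'cV[R]_n) -> Prop)
    (Q' : probability (pt R d) R -> (pt R d -> 'cV[R]_p) -> Prop) (f : 'cV[R]_n -> 'cV[R]_p) :
  (n <= d + 3 * d')%N -> mlpable f -> reach Q ->
  (forall P phi, Lp P -> Q P phi -> Q' P (fun z => f (phi z))) -> reach Q'.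
Proof.
move=> nd [F HF] rQ HQ.
apply: (@reach_layer n p Q Q' (id_attn R n) F _ rQ) => // P phi LP mphi Qphi phi'.
have E : phi' = fun z => f (phi z) by apply/funext => z; rewrite /phi' Gamma_id HF.
split; last by rewrite E; exact: HQ.
move=> i; rewrite E; have := measurable_mlp F mphi i.
by congr (measurable_fun _ _); apply/funext => z; rewrite HF.
Qed.

Definition upd n (r : 'I_n) (v : 'cV[R]_n) (a : R) : 'cV[R]_n :=
  \col_i (if i == r then a else v i 0).

Lemma updE n (r : 'I_n) v a i : upd r v a i 0 = if i == r then a else v i 0.
Proof. by rewrite mxE. Qed.

Lemma upd_eq n (r : 'I_n) v a : upd r v a r 0 = a.
Proof. by rewrite updE eqxx. Qed.

Lemma upd_neq n (r : 'I_n) v a i : i != r -> upd r v a i 0 = v i 0.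
Proof. by move=> h; rewrite updE (negbTE h). Qed.

Lemma upd_upd n (r : 'I_n) v a b : upd r (upd r v a) b = upd r v b.
Proof. by apply/matrixP => i j; rewrite !mxE; case: ifP => // ->. Qed.

Lemma mlpable_upd n (r : 'I_n) (h : 'cV[R]_n -> R) : mlps h -> mlpable (fun v => upd r v (h v)).
Proof.
move=> mh; apply: mlpable_coords => i; case: (eqVneq i r) => [->|ne].
  by apply: mlps_ext mh => v; rewrite upd_eq.
by apply: mlps_ext (mlps_coord R i) => v; rewrite upd_neq.
Qed.

(** The residual connection leaves the register plus its average, and the MLP of the same layer
    halves that register only. *)
Lemma reach_avg n (r : 'I_n) (Q Q' : probability (pt R d) R -> (pt R d -> 'cV[R]_n) -> Prop) :
  (n <= d + 3 * d')%N -> (0 < d')%N ->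
  (forall P, Lp P -> 0 < fine (P (past 0))) ->
  reach Q ->
  (forall P (phi : pt R d -> 'cV[R]_n), Lp P -> (forall i, measurable_fun setT (fun z => phi z i
    0)) -> Q P phi ->
    (exists B : R, forall z, `|phi z r 0| <= B) /\
    Q' P (fun z => upd r (phi z) ((phi z r 0 + avg P (fun z => phi z r 0) z.2) / 2))) ->
  reach Q'.
Proof.
move=> nd d0 P0 rQ HQ.
have mh : mlps (fun v : 'cV[R]_n => v r 0 / 2).
  apply: mlps_ext (mlps_lin2 (1 / 2) 0 0 (mlps_coord R r) (mlps_coord R r)) => v; lra.
have [F HF] := mlpable_upd r mh.
apply: (@reach_layer n n Q Q' (avg_attn R r) F _ rQ) => // P phi LP mphi Qphi phi'.
have [[B phiB] Q'phi] := HQ P phi LP mphi Qphi.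
have E : phi' = fun z => upd r (phi z) ((phi z r 0 + avg P (fun z => phi z r 0) z.2) / 2).
  apply/funext => z; rewrite /phi' HF; apply/matrixP => i j; rewrite (ord1 j) !updE.
  have G k := Gamma_avg P (phi z) z.2 k mphi (ex_intro _ B phiB).
  case: ifP => ir; rewrite G ?eqxx //.
  by rewrite ir addr0.
split; last by rewrite E.
move=> i; rewrite E; case: (eqVneq i r) => [->|ne].
  under eq_fun do rewrite upd_eq.
  apply: measurable_funM => //; apply: measurable_funD => //.
  exact: (measurableT_comp (measurable_avg (P0 P LP) (mphi r) phiB) measurable_snd).
by under eq_fun do rewrite upd_neq //; exact: mphi.
Qed.

End Reach.

(** * The register program for the McShane formula *)

Section Program.
Context (R : realType) (d d' : nat) (Om : set 'cV[R]_d) (C sig : R).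
Hypotheses (cOm : compact Om) (sig01 : 0 < sig < 1) (d'0 : (0 < d')%N).

Let Lp (P : probability (pt R d) R) : Prop := Lip Om C sig P.
Let n := (d + (2 + d'))%N.
(* Registers: the token [xi], a scratch moment [ra], the inner maximum [rb] of
   the McShane formula, and the outer minima [ro o]. *)
Let xi (l : 'I_d) : 'I_n := lshift (2 + d') l.
Let ra : 'I_n := rshift d (lshift d' (ord0 : 'I_2)).
Let rb : 'I_n := rshift d (lshift d' (ord_max : 'I_2)).
Let ro (o : 'I_d') : 'I_n := rshift d (rshift 2 o).

(** The two scratch registers fit into the allowance [2 * d'] because [d'] is positive. *)
Let nD : (n <= d + 3 * d')%N.
Proof. by rewrite /n leq_add2l mulSn addnC leq_add2l mulSn mul1n; case: d' d'0 => // k _;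
  rewrite addSn addnS. Qed.

Let xi_ra l : xi l != ra. Proof. by rewrite /xi /ra eq_lrshift. Qed.
Let xi_rb l : xi l != rb. Proof. by rewrite /xi /rb eq_lrshift. Qed.
Let xi_ro l o : xi l != ro o. Proof. by rewrite /xi /ro eq_lrshift. Qed.
Let rb_ra : rb != ra. Proof. by rewrite /rb /ra eq_rshift eq_lshift. Qed.
Let ro_ra o : ro o != ra. Proof. by rewrite /ro /ra eq_rshift eq_rlshift. Qed.
Let ro_rb o : ro o != rb. Proof. by rewrite /ro /rb eq_rshift eq_rlshift. Qed.
Let ro_inj o o' : (ro o == ro o') = (o == o'). Proof. by rewrite /ro eq_rshift eq_rshift. Qed.

Definition moment (P : probability (pt R d) R) (f : 'cV[R]_d -> R) : R :=
  (\int[P]_z (f z.1 * \1_(Itv0 0) z.2)) / fine (P (past 0)).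

Lemma Itv00 : Itv0 (0 : R) = [set 0].
Proof.
apply/seteqP; split=> s /=; rewrite /Itv0 /=; last by move=> ->; rewrite lexx.
by move=> h; apply/eqP; rewrite eq_le andbC.
Qed.

Lemma Lip_past_ge P : Lp P -> sig <= fine (P (past 0)).
Proof.
move=> [_ [_ [h _]]]; rewrite /past Itv00.
have m0 : measurable (setT `*` [set 0] : set (pt R d)) by apply: measurableX.
by rewrite -lee_fin fineK ?fin_num_measure.
Qed.

Let Lp_pos P : Lp P -> 0 < fine (P (past 0)).
Proof. by move=> /Lip_past_ge; apply: lt_le_trans; case/andP: sig01. Qed.

Lemma exp_small (a b e : R) : 0 <= a < 1 -> 0 < e -> exists k, a ^+ k * b <= e.
Proof.
move=> a01 e0; have [b0|b0] := leP b 0.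
  by exists 0%N; rewrite expr0 mul1r; lra.
have : (fun k => a ^+ k) @ \oo --> (0 : R).
  by apply: cvg_expr; rewrite ger0_norm; case/andP: a01.
move=> /cvgrPdist_lt /(_ (e / b)) []; first by rewrite divr_gt0.
move=> k _ /(_ k (leqnn k)); rewrite sub0r normrN ger0_norm; last by rewrite exprn_ge0 //;
  case/andP: a01.
by move=> h; exists k; rewrite -ler_pdivlMr // ltW.
Qed.

(** [f] is replaced by a bounded MLP function [g] of the token, written in [ra] and then averaged
    repeatedly. The conclusion keeps [Q] for the state before [ra] is overwritten, so any property
    that ignores [ra] survives. *)
Lemma reach_moment (Q : probability (pt R d) R -> (pt R d -> 'cV[R]_n) -> Prop)
    (f : 'cV[R]_d -> R) (e : R) : continuous f -> 0 < e ->
  reach d' Lp Q ->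
  (forall P phi, Q P phi -> forall z l, phi z (xi l) 0 = (z.1 : 'cV[R]_d) l 0) ->
  reach d' Lp (fun P phi' => exists phi (a : pt R d -> R),
    [/\ Q P phi, phi' = (fun z => upd ra (phi z) (a z)) &
      forall z, 0 <= z.2 -> `|a z - moment P f| <= e]).
Proof.
move=> cf e0 rQ HQ.
have e2 : 0 < e / 2 by rewrite divr_gt0.
have [g [B [mg gB fg]]] := mlps_approx cOm cf e2.
have B0 : 0 <= B by exact: le_trans (gB 0).
(* Invariant after [k] averagings: a uniform bound, an exact mean at time 0, and a geometric
   distance to that mean, trivial for [k = 0]. *)
pose S k P (phi' : pt R d -> 'cV[R]_n) := exists phi (a : pt R d -> R),
  [/\ Q P phi, phi' = (fun z => upd ra (phi z) (a z)), forall z, `|a z| <= B,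
    \int[P]_z (a z * \1_(Itv0 0) z.2) = moment P g * fine (P (past 0)) &
    forall z, 0 <= z.2 -> `|a z - moment P g| <= (1 - sig / 2) ^+ k * (2 * B)].
have gcont : measurable_fun setT (fun z : pt R d => g z.1).
  have [F HF] := mg.
  have := @measurable_mlp R _ _ _ _ F (fun z : pt R d => z.1 : 'cV[R]_d)
    (fun i => measurableT_comp (@measurable_coordV R d i) measurable_fst) 0.
  by congr (measurable_fun _ _); apply/funext => z; rewrite HF mxE eqxx.
have momB P : Lp P -> `|moment P g| <= B.
  move=> LP; have := @avg_bound R d P (fun z => g z.1) B 0 gcont (fun z => gB _).
  by rewrite /avg Rintegral_indic_time.
have r0 : reach d' Lp (S 0%N).
  have mproj : mlpable (fun v : 'cV[R]_n => usubmx (v : 'cV[R]_(d + (2 + d')))).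
    apply: mlpable_ext (mlpable_lin (row_mx 1%:M 0)) => v.
    by rewrite -{1}[v](@vsubmxK _ d (2 + d')) mul_row_col mul1mx mul0mx addr0.
  have mh := mlps_comp mproj mg.
  apply: (reach_mlp nD (mlpable_upd ra mh) rQ) => P phi LP Qphi.
  have phix z : usubmx (phi z : 'cV[R]_(d + (2 + d'))) = z.1.
    by apply/matrixP => l j; rewrite (ord1 j) !mxE; exact: (HQ _ _ Qphi z l).
  exists phi, (fun z => g z.1); split=> //.
  - by apply/funext => z; rewrite phix.
  - by rewrite /moment divfK // gt_eqF // Lp_pos.
  - move=> z _; rewrite expr0 mul1r; apply: (le_trans (ler_normB _ _)).
    by have := gB z.1; have := momB P LP; lra.
have rS k : reach d' Lp (S k).
  elim: k => // k IH; apply: (reach_avg (r := ra) nD d'0 Lp_pos IH) => P phi' LP mphi' [phi [a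
    [Qphi pE aB ac aE]]].
  have aE' : (fun z => phi' z ra 0) = a by apply/funext => z; rewrite pE upd_eq.
  have ma : measurable_fun setT a by have := mphi' ra; rewrite aE'.
  split; first by exists B => z; rewrite -[phi' z ra 0]/((fun z => phi' z ra 0) z) aE'.
  have P0 := Lp_pos LP.
  have m_avg := measurable_avg P0 ma aB.
  have m_avg2 : measurable_fun setT (fun z : pt R d => avg P a z.2).
    exact: (measurableT_comp m_avg measurable_snd).
  have avB s := avg_bound P s ma aB.
  exists phi, (fun z => (a z + avg P a z.2) / 2); split=> //.
  - apply/funext => z; rewrite aE' -[phi' z ra 0]/((fun z => phi' z ra 0) z) aE' pE.
    by rewrite upd_upd.
  - move=> z; rewrite normrM [`|2^-1|]ger0_norm // ler_pdivrMr //.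
    by apply: (le_trans (ler_normD _ _)); have := aB z; have := avB z.2; lra.
  - have mi := @measurable_indic_time R d 0.
    have I1 : P.-integrable setT (EFin \o (fun z : pt R d => a z * \1_(Itv0 0) z.2 : R)).
      apply: (@bounded_prob_integrable _ _ _ P _ B); first exact: measurable_funM.
      by move=> z; exact: norm_indic_le.
    have I2 : P.-integrable setT (EFin \o (fun z : pt R d => avg P a z.2 * \1_(Itv0 0) z.2 : R)).
      apply: (@bounded_prob_integrable _ _ _ P _ B); first exact: measurable_funM.
      by move=> z; exact: norm_indic_le.
    have I3 : P.-integrable setT (EFin \o (fun z : pt R d => \1_(Itv0 0) z.2 : R)).
      apply: (@bounded_prob_integrable _ _ _ P _ 1) => // z.
      by have /andP[h0 h1] := indic_bound R (Itv0 0) z.2; rewrite ger0_norm.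
    rewrite (@eq_Rintegral _ _ _ P setT (fun z => 2^-1 * (a z * \1_(Itv0 0) z.2 + avg P a z.2 *
      \1_(Itv0 0) z.2))); last first.
      by move=> z _; rewrite -mulrDl [2^-1 * _]mulrC mulrAC.
    rewrite RintegralZl //; last by have := integrableD measurableT I1 I2; apply: eq_integrable.
    rewrite RintegralD // ac.
    (* At time 0 the past consists of time 0 alone, so the average there equals the mean and the
       mean of the new register is unchanged. *)
    rewrite (@eq_Rintegral _ _ _ P setT (fun z => moment P g * \1_(Itv0 0) z.2)); last first.
      move=> z _; rewrite indicE Itv00; have [->|ne] := pselect (z.2 = 0).
        by rewrite mem_set // !mulr1 /avg Rintegral_indic_time ac mulfK // gt_eqF.
      by rewrite memNset // !mulr0.
    by rewrite RintegralZl // Rintegral_indic_time; lra.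
  - move=> z z0; have E0 : 0 <= (1 - sig / 2) ^+ k * (2 * B).
      by rewrite mulr_ge0 ?mulr_ge0 // exprn_ge0 //; case/andP: sig01; lra.
    (* Half of the old error [E] plus half of [(1 - sig) * E] gives [(1 - sig / 2) * E]. *)
    have h1 := avg_contract P0 ma aB ac (Lip_past_ge LP) z0 E0 aE.
    have h2 := aE z z0.
    have -> : (a z + avg P a z.2) / 2 - moment P g = ((a z - moment P g) + (avg P a z.2 - moment
      P g)) / 2 by field.
    rewrite normrM [`|2^-1|]ger0_norm // ler_pdivrMr //; apply: (le_trans (ler_normD _ _)).
    rewrite exprS -mulrA; move: (_ ^+ k * _) h1 h2 => X; nra.
have [k Hk] : exists k, (1 - sig / 2) ^+ k * (2 * B) <= e / 2.
  by apply: exp_small => //; case/andP: sig01 => h1 h2; apply/andP; split; lra.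
apply: (reach_weaken (rS k)) => P phi' LP [phi [a [Qphi pE aB ac aE]]].
exists phi, a; split=> // z z0.
have h1 := le_trans (aE z z0) Hk.
have h2 : `|moment P g - moment P f| <= e / 2.
  have P0 := Lp_pos LP.
  rewrite /moment -mulrBl normrM [`|_^-1|]gtr0_norm ?invr_gt0 // ler_pdivrMr //.
  have [_ [PO _]] := LP.
  have [F F0 fF] := compact_bounded_fun cOm cf.
  have mi := @measurable_indic_time R d 0.
  apply: (@Rintegral_close_indic _ _ _ P (Om `*` @I01 R) _ _ _ (B + F)) => //.
  - by apply: measurableX; [exact: compact_measurableV | exact: measurable_I01].
  - exact: measurable_past.
  - exact: measurable_funM.
  - by apply: measurable_funM => //;
    exact: (measurableT_comp (measurable_continuousV cf) measurable_fst).
  - by move=> z' _; apply: norm_indic_le; have := gB z'.1; lra.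
  - by move=> z' [Oz _]; apply: norm_indic_le; have := fF _ Oz; lra.
  - move=> z' [Oz _]; rewrite -mulrBl normrM indic_past; have /andP[i0 i1] := indic_bound R (past 0) z'.
    by rewrite [X in _ * X <= _]ger0_norm // ler_wpM2r // distrC; exact: fg.
have -> : a z - moment P f = (a z - moment P g) + (moment P g - moment P f) by ring.
by apply: (le_trans (ler_normD _ _)); lra.
Qed.

(** The token copy is exact for every [z], as later moments are recomputed from it; the property [A]
    is asked only over [Om] and the unit interval, where the approximations hold. *)
Definition inv (A : probability (pt R d) R -> pt R d -> 'cV[R]_n -> Prop)
    (P : probability (pt R d) R) (phi : pt R d -> 'cV[R]_n) : Prop :=
  (forall z l, phi z (xi l) 0 = (z.1 : 'cV[R]_d) l 0) /\
  forall z, Om z.1 -> I01 z.2 -> A P z (phi z).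

Definition insensitive (r : 'I_n) (A : probability (pt R d) R -> pt R d -> 'cV[R]_n -> Prop) :=
  forall P z v a, A P z v -> A P z (upd r v a).

Lemma reach_upd (r : 'I_n) (h : 'cV[R]_n -> R)
    (A A' : probability (pt R d) R -> pt R d -> 'cV[R]_n -> Prop) :
  (forall l, xi l != r) -> mlps h -> reach d' Lp (inv A) ->
  (forall P (z : pt R d) (v : 'cV[R]_n), (forall l, v (xi l) 0 = (z.1 : 'cV[R]_d) l 0) -> A P z v
    -> A' P z (upd r v (h v))) ->
  reach d' Lp (inv A').
Proof.
move=> xr mh rA HA; apply: (reach_mlp nD (mlpable_upd r mh) rA) => P phi LP [h1 h2].
split=> [z l|z Oz Iz]; first by rewrite upd_neq.
by apply: HA; [exact: h1 | exact: h2].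
Qed.

Context (k : nat) (f : 'I_k -> 'cV[R]_d -> R).
Hypothesis cf : forall i, continuous (f i).

Definition feature (P : probability (pt R d) R) (x : 'cV[R]_d) (i : 'I_(k + d)) : R :=
  match fintype.split i with inl j => moment P (f j) | inr l => x l 0 end.

Definition partdist P x (c' : 'I_(k + d) -> R) s : R :=
  foldr Num.max 0 [seq `|feature P x i - c' i| | i <- s].

Lemma max_dist_le (a b a' b' e : R) : `|a - a'| <= e -> `|b - b'| <= e ->
  `|Num.max a b - Num.max a' b'| <= e.
Proof.
rewrite !ler_norml => /andP[h1 h2] /andP[h3 h4].
by rewrite /Num.max; case: ltP => q1; case: ltP => q2; apply/andP; split; lra.
Qed.

Lemma min_dist_le (a b a' b' e : R) : `|a - a'| <= e -> `|b - b'| <= e ->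
  `|Num.min a b - Num.min a' b'| <= e.
Proof.
rewrite !ler_norml => /andP[h1 h2] /andP[h3 h4].
by rewrite /Num.min; case: ltP => q1; case: ltP => q2; apply/andP; split; lra.
Qed.

(** The features enter a running maximum in [rb] one at a time: a moment passes through [ra], which
    the next one overwrites, and a coordinate is read from the token. Since [max] is nonexpansive,
    the error stays [e] whatever the number of features. *)
Lemma reach_dist (A : probability (pt R d) R -> pt R d -> 'cV[R]_n -> Prop) c' (e : R) :
  0 < e -> insensitive ra A -> insensitive rb A -> reach d' Lp (inv A) ->
  reach d' Lp (inv (fun P (z : pt R d) (v : 'cV[R]_n) => A P z v /\ `|v rb 0 - supdist (feature P
    z.1) c'| <= e)).
Proof.
move=> e0 Aa Ab rA.
suff H s : reach d' Lp (inv (fun P (z : pt R d) (v : 'cV[R]_n) => A P z v /\ `|v rb 0 - partdist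
  P z.1 c' s| <= e)) by exact: H.
elim: s => [|i s IH].
  apply: (reach_upd xi_rb (mlps_cst n 0) rA) => P z v vx Av; split; first exact: Ab.
  by rewrite upd_eq subrr normr0 ltW.
have E P x : partdist P x c' (i :: s) = Num.max `|feature P x i - c' i| (partdist P x c' s) by [].
have dd (a b c : R) : `| `|a - c| - `|b - c| | <= `|a - b|.
  by apply: (le_trans (ler_dist_dist _ _)); have -> : a - c - (b - c) = a - b by ring.
case Ei : (fintype.split i) => [j|l].
  have rm := reach_moment (@cf j) e0 IH (fun P phi h => h.1).
  have r2 : reach d' Lp (inv (fun P (z : pt R d) (v : 'cV[R]_n) => (A P z v /\ `|v rb 0 -
    partdist P z.1 c' s| <= e) /\
      `|v ra 0 - feature P z.1 i| <= e)).
    apply: (reach_weaken rm) => P phi' LP [phi [a [[hx hA] -> ha]]]; split=> [z l|z Oz Iz].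
      by rewrite upd_neq.
    have [h1 h2] := hA z Oz Iz; split; last first.
      by rewrite upd_eq /feature Ei; apply: ha; case/andP: Iz.
    by split; [exact: Aa | rewrite upd_neq].
  have mh := mlps_max (mlps_dist (c' i) (mlps_coord R ra)) (mlps_coord R rb).
  apply: (reach_upd xi_rb mh r2) => P z v vx [[Av vb] va].
  split; first exact: Ab.
  rewrite upd_eq E; apply: max_dist_le => //; exact: le_trans (dd _ _ _) va.
have mh := mlps_max (mlps_dist (c' i) (mlps_coord R (xi l))) (mlps_coord R rb).
apply: (reach_upd xi_rb mh IH) => P z v vx [Av vb].
split; first exact: Ab.
rewrite upd_eq E; apply: max_dist_le => //.
by apply: (le_trans (dd _ _ _)); rewrite vx /feature Ei subrr normr0 ltW.
Qed.

(** Each centre has its distance recomputed in [rb] and is then merged into the running minimum. The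
    slope multiplies the error by [K], and [min] does not increase it. *)
Lemma reach_mcshane (A : probability (pt R d) R -> pt R d -> 'cV[R]_n -> Prop) o
    (V K e : R) js : 0 < e -> 0 <= K ->
  insensitive ra A -> insensitive rb A -> insensitive (ro o) A -> reach d' Lp (inv A) ->
  reach d' Lp (inv (fun P (z : pt R d) (v : 'cV[R]_n) => A P z v /\ `|v (ro o) 0 - mcshane V K js
    (feature P z.1)| <= K * e)).
Proof.
move=> e0 K0 Aa Ab Ao rA; elim: js => [|j js IH].
  apply: (reach_upd (xi_ro^~ o) (mlps_cst n V) rA) => P z v vx Av; split; first exact: Ao.
  by rewrite upd_eq subrr normr0 mulr_ge0 // ltW.
have rd := @reach_dist _ j.2 e e0 _ _ IH.
have {}rd : reach d' Lp (inv (fun P (z : pt R d) (v : 'cV[R]_n) => (A P z v /\ `|v (ro o) 0 -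
  mcshane V K js (feature P z.1)| <= K * e) /\
    `|v rb 0 - supdist (feature P z.1) j.2| <= e)).
  by apply: rd => P z v a [h1 h2]; (split; [first [exact: Aa|exact: Ab]|rewrite upd_neq]).
have mh := mlps_min (mlps_coord R (ro o)) (mlps_lin2 K 0 j.1 (mlps_coord R rb) (mlps_coord R rb)).
apply: (reach_upd (xi_ro^~ o) mh rd) => P z v vx [[Av vo] vb].
split; first exact: Ao.
rewrite upd_eq /=; apply: min_dist_le => //.
have -> : K * v rb 0 + 0 * v rb 0 + j.1 - (j.1 + K * supdist (feature P z.1) j.2) =
  K * (v rb 0 - supdist (feature P z.1) j.2) by ring.
by rewrite normrM (ger0_norm K0) ler_wpM2l.
Qed.

Lemma network_mcshane (V K : 'I_d' -> R) (js : 'I_d' -> seq (R * ('I_(k + d) -> R))) (e : R) :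
  0 < e -> (forall o, 0 <= K o) ->
  exists N : net R d d', net_all (@admissible R d d') N /\
    forall P, Lp P -> forall x t, Om x -> I01 t -> forall o,
      `|net_eval N P x t o 0 - mcshane (V o) (K o) (js o) (feature P x)| <= e.
Proof.
move=> e0 K0.
pose T o (P : probability (pt R d) R) (x : 'cV[R]_d) := mcshane (V o) (K o) (js o) (feature P x).
have r0 : reach d' Lp (inv (fun _ _ _ => True)).
  have mi : mlpable (fun x : 'cV[R]_d => col_mx x 0 : 'cV[R]_n).
    apply: mlpable_ext (mlpable_lin (col_mx 1%:M 0)) => x.
    by rewrite mul_col_mx mul1mx mul0mx.
  apply: (reach_mlp (leq_addr _ _) mi (@reach_init R d d' Lp)) => P phi LP ->.
  by split=> // z l; rewrite col_mxEu.
(* Output coordinates are produced one after another; [uniq] ensures that a finished output register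
   is never written again. *)
have rs (os : seq 'I_d') : uniq os ->
    reach d' Lp (inv (fun P (z : pt R d) (v : 'cV[R]_n) => forall o, o \in os -> `|v (ro o) 0 - T
      o P z.1| <= e)).
  elim: os => [_|o os IH /= /andP[no /IH rA]].
    by apply: (reach_weaken r0) => P phi LP [h1 h2]; split.
  (* Tolerance on the features that becomes at most [e] after multiplication by [K o]. *)
  have e1 : 0 < e / (K o + 1) by rewrite divr_gt0 // ltr_wpDl.
  have Aa : insensitive ra (fun P (z : pt R d) (v : 'cV[R]_n) => forall o, o \in os -> `|v (ro o)
    0 - T o P z.1| <= e).
    by move=> P z v a h o' ho; rewrite upd_neq //; exact: h.
  have Ab : insensitive rb (fun P (z : pt R d) (v : 'cV[R]_n) => forall o, o \in os -> `|v (ro o)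
    0 - T o P z.1| <= e).
    by move=> P z v a h o' ho; rewrite upd_neq //; exact: h.
  have Ao : insensitive (ro o) (fun P (z : pt R d) (v : 'cV[R]_n) => forall o, o \in os -> `|v
    (ro o) 0 - T o P z.1| <= e).
    move=> P z v a h o' ho; rewrite upd_neq; first exact: h.
    by rewrite ro_inj; apply: contraNneq no => <-.
  apply: (reach_weaken (reach_mcshane (V o) (js o) e1 (K0 o) Aa Ab Ao rA)) => P phi LP [h1 h2].
  split=> // z Oz Iz o'; have [h3 h4] := h2 z Oz Iz.
  rewrite in_cons => /predU1P[->|]; last exact: h3.
  apply: (le_trans h4); rewrite mulrCA ler_piMr ?(ltW e0) // ler_pdivrMr ?ltr_wpDl //; lra.
have [ext [okx H]] := rs (enum 'I_d') (enum_uniq _).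
(* The closing layer projects onto the [d'] output registers. *)
have [F HF] := mlpable_lin (row_mx 0 (row_mx 0 1%:M) : 'M[R]_(d', d + (2 + d'))).
exists (ext d' (net_one (id_attn R n) F)); split.
  by apply: okx.
move=> P LP x t Ox It o.
have [phi [_ [_ h2] h3]] := H P LP.
rewrite h3 /= /diamond /ctxfree Gamma_id HF.
have := h2 (x, t) Ox It o; rewrite mem_enum => /(_ isT); rewrite -/(T o P x) /=.
congr (`|_ - _| <= _).
rewrite -{2}[phi (x, t)](@vsubmxK _ d (2 + d')) mul_row_col mul0mx add0r.
rewrite -[dsubmx _](@vsubmxK _ 2 d') mul_row_col mul0mx add0r mul1mx.
by rewrite !mxE.
Qed.

End Program.

(** * The approximation theorem *)

Section UniformContinuity.
Context (R : realType) (d d' : nat) (Om : set 'cV[R]_d) (C sig : R) (Lam : cmap R d d').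
Hypotheses (cOm : compact Om) (C0 : 0 < C) (sig01 : 0 < sig < 1).
Hypothesis Lc : weak_cont Om C sig Lam.

Lemma Rintegral_initial (nu : probability (borelV R d) R) (f : 'cV[R]_d * R -> R) :
  continuous f ->
  fine (\int[initial nu]_z (f z)%:E)%E = \int[nu]_y f (y, 0).
Proof.
move=> cf; rewrite initialE.
exact: (Rintegral_pushforward nu (measurable_pairt 0) (measurable_continuous_pt cf)).
Qed.

(** A finite list of test functions with a tolerance describes a basic weak neighbourhood. Ordered
    by refinement, these families generate a filter, which plays the part that small radii play in a
    metric space. *)
Let tests := (seq ('cV[R]_d -> R) * R)%type.
Let good (L : tests) := 0 < L.2 /\ forall f, List.In f L.1 -> continuous f.
Let finer (L : tests) : set tests :=
  [set L' | [/\ good L', L'.2 <= L.2 & forall f, List.In f L.1 -> List.In f L'.1]].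
Let F : set_system tests := filter_from good finer.

Let FF : Filter F.
Proof.
apply: filter_from_filter; first by exists ([::], 1); split.
move=> L1 L2 [p1 c1] [p2 c2]; exists (L1.1 ++ L2.1, Num.min L1.2 L2.2).
  by split=> /= [|f /List.in_app_iff[]]; [rewrite lt_min p1 p2 | exact: c1 | exact: c2].
move=> L [gL /= ]; rewrite le_min => /andP[l1 l2] h.
by split; split=> // f hf; apply: h; apply/List.in_app_iff; [left|right].
Qed.

Lemma Lam_initial_unif_continuous (eps : R) : 0 < eps -> Om !=set0 ->
  exists (k : nat) (f : 'I_k -> 'cV[R]_d -> R) (del : R),
    [/\ 0 < del, forall i, continuous (f i) &
    forall (nu nu' : probability (borelV R d) R) x x', nu Om = 1%E -> nu' Om = 1%E ->
      Om x -> Om x' ->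
      (forall i, `|\int[nu]_y f i y - \int[nu']_y f i y| < del) ->
      (forall l, `|x l 0 - x' l 0| < del) ->
      forall o, `|Lam (initial nu) x 0 o 0 - Lam (initial nu') x' 0 o 0| < eps].
Proof.
move=> e0 Om0.
have [K [Pm [cK PmOm Pmc Pms]]] := weak_compactness cOm Om0.
pose close (L : tests) (nu nu' : probability (borelV R d) R) (x x' : 'cV[R]_d) :=
  (forall f, List.In f L.1 -> `|\int[nu]_y f y - \int[nu']_y f y| < L.2) /\
  forall l, `|x l 0 - x' l 0| < L.2.
pose Pr (L : tests) (p : {ptws seq bool -> R} * 'cV[R]_d) :=
  forall (nu : probability (borelV R d) R) x, nu Om = 1%E -> Om x ->
    close L nu (Pm p.1) x p.2 ->
    forall o, `|Lam (initial nu) x 0 o 0 - Lam (initial (Pm p.1)) p.2 0 o 0| < eps / 2.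
have LI (nu : probability (borelV R d) R) : nu Om = 1%E -> Lip Om C sig (initial nu).
  by move=> h; apply: Lip_initial => //; [exact: ltW | case/andP: sig01 => _ /ltW].
have I0 : @I01 R 0 by rewrite /I01 /= lexx ler01.
have etri (u v w : 'cV[R]_d') o : enorm (u - w) < eps / 4 -> enorm (v - w) < eps / 4 -> `|u o 0 -
  v o 0| < eps / 2.
  move=> /(le_lt_trans (coord_le_enorm _ o)) h1 /(le_lt_trans (coord_le_enorm _ o)) h2.
  move: h1 h2; rewrite !mxE !ltr_norml => /andP[h1 h2] /andP[h3 h4]; apply/andP; split; lra.
have H : \forall L \near F, K `*` Om `<=` Pr L.
  (* Near covering within the compact set, along the filter of test families: a neighbourhood and a
     family that work locally around each point yield one family that works everywhere. *)
  move/compact_near_coveringP/near_covering_withinP: (compact_setX cK cOm);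
    move=> /(_ _ F (fun L p => Pr L p) FF); apply=> -[m x] [/= Km Ox].
  have e4 : 0 < eps / 4 by rewrite divr_gt0.
  have [k [f [del [del0 [cf Hf]]]]] := Lc (LI _ (PmOm _ Km)) Ox I0 e4.
  (* Coordinates within [2 * r] give a Euclidean distance at most [d * (2 * r)], which is below
     [del]; the factor 2 covers the detour through [x']. *)
  pose r := del / (2 * d.+1%:R).
  have r0 : 0 < r by rewrite divr_gt0 // mulr_gt0.
  have rd : r <= del / 2.
    by rewrite /r invfM mulrA ler_piMr ?divr_ge0 ?(ltW del0) // invf_le1 ?ler1n.
  (* A measure at time 0 sees only this slice of a test function. *)
  pose g i := fun y : 'cV[R]_d => f i (y, 0).
  have cg i : continuous (g i) by exact: continuous_slice.
  pose A := [set p : {ptws seq bool -> R} * 'cV[R]_d |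
    (forall i, K p.1 -> `|\int[Pm p.1]_y g i y - \int[Pm m]_y g i y| < del / 2) /\
    ball x r p.2].
  pose L0 : tests := ([seq g i | i <- enum 'I_k], r).
  exists (A, finer L0) => /=.
    split.
      exists ([set m' | forall i, K m' -> `|\int[Pm m']_y g i y - \int[Pm m]_y g i y| < del / 2],
        ball x r) => /=.
        split; last exact: nbhsx_ballx.
        have Hi i : \forall m' \near m, K m' -> `|\int[Pm m']_y g i y - \int[Pm m]_y g i y| < del / 2.
          by apply: Pmc => //; rewrite divr_gt0.
        exact: (filter_forall _ Hi).
      by move=> -[m' x'] [].
    exists L0 => //; split=> //= h; elim: (enum _) => //= i s IH [<-|//]; exact: cg.
  move=> [[m' x'] L] [/= [/= Am Ax] [[L2 _] Lr Lg]] [Km' Ox'] nu y nuO Oy [/= c1 c2] o.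
  have {}Lr : L.2 <= r by [].
  have gin i : List.In (g i) L.1.
    apply: Lg => /=; have : i \in enum 'I_k by rewrite mem_enum.
    elim: (enum _) => //= j s IH; rewrite in_cons => /predU1P[->|/IH]; by [left|right].
  have Ax' l : `|(x' : 'cV[R]_d) l 0 - (x : 'cV[R]_d) l 0| < r by rewrite distrC; exact: (cV_ball Ax l).
  have E0 (v : 'cV[R]_d) : (forall l, `|v l 0| <= 2 * r) -> enorm v < del.
    move=> h; apply: (@le_lt_trans _ _ (d%:R * (2 * r))).
      by apply: enorm_le_coord => //; rewrite mulr_ge0 // ltW.
    have -> : d%:R * (2 * r) = del * (d%:R / d.+1%:R).
      by rewrite /r; field; rewrite nat1r pnatr_eq0.
    by rewrite gtr_pMr // ltr_pdivrMr // mul1r ltr_nat.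
  apply: (etri _ _ (Lam (initial (Pm m)) x 0) o); apply: Hf => //.
  - exact: LI.
  - move=> i; rewrite !Rintegral_initial //.
    have := c1 _ (gin i); have := Am i Km'; rewrite /g.
    move: (\int[nu]_y _) (\int[Pm m']_y _) (\int[Pm m]_y _) => a b c.
    by rewrite !ltr_norml => /andP[h1 h2] /andP[h3 h4]; apply/andP; split; lra.
  - apply: E0 => l; rewrite !mxE; have := c2 l; have := Ax' l.
    by rewrite ltr_norml ler_norml ltr_norml => /andP[h1 h2] /andP[h3 h4]; apply/andP; split; lra.
  - by rewrite subrr normr0.
  - exact/LI/PmOm.
  - move=> i; rewrite !Rintegral_initial //.
    by apply: (lt_trans (Am i Km')); rewrite ltr_pdivrMr //; lra.
  - apply: E0 => l; rewrite !mxE; have := Ax' l.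
    by rewrite ltr_norml ler_norml => /andP[h1 h2]; apply/andP; split; lra.
  - by rewrite subrr normr0.
have [L [L0 Lc'] /(_ L) HL] := H.
have {}HL : K `*` Om `<=` Pr L by apply: HL.
have nthin (i : 'I_(size L.1)) : List.In (nth (fun=> 0) L.1 i) L.1.
  case: i => i /=; elim: L.1 i => //= g s IH [|i] h; [by left | by right; exact: IH].
have inth g : List.In g L.1 -> exists i : 'I_(size L.1), g = nth (fun=> 0) L.1 i.
  elim: L.1 => //= h s IH [->|/IH[i ->]]; first by exists ord0.
  by exists (lift ord0 i).
exists (size L.1), (fun i => nth (fun=> 0) L.1 i), L.2; split=> // [i|nu nu' x x' h h' Ox Ox' hf hx o].
  exact: Lc'.
(* [nu'] has the same test integrals as a parametrised law, so both [nu] and [nu'] are compared with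
   the latter, each at cost [eps / 2]. *)
have [m Km Em] := Pms nu' h'.
have h1 : `|Lam (initial nu) x 0 o 0 - Lam (initial (Pm m)) x' 0 o 0| < eps / 2.
  apply: (HL (m, x')) => //; split=> //= g hg; rewrite Em; last exact: Lc'.
  by have [i ->] := inth _ hg; exact: hf.
have h2 : `|Lam (initial nu') x' 0 o 0 - Lam (initial (Pm m)) x' 0 o 0| < eps / 2.
  apply: (HL (m, x')) => //; split=> [g hg|l] /=; last by rewrite subrr normr0.
  by rewrite Em ?subrr ?normr0 //; exact: Lc'.
by move: h1 h2; rewrite !ltr_norml => /andP[h1 h2] /andP[h3 h4]; apply/andP; split; lra.
Qed.

End UniformContinuity.

Lemma moment_collapse (R : realType) (d : nat) (P : probability (pt R d) R)
    (nu : probability (borelV R d) R) (g : 'cV[R]_d -> R) :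
  0 < fine (P (past 0)) ->
  \int[P]_z (g z.1 * \1_[set 0] z.2) = fine (tmarg P [set 0%R]) * \int[nu]_x g x ->
  moment P g = \int[nu]_x g x.
Proof. by move=> P0 E; rewrite /moment Itv00 E mulrC /tmarg -Itv00 mulKf // gt_eqF. Qed.

Theorem theorem2 (R : realType) (d d' : nat) (Om : set 'cV[R]_d) (C sig : R)
    (Lam : cmap R d d') :
  compact Om -> 0 < C -> 0 < sig < 1 ->
  weak_cont Om C sig Lam -> causal Om C sig Lam -> identifiable Om C sig Lam ->
  forall eps : R, 0 < eps ->
  exists N : net R d d',
    net_all (fun n (th : attn R n) =>
               (n <= d + 3 * d')%N /\ dhead th = 1%N /\ kdim th = 1%N /\
               (nheads th <= d')%N) N /\
    forall (mu : meas R d) (x : 'cV[R]_d) (t : R),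
      Lip Om C sig mu -> Om x -> I01 t ->
      enorm (net_eval N mu x t - Lam mu x t) <= eps.
Proof.
move=> cOm C0 sig01 Lc Lca Lid eps eps0.
have trivial_net : net_all (admissible d d') (net_one (id_attn R d) (mlp_aff 0 0 : mlp R d d')).
  by split=> //; exact: leq_addr.
have [d'0|d'0] := posnP d'.
  subst d'; exists (net_one (id_attn R d) (mlp_aff 0 0)); split=> // mu x t _ _ _.
  by rewrite (flatmx0 (_ - _)) /enorm /enorm2 big_ord0 sqrtr0 ltW.
have [[x0 Ox0]|Om0] := pselect (Om !=set0); last first.
  exists (net_one (id_attn R d) (mlp_aff 0 0)); split=> // mu x t _ Ox.
  by exfalso; apply: Om0; exists x.
(* Each output coordinate costs [2 * e] for the McShane formula and [e] for the network; the norm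
   adds at most a factor [d']. *)
pose e := eps / (3 * d'%:R).
have e0 : 0 < e by rewrite divr_gt0 // mulr_gt0 // ltr0n.
have [k [f [del [del0 cf Hf]]]] := Lam_initial_unif_continuous cOm C0 sig01 Lc e0 (ex_intro _ x0 Ox0).
pose T := {p : probability (borelV R d) R * 'cV[R]_d | p.1 Om = 1%E /\ Om p.2}.
pose c (a : T) (i : 'I_(k + d)) : R := match fintype.split i with
  inl j => \int[(sval a).1]_y f j y | inr l => (sval a).2 l 0 end.
have [B HB] : exists B : R, forall a i, `|c a i| <= B.
  have [M M0 HM] := compact_coord_bounded cOm.
  have HFb i : exists2 B : R, 0 < B & forall x, Om x -> `|f i x| <= B by exact: compact_bounded_fun.
  have [Bf HBf] := choice (fun i => let: ex_intro2 B b0 h := HFb i in ex_intro _ B (conj b0 h)).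
  exists (M + \sum_i Bf i) => -[[nu y] [/= nO Oy]] i; rewrite /c /=; case: fintype.split => [j|l].
    have h : `|\int[nu]_y f j y| <= Bf j.
      apply: (@Rintegral_norm_le _ _ _ nu Om) => //; last exact: (HBf j).2.
        exact: compact_measurableV.
      exact: measurable_continuousV.
    apply: (le_trans h); rewrite (bigD1 j) //= addrCA lerDl addr_ge0 ?(ltW M0) //.
    by apply: sumr_ge0 => i' _; apply: ltW; exact: (HBf i').1.
  by apply: (le_trans (HM _ Oy l)); rewrite lerDl; apply: sumr_ge0 => i' _; apply: ltW;
    exact: (HBf i').1.
pose h o (a : T) := Lam (initial (sval a).1) (sval a).2 0 o 0.
have hc o a b : (forall i, `|c a i - c b i| < del) -> `|h o a - h o b| <= e.
  case: a b => -[nu y] [/= nO Oy] [[nu' y'] [/= nO' Oy']] hab; apply: ltW.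
  apply: Hf => // [i|l].
    by have := hab (lshift d i); rewrite /c (unsplitK (inl i) : fintype.split (lshift d i) = inl i).
  by have := hab (rshift k l); rewrite /c (unsplitK (inr l) : fintype.split (rshift k l) = inr l).
have hM o : exists VKj : R * R * seq (R * ('I_(k + d) -> R)), 0 <= VKj.1.2 /\
    forall a, `|h o a - mcshane VKj.1.1 VKj.1.2 VKj.2 (c a)| <= 2 * e.
  by have [V [K [js HK]]] := mcshane_approx del0 e0 HB (hc o); exists (V, K, js).
have [vkj Hvkj] := choice hM.
have [N [okN HN]] := @network_mcshane R d d' Om C sig cOm sig01 d'0 k f cf
  (fun o => (vkj o).1.1) (fun o => (vkj o).1.2) (fun o => (vkj o).2) e e0 (fun o => (Hvkj o).1).
exists N; split=> // mu x t Lmu Ox It.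
have [[P PE] _] := Lmu; rewrite -PE in Lmu *.
have [nu [nO nuI nuL]] := collapse cOm C0 sig01 Lc Lca Lid Lmu.
have P0 : 0 < fine (P (past 0)) by apply: lt_le_trans (Lip_past_ge Lmu); case/andP: sig01.
pose a : T := exist _ (nu, x) (conj nO Ox).
(* The features computed by the network from [P] are those of the law at time 0 supplied by
   [collapse], so both approximations speak of the same formula. *)
have fE : feature f P x = c a.
  apply/funext => i; rewrite /feature /c; case: fintype.split => // j /=.
  by apply: moment_collapse => //; exact: nuI.
have -> : eps = d'%:R * (3 * e) by rewrite /e; field; rewrite pnatr_eq0 -lt0n.
apply: enorm_le_coord; first by rewrite mulr_ge0 // ltW.
move=> o; rewrite !mxE nuL //.
have h1 := HN P Lmu x t Ox It o; have h2 := (Hvkj o).2 a.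
move: h1 h2; rewrite fE /h /= !ler_norml => /andP[h1 h2] /andP[h3 h4].
by apply/andP; split; lra.
Qed.
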